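(* Let $d\ge 1$, let $A$ be a $d\times d$ matrix with integer entries and with all eigenvalues strictly larger than $1$ in modulus, define $N:=|\det A|$ and suppose that $N>2$. For each $u_1,\ldots,u_N\in\mathbb{R}^d$ define an iterated function system $(T_1,\ldots,T_N)$ acting on $\mathbb{R}^d$ by $T_jx:=A^{-1}x+u_j$ for every $j=1,\ldots,N$, and let $\nu$ denote the unique Borel probability measure on $\mathbb{R}^d$ which satisfies $\nu=\frac1N\sum_{j=1}^N (T_j)_*\nu$. If $u_1,\ldots,u_N\in\bigcup_{m\ge 0}A^{-m}\mathbb{Z}^d$, then the associated iterated function system $(T_1,\ldots,T_N)$ satisfies exactly one of the following: (i) The open set condition is satisfied, the attractor has positive Lebesgue measure and is equal to the closure of its interior, and $\nu$ is the normalised restriction of Lebesgue measure to the attractor. (ii) Exact overlaps exist, the attractor has upper box dimension strictly smaller than $d$, and the measure $\nu$ is singular with respect to Lebesgue measure. Additionally, each of (i) and (ii) is satisfied for a dense set of $(u_1,\ldots,u_N)\in\left(\bigcup_{m\ge0}A^{-m}\mathbb{Z}^d\right)^N$, and in particular each holds for a dense set of $(u_1,\ldots,u_N)\in(\mathbb{R}^d)^N$.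
   Context: Since all eigenvalues of $A$ exceed $1$ in modulus, there is a norm on $\mathbb{R}^d$ with respect to which all of the maps $T_j$ are contractions. The attractor of $(T_1,\ldots,T_N)$ is the unique nonempty compact set $X\subset\mathbb{R}^d$ such that $X=\bigcup_{j=1}^N T_jX$. The system $(T_1,\ldots,T_N)$ satisfies the open set condition if there exists a nonempty open set $U\subset\mathbb{R}^d$ such that $T_jU\subseteq U$ for every $j=1,\ldots,N$ and $T_jU\cap T_kU=\emptyset$ whenever $j\ne k$. The system has exact overlaps if there are two distinct words $j_1j_2\cdots j_n\in\{1,\ldots,N\}^n$ and $k_1k_2\cdots k_m\in\{1,\ldots,N\}^m$ (with $n,m\ge1$) such that $T_{j_1}T_{j_2}\cdots T_{j_n}=T_{k_1}T_{k_2}\cdots T_{k_m}$ as maps of $\mathbb{R}^d$. $(T_j)_*\nu$ denotes the push-forward of $\nu$ under $T_j$. The set $\left(\bigcup_{m\ge0}A^{-m}\mathbb{Z}^d\right)^N$ carries the subspace topology inherited from $(\mathbb{R}^d)^N$. *)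

(* Defs.v *)
From HB Require Import structures.
From mathcomp Require Import all_boot all_order all_algebra.
From mathcomp Require Import all_classical all_reals all_analysis.
From mathcomp Require Import measurable_realfun complex.

Set Implicit Arguments.
Unset Strict Implicit.
Unset Printing Implicit Defensive.

Import Order.TTheory GRing.Theory Num.Theory.
Import numFieldNormedType.Exports.

Local Open Scope classical_set_scope.
Local Open Scope ring_scope.

Notation borel T := (g_sigma_algebraType (open : set (set T))).

Section lebesgue_cV.
Context (R : realType).

Definition cV_cons n (p : R * 'cV[R]_n) : 'cV[R]_n.+1 := col_mx p.1%:M p.2.

(* d-dimensional Lebesgue measure on the Borel sets of the space of column
   vectors: the d-fold product of the Lebesgue measure of R, transported along
   (x, v) |-> (x; v). It is shown below to be a sigma-finite measure giving
   each open cube of side 2r the mass (2r)^d, which determines it. *)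
Fixpoint lebesgue_cV n : set (borel 'cV[R]_n) -> \bar R :=
  match n with
  | 0 => dirac (0 : borel 'cV[R]_0)
  | m.+1 => pushforward (T1 := (measurableTypeR R * borel 'cV[R]_m)%type)
              (T2 := borel 'cV[R]_m.+1)
              (lebesgue_measure \x @lebesgue_cV m)%E (@cV_cons m)
  end.

End lebesgue_cV.

Section lebesgue_cV_theory.
Context (R : realType).

Lemma cV_cons0 n (p : R * 'cV[R]_n) : cV_cons p ord0 ord0 = p.1.
Proof.
have -> : (ord0 : 'I_n.+1) = lshift n (ord0 : 'I_1) by exact/val_inj.
by rewrite /cV_cons (@col_mxEu _ 1 n 1) mxE eqxx mulr1n.
Qed.

Lemma cV_consS n (p : R * 'cV[R]_n) (i : 'I_n) :
  cV_cons p (lift ord0 i) ord0 = p.2 i ord0.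
Proof.
have -> : lift ord0 i = rshift 1 i by exact/val_inj.
by rewrite /cV_cons (@col_mxEd _ 1 n 1).
Qed.

Lemma preimage_ball_cV_cons n (c : 'cV[R]_n.+1) (r : R) :
  @cV_cons R n @^-1` ball c r =
  ball (c ord0 ord0) r `*` ball (\col_i c (lift ord0 i) ord0) r.
Proof.
apply/seteqP; split => [[x v]|[x v]].
  move=> [r0 cr]; split => /=; first by have := cr ord0 ord0; rewrite cV_cons0.
  split => // i j; have := cr (lift ord0 i) ord0.
  by rewrite cV_consS mxE (ord1 j).
move=> [/= xr [r0 vr]]; split => // i j; rewrite (ord1 j).
case: (unliftP ord0 i) => [k ->|->]; last by rewrite cV_cons0.
by rewrite cV_consS; have := vr k ord0; rewrite mxE.
Qed.

Lemma measurable_borel_open (T : ptopologicalType) (U : set T) :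
  open U -> measurable (U : set (borel T)).
Proof. by move=> oU; exact: sub_gen_smallest. Qed.

Lemma measurable_ball_cV n (c : 'cV[R]_n) (r : R) :
  measurable (ball c r : set (borel 'cV[R]_n)).
Proof.
have [r0|r0] := ltP 0 r; last by rewrite le0_ball0.
have oB : open (ball c r) by exact: ball_open.
exact: sub_gen_smallest.
Qed.

Lemma open_cV_bigcup n (U : set 'cV[R]_n) : open U ->
  U = \bigcup_(q in [set q : 'cV[rat]_n * rat |
        ball (map_mx ratr q.1 : 'cV[R]_n) (ratr q.2) `<=` U])
      ball (map_mx ratr q.1 : 'cV[R]_n) (ratr q.2).
Proof.
move=> oU; apply/seteqP; split => [x Ux|x [q /= qU xq]]; last exact: qU.
have [e e0 xeU] : exists2 e : R, 0 < e & ball x e `<=` U.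
  have /nbhs_ballP[e /= e0 xe] : nbhs x U by exact: open_nbhs_nbhs.
  by exists e.
have e40 : e / 4 < e / 2 by rewrite ltr_pM2l// ltf_pV2 ?posrE// ltr_nat.
have [r] := rat_in_itvoo e40; rewrite in_itv/= => /andP[r1 r2].
have r0 : 0 < ratr r :> R by rewrite (lt_trans _ r1)// divr_gt0.
have /choice[q qx] : forall i, exists q : rat, `|ratr q - x i ord0| < ratr r.
  move=> i.
  have lt1 : x i ord0 - ratr r < x i ord0 + ratr r.
    by rewrite ltrD2l (lt_trans _ r0)// oppr_lt0.
  by have [q] := rat_in_itvoo lt1; rewrite in_itv/= -ltr_distl => xq; exists q.
have qx' : ball (map_mx ratr (\col_i q i) : 'cV[R]_n) (ratr r) x.
  by split => // i j; rewrite (ord1 j) !mxE; exact: qx.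
exists (\col_i q i, r) => //= y qy; apply: xeU.
apply: (@le_ball _ _ _ (ratr r + ratr r)).
  by rewrite (splitr e) ltW// ltrD.
by apply: ball_triangle qy; exact: ball_sym.
Qed.

Lemma measurable_cV_cons n :
  measurable_fun [set: measurableTypeR R * borel 'cV[R]_n]
    (@cV_cons R n : _ -> borel 'cV[R]_n.+1).
Proof.
have h := @measurability _ _ (measurableTypeR R * borel 'cV[R]_n)%type
  (borel 'cV[R]_n.+1) setT (@cV_cons R n) open erefl.
apply: h => // _ [U oU <-].
rewrite setTI (open_cV_bigcup oU) preimage_bigcup bigcup_mkcond.
apply: countable_bigcupT_measurable; first exact: countableP.
move=> q; case: ifPn => // _.
rewrite preimage_ball_cV_cons; apply: measurableX.
  exact: measurable_ball.
exact: measurable_ball_cV.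
Qed.

Lemma lebesgue_cV_sigma_finite n :
  exists mu : {sigma_finite_measure set (borel 'cV[R]_n) -> \bar R},
    lebesgue_cV (R := R) (n := n) = mu /\
    forall r, (mu (ball (0%R : 'cV[R]_n) r : set (borel 'cV[R]_n)) < +oo)%E.
Proof.
elim: n => [|n [mu [muE mu_fin]]].
  by exists (dirac (0 : borel 'cV[R]_0)); split => // r; exact: ltry.
have mC := @measurable_cV_cons n.
pose nu0 := measure_function_pushforward__canonical__measure_function_Measure
  (lebesgue_measure \x mu)%E mC.
have nuE : lebesgue_cV (R := R) (n := n.+1) = nu0 by rewrite /= -muE.
have nu_fin r :
  (nu0 (ball (0%R : 'cV[R]_n.+1) r : set (borel 'cV[R]_n.+1)) < +oo)%E.
  rewrite /nu0 /= /pushforward preimage_ball_cV_cons product_measure1E.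
  - rewrite mxE; have -> : \col_i (0 : 'cV[R]_n.+1) (lift ord0 i) ord0 = 0.
      by apply/colP => i; rewrite !mxE.
    have bfin : (lebesgue_measure (ball (0%R : R) r : set R) < +oo)%E.
      rewrite ball_itv lebesgue_measure_itv/=.
      by case: ifP => // _; rewrite -EFinB ltry.
    by rewrite lte_mul_pinfty// ge0_fin_numE.
  - exact: measurable_ball.
  - exact: measurable_ball_cV.
have nu_sf : sigma_finite [set: borel 'cV[R]_n.+1] nu0.
  exists (fun k => ball (0 : 'cV[R]_n.+1) k%:R); last first.
    by move=> k; split; [exact: measurable_ball_cV|exact: nu_fin].
  apply/esym; rewrite -subTset => x _; exists (Num.truncn `|x|).+1 => //.
  by rewrite mx_norm_ball /= sub0r normrN truncnS_gt.
pose nu : {sigma_finite_measure set (borel 'cV[R]_n.+1) -> \bar R} :=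
  HB.pack (Measure.sort nu0) (Measure.class nu0)
    (Measure_isSigmaFinite.Build _ _ _ nu0 nu_sf).
by exists nu.
Qed.

Section lebesgue_cV_instances.
Variable n : nat.
Let mu := sval (cid (lebesgue_cV_sigma_finite n)).
Let muE : lebesgue_cV (R := R) (n := n) = mu.
Proof. by rewrite /mu; case: cid => ? []. Qed.
Let lebesgue_cV0 : @lebesgue_cV R n set0 = 0%E.
Proof. by rewrite muE measure0. Qed.
Let lebesgue_cV_ge0 A : (0 <= @lebesgue_cV R n A)%E.
Proof. by rewrite muE. Qed.
Let lebesgue_cV_sigma_additive : semi_sigma_additive (@lebesgue_cV R n).
Proof. by rewrite muE; exact: measure_semi_sigma_additive. Qed.
HB.instance Definition _ := isMeasure.Build _ _ _ (@lebesgue_cV R n)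
  lebesgue_cV0 lebesgue_cV_ge0 lebesgue_cV_sigma_additive.
Let lebesgue_cV_sigma_finiteT : sigma_finite setT (@lebesgue_cV R n).
Proof. by rewrite muE; exact: sigma_finiteT. Qed.
HB.instance Definition _ :=
  Measure_isSigmaFinite.Build _ _ _ (@lebesgue_cV R n)
    lebesgue_cV_sigma_finiteT.
End lebesgue_cV_instances.

Lemma lebesgue_cV_ball n (c : 'cV[R]_n) (r : R) : 0 < r ->
  lebesgue_cV (ball c r) = ((r *+ 2) ^+ n)%:E.
Proof.
move=> r0; elim: n c => [|n IH] c.
  rewrite /= /dirac indicE mem_set//; split => // -[].
  by [].
rewrite /= /pushforward preimage_ball_cV_cons product_measure1E.
- rewrite exprS EFinM; congr (_ * _)%E; last exact: IH.
  by apply: lebesgue_measure_ball; exact: ltW.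
- exact: measurable_ball.
- exact: measurable_ball_cV.
Qed.

End lebesgue_cV_theory.

Section ifs.
Context (R : realType) (d N : nat).
Implicit Types (A : 'M[int]_d) (u : 'I_N -> 'cV[R]_d)
  (T : 'I_N -> 'cV[R]_d -> 'cV[R]_d).

Definition ifs_map A u (j : 'I_N) (x : 'cV[R]_d) : 'cV[R]_d :=
  invmx (map_mx intr A) *m x + u j.

Definition is_attractor T (X : set 'cV[R]_d) :=
  [/\ compact X, X !=set0 & X = \bigcup_j (T j @` X)].

(* Under the standing expanding hypothesis there is exactly one such X
   (resp. nu), so that [get] denotes it. *)
Definition attractor T : set 'cV[R]_d := get (is_attractor T).

Definition is_self_similar T (nu : probability (borel 'cV[R]_d) R) :=
  forall B : set (borel 'cV[R]_d), measurable B ->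
    nu B = (N%:R^-1%:E *
      \sum_(j < N) pushforward nu (T j : borel _ -> borel _) B)%E.

Definition self_similar_measure T : probability (borel 'cV[R]_d) R :=
  get (is_self_similar T).

Definition open_set_condition T :=
  exists U : set 'cV[R]_d, [/\ open U, U !=set0,
    forall j, T j @` U `<=` U &
    forall j k, j != k -> T j @` U `&` T k @` U = set0].

(* word_map T [:: j1; ...; jn] is T_j1 \o ... \o T_jn *)
Definition word_map T (w : seq 'I_N) : 'cV[R]_d -> 'cV[R]_d :=
  foldr (fun j f => T j \o f) idfun w.

Definition exact_overlaps T :=
  exists v w : seq 'I_N,
    [/\ v != [::], w != [::], v != w & word_map T v = word_map T w].

(* Balls are those of the sup norm; the box dimension does not depend on the
   choice of the norm. *)
Definition covering_number (X : set 'cV[R]_d) (e : R) : \bar R :=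
  ereal_inf [set n%:R%:E | n in [set n |
    exists c : 'I_n -> 'cV[R]_d, X `<=` \bigcup_i ball (c i) e]].

(* limsup as e -> 0+ of log N(X, e) / log (1 / e) *)
Definition upper_box_dimension (X : set 'cV[R]_d) : \bar R :=
  limf_esup (fun e : R => lne (covering_number X e) / (- ln e)%:E)%E 0^'+.

Definition lebesgue_singular (nu : set (borel 'cV[R]_d) -> \bar R) :=
  exists B : set (borel 'cV[R]_d),
    [/\ measurable B, lebesgue_cV B = 0%E & nu (~` B) = 0%E].

Definition lattice_union A : set 'cV[R]_d :=
  [set x | exists (m : nat) (z : 'cV[int]_d),
     x = invmx (map_mx intr A) ^+ m *m map_mx intr z].

(* {ptws 'I_N -> _} is the finite power with its product topology; as a type,
   the set below carries the subspace topology. *)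
Definition lattice_tuples A : set {ptws 'I_N -> 'cV[R]_d} :=
  [set u | forall j, lattice_union A (u j)].

Definition tiling_case A u :=
  let T := ifs_map A u in let X := attractor T in
  [/\ open_set_condition T,
      (0 < lebesgue_cV X)%E,
      X = closure (interior X) &
      forall B : set (borel 'cV[R]_d), measurable B ->
        self_similar_measure T B = (lebesgue_cV (B `&` X) / lebesgue_cV X)%E].

Definition overlap_case A u :=
  let T := ifs_map A u in
  [/\ exact_overlaps T,
      (upper_box_dimension (attractor T) < d%:R%:E)%E &
      lebesgue_singular (self_similar_measure T)].

End ifs.
Arguments lattice_tuples R {d} N A.

(* Main.v *)
(* Write B = A^-1 and T_w x = B^n x + t_w for a word w of length n, let X be the
   attractor, nu the self-similar measure and lambda the Lebesgue measure; then
   lambda (T_w E) = N^-n lambda E.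

   Exact overlaps: comparing determinants, two words with the same map have the
   same length p, so X is covered by fewer than N^p copies of B^p X. Iterating,
   the a^-k-neighbourhood of X has measure at most theta^k K with theta < 1 < a,
   which bounds the covering numbers and gives lambda X = 0, while nu X = 1.

   No exact overlaps: for |w| = n the points A^n t_w are distinct and lie in a
   fixed lattice. If X had empty interior, a small open set U would have all its
   copies T_w U, |w| = n, disjoint from each other and from X, although they
   accumulate on X and have total measure lambda U. Hence the interior of X is
   not empty, the T_j X tile X up to null sets, and normalized Lebesgue
   measure on X is self-similar, so it is nu. The interior of X witnesses the
   open set condition.

   Density of tilings: approximate u by u_j = B^m z_j with the z_j pairwise
   incongruent modulo A; then the words have distinct base-A expansions.

   Density of overlaps: approximate u by lattice points such that all u_j but one
   lie in B^m Z^d, and the last one avoids finitely many nowhere dense sets, so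
   that the Fourier transform of nu does not vanish at r = 2 pi e^T A^m. It
   satisfies nu^(r) = p(r) nu^(r B) with p(r) = N^-1 sum_j exp (i r u_j), and for
   large n the factors p(r A^n) are 1 while the earlier ones are non-zero because
   N > 2. So nu^(r A^n) does not tend to 0, whereas without exact overlaps nu
   would be absolutely continuous and Riemann-Lebesgue would apply. *)

Require Import Defs.
From HB Require Import structures.
From mathcomp Require Import all_boot all_order all_algebra.
From mathcomp Require Import all_classical all_reals all_analysis.
From mathcomp Require Import complex.
From mathcomp Require Import measurable_realfun perm ring lra zify.

Set Implicit Arguments.
Unset Strict Implicit.
Unset Printing Implicit Defensive.

Import Order.TTheory GRing.Theory Num.Theory.
Import numFieldNormedType.Exports.

Local Open Scope classical_set_scope.
Local Open Scope ring_scope.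

(** * Powers of matrices *)

(** The matrix B need not contract the sup norm; only its powers decay, |B^k x| <= C q^k |x|
    ([geometric]). Hence no step relies on a single map being a contraction. The attractor is built
    as the closure of the orbit of one fixed point under all words, and nu as the law of a digit
    coding of [0, 1). Uniqueness of nu and its concentration on X both come from comparing nu with
    the distribution of T_w x0 over long words w.

    The volume factor N^-n rests on the change of variables formula for linear maps. The Lebesgue
    measure of a linear image is shift invariant, hence proportional to Lebesgue measure. The ratio
    is at most |det| for triangular and permutation matrices, so for all invertible ones by
    factorization, and the same bound for the inverse turns this into an equality.

    Density of overlaps exhibits no pair of coinciding words: their existence is deduced from the
    behaviour of the Fourier transform alone. All estimates used to choose the last translation must
    therefore be uniform in it, which is why bounds on X are expressed by a bound on the |u_j|. *)

Lemma exprmxSr (K : pzRingType) n (M : 'M[K]_n) k : M ^+ k.+1 = M ^+ k *m M.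
Proof. by rewrite exprSr. Qed.

Lemma exprmxS (K : pzRingType) n (M : 'M[K]_n) k : M ^+ k.+1 = M *m M ^+ k.
Proof. by rewrite exprS. Qed.

Lemma exprmxD (K : pzRingType) n (M : 'M[K]_n) k l :
  M ^+ (k + l) = M ^+ k *m M ^+ l.
Proof. by rewrite exprD. Qed.

Lemma map_mx_exp (K L : pzRingType) (f : {rmorphism K -> L}) n (M : 'M[K]_n) k :
  map_mx f (M ^+ k) = map_mx f M ^+ k.
Proof.
elim: k => [|k IH]; first by rewrite !expr0 map_mx1.
by rewrite !exprmxS map_mxM IH.
Qed.

Section row_sums.
Context (K : numDomainType) (n : nat).
Implicit Types (M P : 'M[K]_n) (a b : K).

(** A bound on the operator norm for the sup norm, written with entries so that it applies to real
    and complex matrices alike. *)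
Definition row_sum_le M a := forall i, \sum_j `|M i j| <= a.

Lemma row_sum_le_mul M P a b : 0 <= b ->
  row_sum_le M a -> row_sum_le P b -> row_sum_le (M *m P) (a * b).
Proof.
move=> b0 Ma Pb i.
apply: (@le_trans _ _ (\sum_j \sum_k `|M i k| * `|P k j|)).
  apply: ler_sum => j _; rewrite mxE (le_trans (ler_norm_sum _ _ _))//.
  by apply: ler_sum => k _; rewrite normrM.
rewrite exchange_big/=; apply: (@le_trans _ _ (\sum_k `|M i k| * b)).
  by apply: ler_sum => k _; rewrite -mulr_sumr ler_wpM2l.
by rewrite -mulr_suml ler_wpM2r.
Qed.

Lemma row_sum_le1 : row_sum_le 1%:M 1.
Proof.
move=> i; rewrite (bigD1 i)//= big1 ?addr0 => [|j ji].
  by rewrite mxE eqxx normr1.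
by rewrite mxE eq_sym (negbTE ji) normr0.
Qed.

Lemma row_sum_le_exp M a k : 0 <= a ->
  row_sum_le M a -> row_sum_le (M ^+ k) (a ^+ k).
Proof.
move=> a0 Ma; elim: k => [|k IH]; first exact: row_sum_le1.
by rewrite !exprS; apply: row_sum_le_mul => //; exact: exprn_ge0.
Qed.

Lemma row_sum_le_ex M : row_sum_le M (\sum_i \sum_j `|M i j|).
Proof.
by move=> i; rewrite [leRHS](bigD1 i)//= lerDl sumr_ge0 // => k _; exact: sumr_ge0.
Qed.

Lemma row_sum_le_entry M a i j : row_sum_le M a -> `|M i j| <= a.
Proof.
by move=> /(_ i); apply: le_trans; rewrite (bigD1 j)//= lerDl sumr_ge0.
Qed.

End row_sums.

(** * Geometric decay of the powers of a matrix of spectral radius below 1 *)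

Section conj_triangular.
Context (K : numFieldType) (n : nat).

(* Conjugating a triangular matrix by diag (t ^ r i) multiplies its
   off-diagonal entries by positive powers of t, so they are negligible for
   small t. The rank r covers lower and upper triangular matrices at once. *)
Lemma conj_triangular_row_sum (T : 'M[K]_n) (r : 'I_n -> nat) (e : K) :
  (forall i j, i != j -> T i j != 0 -> (r j < r i)%N) -> 0 < e ->
  exists D D' : 'M[K]_n, [/\ D *m D' = 1%:M, D' *m D = 1%:M &
    forall i, \sum_j `|(D *m T *m D') i j| <= `|T i i| + e].
Proof.
move=> Tr e0; pose S := \sum_i \sum_j `|T i j|.
have S0 : 0 <= S by apply: sumr_ge0 => i _; exact: sumr_ge0.
(* This choice gives [t <= 1], so that every positive power of [t] is at most [t], and
   [t * S <= e]. *)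
pose t := e / (S + e).
have Se0 : 0 < S + e by rewrite ltr_wpDl.
have t0 : 0 < t by rewrite divr_gt0.
have t1 : t <= 1 by rewrite ler_pdivrMr// mul1r lerDr.
have tS : t * S <= e.
  by rewrite /t mulrAC ler_pdivrMr// ler_pM2l// lerDl ltW.
have tn0 : t != 0 by rewrite gt_eqF.
pose D := diag_mx (\row_i t ^+ r i) : 'M[K]_n.
pose D' := diag_mx (\row_i (t ^+ r i)^-1) : 'M[K]_n.
have DD' : D *m D' = 1%:M.
  rewrite /D /D' mulmx_diag -diag_const_mx; congr diag_mx.
  by apply/rowP => i; rewrite !mxE divff// expf_neq0.
have D'D : D' *m D = 1%:M.
  rewrite /D /D' mulmx_diag -diag_const_mx; congr diag_mx.
  by apply/rowP => i; rewrite !mxE mulVf// expf_neq0.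
exists D, D'; split => // i.
have ent j : (D *m T *m D') i j = t ^+ r i * T i j * (t ^+ r j)^-1.
  by rewrite /D' mul_mx_diag mxE /D mul_diag_mx !mxE.
rewrite (bigD1 i)//= ent mulrAC divff ?expf_neq0// mul1r lerD2l.
apply: (le_trans _ tS).
apply: (@le_trans _ _ (\sum_j t * `|T i j|)).
  rewrite [leRHS](bigD1 i)//=; apply: ler_wpDl; first by apply: mulr_ge0 => //; exact: ltW.
  apply: ler_sum => j ji; rewrite ent !normrM.
  have [->|Tij] := eqVneq (T i j) 0; first by rewrite normr0 mulr0 mul0r mulr0.
  have rij := Tr i j _ Tij; rewrite eq_sym in ji; have {}rij := rij ji.
  rewrite mulrAC ler_wpM2r//.
  rewrite ger0_norm ?exprn_ge0 ?(ltW t0)// gtr0_norm ?invr_gt0 ?exprn_gt0//.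
  rewrite ler_pdivrMr ?exprn_gt0// -exprS.
  by apply: ler_wiXn2l => //; rewrite ltW.
rewrite -mulr_sumr ler_wpM2l// ?(ltW t0)//.
exact: row_sum_le_ex.
Qed.

End conj_triangular.

Section spectral_radius.
Context (R : realType) (n : nat).

Lemma char_poly_trig (K : fieldType) (T : 'M[K]_n) :
  is_trig_mx T -> char_poly T = \prod_i ('X - (T i i)%:P).
Proof.
move=> /is_trig_mxP Ttrig; rewrite /char_poly det_trig.
  by apply: eq_bigr => i _; rewrite !mxE eqxx mulr1n.
apply/is_trig_mxP => i j ij.
by rewrite !mxE Ttrig// lt_eqF// mulr0n polyC0 subr0.
Qed.

Lemma eigenvalue_trig_conj (K : fieldType) (M T P P' : 'M[K]_n) i :
  P *m P' = 1%:M -> P *m M *m P' = T -> is_trig_mx T -> eigenvalue M (T i i).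
Proof.
move=> PP' MT Ttrig; have : eigenvalue T (T i i).
  rewrite eigenvalue_root_char char_poly_trig//; apply/rootP.
  by rewrite horner_prod (bigD1 i)//= hornerXsubC subrr mul0r.
case/eigenvalueP => v vT v0; apply/eigenvalueP; exists (v *m P).
  by rewrite scalemxAl -vT -MT -!mulmxA (mulmx1C PP') mulmx1.
apply: contra_neq v0 => vP0.
by rewrite -[v]mulmx1 -PP' mulmxA vP0 mul0mx.
Qed.

(** Over the complex numbers [M] is unitarily conjugate to a triangular matrix with the eigenvalues
    on its diagonal. A further diagonal conjugation makes all row sums at most some [q' < 1]; taking
    powers, the two conjugations only cost a constant factor. *)
Lemma exp_geometric_bound (M : 'M[R]_n) : (0 < n)%N ->
  (forall z : R[i], eigenvalue (map_mx (real_complex R) M) z -> `|z| < 1) ->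
  exists C q : R, [/\ 0 < C, 0 < q, q < 1 &
    forall k i j, `|(M ^+ k) i j| <= C * q ^+ k].
Proof.
move=> n0 Mev; set Mc := map_mx _ M in Mev.
have [P Pu Ptrig] := Schur Mc n0.
have Punit := unitarymx_unit Pu.
pose T := P *m Mc *m invmx P.
have Ttrig : is_trig_mx T by rewrite /T -conjumx.
have Tev i : `|T i i| < 1.
  apply: Mev.
  exact: (@eigenvalue_trig_conj R[i] Mc T P (invmx P) i (mulmxV Punit)).
have [q [q0 q1 Tq]] : exists q : R, [/\ 0 < q, q < 1 &
    forall i, `|T i i| <= (q%:C)%C].
  (* Starting the maximum at [2^-1] keeps [q] positive even if all eigenvalues vanish. *)
  exists (\big[Order.max/2^-1]_i complex.Re `|T i i|); split.
  - by apply/bigmax_gtP; left; rewrite invr_gt0.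
  - apply: bigmax_lt; first by rewrite invf_lt1// ltr1n.
    move=> i _; have := Tev i; rewrite [X in X < _](_ : _ = ((complex.Re `|T i i|)%:C)%C).
      by rewrite (_ : 1 = (1%:C)%C)// ltcR.
    by rewrite RRe_real// normr_real.
  - move=> i; rewrite -[`|T i i|]RRe_real ?normr_real// lecR.
    exact: le_bigmax.
(* The gap [q' - q] is the room left for the off-diagonal entries. *)
pose q' := (q + 1) / 2.
have qq' : q < q' by rewrite /q' ltr_pdivlMr// mulr2n mulrDr mulr1 ltrD2l.
have q'1 : q' < 1 by rewrite /q' ltr_pdivrMr// mul1r mulr2n ltrD2r.
have e0 : (0 : R[i]) < ((q' - q)%:C)%C by rewrite ltcR subr_gt0.
have [i j ij Tij|D [D' [DD' D'D TD]]] :=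
    @conj_triangular_row_sum R[i] n T (fun i => i) _ _ e0.
  rewrite ltnNge; apply: contra Tij => ij'; apply/eqP.
  by apply: (is_trig_mxP Ttrig); rewrite ltn_neqAle ij' andbT.
pose T' := D *m T *m D'.
have T'q : row_sum_le T' (q'%:C)%C.
  move=> i; rewrite (le_trans (TD i))// (le_trans (lerD (Tq i) (lexx _)))//.
  by rewrite -rmorphD/= addrC subrK.
pose Q := D *m P; pose Q' := invmx P *m D'.
have MT' k : Mc ^+ k = Q' *m T' ^+ k *m Q.
  have QQ' : Q *m Q' = 1%:M.
    by rewrite /Q /Q' mulmxA -(mulmxA D) mulmxV// mulmx1.
  have Q'Q := mulmx1C QQ'.
  have T'Q : T' *m Q = Q *m Mc.
    have -> : T' = Q *m Mc *m Q' by rewrite /T' /T /Q /Q' !mulmxA.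
    by rewrite -mulmxA Q'Q mulmx1.
  move: T' Q Q' QQ' Q'Q T'Q {T'q} => T' Q Q' QQ' Q'Q T'Q.
  elim: k => [|k IH]; first by rewrite !expr0 mulmx1 Q'Q.
  by rewrite !exprmxSr IH -!mulmxA T'Q.
pose a := \sum_i \sum_j `|Q' i j|; pose b := \sum_i \sum_j `|Q i j|.
have a0 : 0 <= a by apply: sumr_ge0 => i _; exact: sumr_ge0.
have b0 : 0 <= b by apply: sumr_ge0 => i _; exact: sumr_ge0.
have q'0 : 0 < q' by rewrite (lt_trans q0).
have cq'0 : (0 : R[i]) <= (q'%:C)%C by rewrite lecR ltW.
exists (complex.Re (a * b) + 1), q'; split => //.
  rewrite ltr_pwDr//.
  have : 0 <= a * b by rewrite mulr_ge0.
  by rewrite -[a * b]RRe_real ?realM ?ger0_real// lecR.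
move=> k i j.
have /row_sum_le_entry : row_sum_le (Mc ^+ k) (a * (q'%:C)%C ^+ k * b).
  rewrite MT'; apply: row_sum_le_mul => //; last exact: row_sum_le_ex.
  apply: row_sum_le_mul; [exact: exprn_ge0|exact: row_sum_le_ex|].
  exact: row_sum_le_exp.
move=> /(_ i j).
have -> : (Mc ^+ k) i j = (((M ^+ k) i j)%:C)%C.
  by rewrite /Mc -map_mx_exp mxE.
rewrite mulrAC -[a * b]RRe_real ?realM ?ger0_real//.
rewrite -rmorphXn -rmorphM/= normc_def/= expr0n addr0 sqrtr_sqr lecR => /le_trans; apply.
by rewrite ler_wpM2r ?exprn_ge0 ?(ltW q'0)// lerDl.
Qed.

End spectral_radius.

(** * Lebesgue measure on column vectors *)

Section cV_norm.
Context (R : realType) (n : nat).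
Implicit Types (x y c : 'cV[R]_n) (M : 'M[R]_n) (r : R).

Lemma cV_norm_le x r : 0 <= r -> (forall i, `|x i ord0| <= r) -> `|x| <= r.
Proof.
move=> r0 xr; rewrite [leLHS]/Num.norm/= mx_normrE; apply: bigmax_le => // -[i j] _.
by rewrite (ord1 j).
Qed.

Lemma cV_coord_le x i : `|x i ord0| <= `|x|.
Proof.
rewrite [leRHS]/Num.norm/= mx_normrE.
exact: (le_bigmax (0 : R) (fun ij : 'I_n * 'I_1 => `|x ij.1 ij.2|) (i, ord0)).
Qed.

Lemma cV_ballE c r x : ball c r x = (`|c - x| < r) :> Prop.
Proof. by rewrite mx_norm_ball. Qed.

End cV_norm.

Section cV_topology.
Context (R : realType) (n : nat).
Implicit Types (x y c : 'cV[R]_n) (M : 'M[R]_n) (r : R).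

Lemma mulmx_norm_le (m : nat) (M : 'M[R]_m) a (x : 'cV[R]_m) : row_sum_le M a -> `|M *m x| <= a * `|x|.
Proof.
case: m x M => [|m] x M Ma.
  by rewrite !flatmx0 normr0 mulr0.
have a0 : 0 <= a by rewrite (le_trans _ (Ma ord0))// sumr_ge0.
apply: cV_norm_le => [|i]; first by rewrite mulr_ge0.
rewrite mxE (le_trans (ler_norm_sum _ _ _))//.
apply: (@le_trans _ _ (\sum_j `|M i j| * `|x|)).
  by apply: ler_sum => j _; rewrite normrM ler_wpM2l// cV_coord_le.
by rewrite -mulr_suml ler_wpM2r.
Qed.

Lemma lipschitz_cV_continuous (f : 'cV[R]_n -> 'cV[R]_n) a :
  (forall x y, `|f x - f y| <= a * `|x - y|) -> continuous f.
Proof.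
move=> fa x; apply/(@cvgrPdist_lt _ _ _ _ (nbhs_filter x)) => e e0.
have a10 : 0 < `|a| + 1 by rewrite ltr_wpDl.
near=> y; apply: (le_lt_trans (fa x y)).
apply: (@le_lt_trans _ _ ((`|a| + 1) * `|x - y|)).
  by rewrite ler_wpM2r// (le_trans (ler_norm a))// lerDl.
rewrite -ltr_pdivlMl//; near: y.
apply: (@cvgr_dist_lt _ _ _ (nbhs x) _ id x) => //.
by rewrite mulr_gt0// invr_gt0.
Unshelve. all: by end_near. Qed.

Lemma mulmx_cV_continuous M : continuous (fun x => M *m x).
Proof.
apply: lipschitz_cV_continuous => x y; rewrite -mulmxBr.
exact: mulmx_norm_le (row_sum_le_ex M).
Qed.

Lemma shift_cV_continuous c : continuous (fun x => x + c).
Proof.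
apply: (@lipschitz_cV_continuous _ 1) => x y.
by rewrite mul1r opprD addrACA subrr addr0.
Qed.

(** Transposition reduces the claim to row vectors. *)
Lemma bounded_closed_compact_cV (X : set 'cV[R]_n) r :
  (forall x, X x -> `|x| <= r) -> closed X -> compact X.
Proof.
move=> Xr cX.
have trc p q : continuous (@trmx R p q).
  move=> x A [P Px PA]; exists (fun i j => P j i).
    by move=> i j; have := Px j i; rewrite mxE.
  by move=> y Py; apply: PA => i j; rewrite mxE; exact: Py.
have -> : X = @trmx R 1 n @` ((@trmx R 1 n) @^-1` X).
  apply/seteqP; split => [x Xx|_ [y Xy <-]//].
  by exists x^T; rewrite /= trmxK.
apply: continuous_compact; first by apply/continuous_subspaceT; exact: trc.
apply: bounded_closed_compact.
  exists r; split; first exact: num_real.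
  move=> s rs y /Xr yr; apply: (le_trans _ (ltW rs)).
  have r0 := le_trans (normr_ge0 _) yr.
  rewrite [leLHS]/Num.norm/= mx_normrE; apply: bigmax_le => // -[i j] _.
  rewrite (ord1 i)/=; have := cV_coord_le y^T j; rewrite mxE => /le_trans; exact.
by apply: preimage_closed => // y _; exact: trc.
Qed.

Lemma compact_bounded_cV (X : set 'cV[R]_n) : compact X ->
  exists2 r : R, 0 < r & forall x, X x -> `|x| <= r.
Proof.
move=> /compact_bounded[M [_ XM]].
exists (`|M| + 1); first by rewrite ltr_wpDl.
by apply: XM; rewrite (le_lt_trans (ler_norm M))// ltrDl.
Qed.

Lemma closed_compact_cV (X : set 'cV[R]_n) : compact X -> closed X.
Proof. by apply: compact_closed; exact: norm_hausdorff. Qed.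

End cV_topology.

Section borel_measurable.
Context (R : realType) (n : nat).
Implicit Types (x y c : 'cV[R]_n) (M : 'M[R]_n).

Lemma measurable_borel_closed (T : ptopologicalType) (C : set T) :
  closed C -> measurable (C : set (borel T)).
Proof.
move=> cC; rewrite -[C]setCK; apply: measurableC; apply: measurable_borel_open.
exact: closed_openC.
Qed.

Lemma continuous_borel (S T : ptopologicalType) (f : S -> T) :
  continuous f -> measurable_fun [set: borel S] (f : borel S -> borel T).
Proof.
move=> /continuousP cf.
apply: (@measurability _ _ (borel S) (borel T) setT f open erefl).
move=> _ [U oU <-]; rewrite setTI; apply: measurable_borel_open; exact: cf.
Qed.

(** Open sets are countable unions of rational balls, and the preimage of a sup-norm ball is a
    finite intersection of conditions on single coordinates. *)
Lemma measurable_fun_cV d (T : measurableType d) (f : T -> 'cV[R]_n) :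
  (forall i, measurable_fun [set: T] (fun t => f t i ord0)) ->
  measurable_fun [set: T] (f : T -> borel 'cV[R]_n).
Proof.
move=> mf.
apply: (@measurability _ _ T (borel 'cV[R]_n) setT f open erefl).
move=> _ [U oU <-].
rewrite setTI (open_cV_bigcup oU) preimage_bigcup bigcup_mkcond.
apply: countable_bigcupT_measurable; first exact: countableP.
move=> [q r]; case: ifPn => //= _.
have [r0|r0] := ltP 0 (ratr r : R); last first.
  by rewrite le0_ball0// preimage_set0.
rewrite (_ : _ @^-1` _ = \bigcap_(i in [set: 'I_n])
    (fun t => f t i ord0) @^-1` ball (ratr (q i ord0) : R) (ratr r)); last first.
  apply/seteqP; split=> [t [_ h] i _|t h].
    by have := h i ord0; rewrite mxE.
  by split=> // i j; rewrite (ord1 j) mxE; exact: h.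
apply: fin_bigcap_measurable => // i _.
rewrite -[X in measurable X]setTI; apply: mf => //; exact: measurable_ball.
Qed.

Lemma measurable_coord_cV i :
  measurable_fun [set: borel 'cV[R]_n] (fun x => x i ord0 : R).
Proof.
have h := @measurability _ _ (borel 'cV[R]_n) (measurableTypeR R) setT
  (fun x => x i ord0) (@RGenOpens.G R) (@RGenOpens.measurableE R); apply: h.
move=> _ [_ [a [b ->]] <-]; rewrite setTI; apply: measurable_borel_open.
by apply: open_comp; [move=> x _; exact: coord_continuous|exact: interval_open].
Qed.

Lemma measurable_mulmx_cV M :
  measurable_fun [set: borel 'cV[R]_n] ((fun x => M *m x) : _ -> borel 'cV[R]_n).
Proof. by apply: continuous_borel; exact: mulmx_cV_continuous. Qed.

Lemma measurable_shift_cV c :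
  measurable_fun [set: borel 'cV[R]_n] ((fun x => x + c) : _ -> borel 'cV[R]_n).
Proof. by apply: continuous_borel; exact: shift_cV_continuous. Qed.

End borel_measurable.

(** * Boxes, uniqueness and shift invariance of Lebesgue measure *)

Section boxes.
Context (R : realType).

(** Boxes are stable under intersection, empty ones included, so they form a pi-system generating
    the Borel sets. *)
Definition box n (l h : 'cV[R]_n) : set 'cV[R]_n :=
  [set x | forall i, l i ord0 < x i ord0 < h i ord0].

Lemma open_box n (l h : 'cV[R]_n) : open (box l h).
Proof.
have -> : box l h = \bigcap_(i in [set: 'I_n])
    (fun x : 'cV[R]_n => x i ord0) @^-1` [set` `]l i ord0, h i ord0[ ].
  apply/seteqP; split=> [x lxh i _|x lxh i].
    by rewrite /= in_itv/=; exact: lxh.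
  by have := lxh i I; rewrite /= in_itv.
rewrite -closedC setC_bigcap; apply: closed_bigcup; first exact: finite_finset.
move=> i _; rewrite closedC; apply: open_comp; last exact: interval_open.
by move=> x _; exact: coord_continuous.
Qed.

Lemma setI_box n (l h l' h' : 'cV[R]_n) : box l h `&` box l' h' =
  box (\col_i Num.max (l i ord0) (l' i ord0))
      (\col_i Num.min (h i ord0) (h' i ord0)).
Proof.
apply/seteqP; split=> [x [lh lh'] i|x lh].
  rewrite !mxE gt_max lt_min.
  by have /andP[-> ->] := lh i; have /andP[-> ->] := lh' i.
have {}lh i : (l i ord0 < x i ord0 < h i ord0) &&
    (l' i ord0 < x i ord0 < h' i ord0).
  by have := lh i; rewrite !mxE gt_max lt_min -!andbA => /and4P[-> -> -> ->].
by split=> i; have /andP[] := lh i.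
Qed.

Lemma ball_box n (c : 'cV[R]_n) r : 0 < r ->
  ball c r = box (\col_i (c i ord0 - r)) (\col_i (c i ord0 + r)).
Proof.
move=> r0; apply/seteqP; split=> [x [_ cx] i|x cx].
  by rewrite !mxE -ltr_distl distrC; exact: cx.
split=> // i j; rewrite (ord1 j); have := cx i.
by rewrite !mxE -ltr_distl distrC.
Qed.

Lemma lebesgue_cV_box n (l h : 'cV[R]_n) : lebesgue_cV (box l h) =
  (\prod_i Num.max 0 (h i ord0 - l i ord0))%:E.
Proof.
elim: n l h => [|n IH] l h.
  rewrite big_ord0 /= /dirac indicE mem_set//; by case.
rewrite /= /pushforward.
have -> : @cV_cons R n @^-1` box l h =
    [set` `]l ord0 ord0, h ord0 ord0[] `*`
    box (\col_i l (lift ord0 i) ord0) (\col_i h (lift ord0 i) ord0).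
  apply/seteqP; split=> [[x v] lh|[x v] [/= lh lh'] i].
    split=> /=; first by have := lh ord0; rewrite cV_cons0 in_itv.
    by move=> i; have := lh (lift ord0 i); rewrite cV_consS !mxE.
  case: (unliftP ord0 i) => [k ->|->].
    by rewrite cV_consS; have := lh' k; rewrite !mxE.
  by rewrite cV_cons0; move: lh; rewrite in_itv.
rewrite product_measure1E//; last first.
  by apply: sub_gen_smallest; exact: open_box.
rewrite big_ord_recl EFinM; congr (_ * _)%E; last first.
  apply: etrans (IH _ _) _.
  by congr (_%:E); apply: eq_bigr => i _; rewrite !mxE.
apply: etrans (lebesgue_measure_itv _) _; rewrite /= lte_fin; case: ltP => lh.
  by rewrite max_r ?subr_ge0 ?(ltW lh).
by rewrite max_l// subr_le0.
Qed.

Lemma lebesgue_cV_unique n (m1 m2 : {measure set (borel 'cV[R]_n) -> \bar R}) :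
  (forall l h, m1 (box l h) = m2 (box l h)) ->
  (forall r, m1 (ball (0%R : 'cV[R]_n) r : set (borel 'cV[R]_n)) < +oo)%E ->
  forall E, measurable E -> m1 E = m2 E.
Proof.
move=> m12 m1fin E mE.
pose G : set (set (borel 'cV[R]_n)) :=
  [set box lh.1 lh.2 | lh in [set: 'cV[R]_n * 'cV[R]_n]].
pose g k : set (borel 'cV[R]_n) := ball (0 : 'cV[R]_n) k.+1%:R.
apply: (@measure_unique _ R (borel 'cV[R]_n) G g) => //.
- apply/seteqP; split; apply: smallest_sub.
  + exact: smallest_sigma_algebra.
  + move=> U oU; rewrite (open_cV_bigcup oU) bigcup_mkcond.
    pose T := g_sigma_algebraType G.
    apply: (@countable_bigcupT_measurable _ T); first exact: countableP.
    move=> q; case: ifPn => [_|_]; last exact: (@measurable0 _ T).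
    have [q0|q0] := ltP 0 (ratr q.2 : R); last first.
      by rewrite le0_ball0//; exact: (@measurable0 _ T).
    rewrite ball_box//; apply: sub_sigma_algebra.
    by exists (\col_i ((map_mx ratr q.1 : 'cV[R]_n) i ord0 - ratr q.2),
      \col_i ((map_mx ratr q.1 : 'cV[R]_n) i ord0 + ratr q.2)).
  + exact: smallest_sigma_algebra.
  + move=> _ [lh _ <-]; apply: sub_sigma_algebra; exact: open_box.
- move=> _ _ [lh _ <-] [lh' _ <-]; rewrite setI_box.
  by eexists (_, _).
- by move=> k; rewrite /g ball_box//; eexists (_, _).
- rewrite -subTset => x _; exists (Num.truncn `|x|) => //.
  by rewrite /g mx_norm_ball /= sub0r normrN truncnS_gt.
- by move=> _ [lh _ <-].
- by move=> k; exact: m1fin.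
Qed.

Lemma lebesgue_cV_ball_fin n (c : 'cV[R]_n) r :
  (lebesgue_cV (ball c r) < +oo)%E.
Proof.
have [r0|r0] := ltP 0 r; first by rewrite lebesgue_cV_ball// ltry.
by rewrite le0_ball0// measure0.
Qed.

Lemma lebesgue_cV_shift n (c : 'cV[R]_n) (E : set (borel 'cV[R]_n)) :
  measurable E -> lebesgue_cV ((fun x => x + c) @^-1` E) = lebesgue_cV E.
Proof.
move=> mE; apply/esym.
have mc := measurable_shift_cV c.
pose nu := measure_function_pushforward__canonical__measure_function_Measure
  (@lebesgue_cV R n) mc.
apply: (@lebesgue_cV_unique n (@lebesgue_cV R n) nu) => //; last first.
  by move=> r; exact: lebesgue_cV_ball_fin.
move=> l h; rewrite /nu /= /pushforward.
rewrite (_ : _ @^-1` _ = box (l - c) (h - c)); last first.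
  apply/seteqP; split=> x lxh i; have := lxh i; rewrite !mxE.
    by rewrite ltrBlDr ltrBrDr.
  by rewrite ltrBlDr ltrBrDr.
rewrite !lebesgue_cV_box; congr (_%:E); apply: eq_bigr => i _.
by rewrite !mxE opprB addrA subrK.
Qed.

End boxes.

(** * Change of variables for linear maps *)

Section haar.
Context (R : realType) (n : nat).
Local Notation V := (borel 'cV[R]_n).
Local Notation lam := (@lebesgue_cV R n).

Lemma measurable_add_cV :
  measurable_fun [set: V * V] ((fun p => p.1 + p.2) : V * V -> V).
Proof.
apply: measurable_fun_cV => i.
rewrite [X in measurable_fun _ X](_ : _ =
  (fun p : V * V => (p.1 : 'cV[R]_n) i ord0) \+ (fun p => (p.2 : 'cV[R]_n) i ord0)).
  apply: measurable_funD.
    exact: measurableT_comp (@measurable_coord_cV R n i) measurable_fst.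
  exact: measurableT_comp (@measurable_coord_cV R n i) measurable_snd.
by apply/funext => p; rewrite !mxE.
Qed.

Lemma measurable_sub_cV :
  measurable_fun [set: V * V] ((fun p => p.2 - p.1) : V * V -> V).
Proof.
apply: measurable_fun_cV => i.
rewrite [X in measurable_fun _ X](_ : _ =
  (fun p : V * V => (p.2 : 'cV[R]_n) i ord0) \- (fun p => (p.1 : 'cV[R]_n) i ord0)).
  apply: measurable_funB.
    exact: measurableT_comp (@measurable_coord_cV R n i) measurable_snd.
  exact: measurableT_comp (@measurable_coord_cV R n i) measurable_fst.
by apply/funext => p; rewrite !mxE.
Qed.

(* Fubini on {(x, y) : y in Q, x + y in E} and on its image under the shear
   (x, y) |-> (x, x + y). *)
Lemma shift_invariant_proportional
    (mu : {sigma_finite_measure set V -> \bar R}) (Q E : set V) :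
  (forall (c : 'cV[R]_n) (F : set V), measurable F ->
    mu ((fun x : 'cV[R]_n => x + c) @^-1` F) = mu F) ->
  (forall x : 'cV[R]_n, Q x -> Q (- x)) -> measurable Q -> measurable E ->
  (mu E * lam Q = mu Q * lam E)%E.
Proof.
move=> mu_shift QN mQ mE.
pose S1 : set (V * V) := [set p | Q p.2 /\ E (p.1 + p.2)].
pose S2 : set (V * V) := [set p | E p.2 /\ Q (p.2 - p.1)].
have mS1 : measurable S1.
  apply: measurableI; last first.
    by rewrite -[X in measurable X]setTI; exact: measurable_add_cV.
  by rewrite -[X in measurable X]setTI; exact: measurable_snd.
have mS2 : measurable S2.
  apply: measurableI; last first.
    by rewrite -[X in measurable X]setTI; exact: measurable_sub_cV.
  by rewrite -[X in measurable X]setTI; exact: measurable_snd.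
have swap S : measurable S -> (mu \x lam)%E S = (mu \x^ lam)%E S.
  move=> mS; apply: product_measure_unique => // X Y mX mY.
  exact: product_measure2E.
have S2E : (mu \x^ lam)%E S2 = (mu Q * lam E)%E.
  rewrite /product_measure2.
  transitivity (\int[lam]_y (mu Q * (\1_E y)%:E))%E; last first.
    by rewrite ge0_integralZl// ?integral_indic ?setIT//;
      exact/measurable_EFinP/measurable_indic.
  apply: eq_integral => y _ /=; rewrite indicE; case: (boolP (y \in E)) => yE.
    rewrite mule1 -(mu_shift (- y) Q mQ); congr (mu _).
    apply/seteqP; split=> x /=.
      rewrite /ysection/= inE => -[_ /QN]; by rewrite /= opprB.
    by move=> Qxy; rewrite /ysection/= inE; split; [exact/set_mem|rewrite /= -opprB; exact: QN].
  rewrite mule0 (_ : ysection _ _ = set0) ?measure0//.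
  by apply/seteqP; split=> x //; rewrite /ysection/= inE => -[/mem_set]; rewrite /= (negbTE yE).
have S1E : (mu \x^ lam)%E S1 = (mu E * lam Q)%E.
  rewrite /product_measure2.
  transitivity (\int[lam]_y (mu E * (\1_Q y)%:E))%E; last first.
    by rewrite ge0_integralZl// ?integral_indic ?setIT//;
      exact/measurable_EFinP/measurable_indic.
  apply: eq_integral => y _ /=; rewrite indicE; case: (boolP (y \in Q)) => yQ.
    rewrite mule1 -(mu_shift y E mE); congr (mu _).
    apply/seteqP; split=> x /=; first by rewrite /ysection/= inE => -[].
    by move=> Exy; rewrite /ysection/= inE; split => //; exact/set_mem.
  rewrite mule0 (_ : ysection _ _ = set0) ?measure0//.
  by apply/seteqP; split=> x //; rewrite /ysection/= inE => -[/mem_set]; rewrite /= (negbTE yQ).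
(* For fixed [x] the sections of [S1] and [S2] are translates of each other by [x], so they have the
   same Lebesgue measure. *)
rewrite -S1E -S2E -!swap// /product_measure1; apply: eq_integral => x _ /=.
rewrite -[RHS](lebesgue_cV_shift x); last exact: measurable_xsection.
congr (lebesgue_cV _); apply/seteqP; split=> y /=; rewrite /xsection/= !inE/=.
  by move=> [/= Qy Exy]; split; rewrite /= ?addrK// addrC.
by rewrite /S2/= addrK => -[Exy Qy]; split => //=; rewrite addrC.
Qed.

End haar.

Section linear_change.
Context (R : realType) (n : nat).
Implicit Types (M P : 'M[R]_n) (E : set (borel 'cV[R]_n)).
Local Notation lam := (@lebesgue_cV R n).

Lemma image_mulmx_cV M (E : set 'cV[R]_n) : M \in unitmx ->
  (fun x => M *m x) @` E = (fun x => invmx M *m x) @^-1` E.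
Proof.
move=> Mu; apply/seteqP; split=> [_ [x Ex <-]|x Ex] /=; first by rewrite mulKmx.
by exists (invmx M *m x) => //; rewrite mulKVmx.
Qed.

Lemma measurable_image_mulmx M E : M \in unitmx -> measurable E ->
  measurable ((fun x : 'cV[R]_n => M *m x) @` E : set (borel 'cV[R]_n)).
Proof.
move=> Mu mE; rewrite image_mulmx_cV// -[X in measurable X]setTI.
exact: measurable_mulmx_cV.
Qed.

Lemma measurable_image_shift (c : 'cV[R]_n) E : measurable E ->
  measurable ((fun x : 'cV[R]_n => x + c) @` E : set (borel 'cV[R]_n)).
Proof.
move=> mE; rewrite (_ : _ @` _ = (fun x : 'cV[R]_n => x - c) @^-1` E).
  by rewrite -[X in measurable X]setTI; exact: measurable_shift_cV.
apply/seteqP; split=> [_ [x Ex <-]|x Ex] /=; first by rewrite addrK.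
by exists (x - c) => //; rewrite subrK.
Qed.

Lemma lebesgue_cV_image_shift (c : 'cV[R]_n) E : measurable E ->
  lam ((fun x : 'cV[R]_n => x + c) @` E) = lam E.
Proof.
move=> mE; rewrite (_ : _ @` _ = (fun x : 'cV[R]_n => x - c) @^-1` E).
  exact: lebesgue_cV_shift.
apply/seteqP; split=> [_ [x Ex <-]|x Ex] /=; first by rewrite addrK.
by exists (x - c) => //; rewrite subrK.
Qed.

(** The volume ratio for the unit ball, which has volume 2^n. It turns out to be the ratio for every
    Borel set ([dilationE]) and to equal |det M| ([dilation_det]). *)
Definition dilation M : R :=
  fine (lam ((fun x => M *m x) @` ball (0 : 'cV[R]_n) 1)) / 2 ^+ n.

Lemma dilation_ge0 M : 0 <= dilation M.
Proof. by rewrite divr_ge0// fine_ge0. Qed.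

Lemma image_mulmx_ball M a : row_sum_le M a -> forall r : R,
  (fun x => M *m x) @` ball (0 : 'cV[R]_n) r `<=` ball (0 : 'cV[R]_n) ((`|a| + 1) * r).
Proof.
move=> Ma r _ [x + <-]; rewrite !cV_ballE !sub0r !normrN => xr.
apply: (le_lt_trans (mulmx_norm_le x Ma)).
apply: (@le_lt_trans _ _ ((`|a| + 1) * `|x|)).
  by rewrite ler_wpM2r// (le_trans (ler_norm a))// lerDl.
by rewrite ltr_pM2l// ltr_wpDl.
Qed.

(** The left-hand side is a measure in [E], and it is shift invariant because shifting [E] by [c]
    shifts its image by [M *m c]. Hence it is proportional to Lebesgue measure; the unit ball gives
    the ratio. *)
Lemma dilationE M E : M \in unitmx -> measurable E ->
  lam ((fun x => M *m x) @` E) = ((dilation M)%:E * lam E)%E.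
Proof.
move=> Mu mE.
have mV := @measurable_mulmx_cV R n (invmx M).
pose nu0 := measure_function_pushforward__canonical__measure_function_Measure
  lam mV.
have nuE (F : set 'cV[R]_n) : nu0 F = lam ((fun x => M *m x) @` F).
  by rewrite image_mulmx_cV.
have nufin r : (nu0 (ball (0%R : 'cV[R]_n) r : set (borel 'cV[R]_n)) < +oo)%E.
  rewrite nuE.
  apply: le_lt_trans (lebesgue_cV_ball_fin _ ((`|\sum_i \sum_j `|M i j| | + 1) * r)).
  apply: le_measure; rewrite ?inE.
  - by apply: measurable_image_mulmx => //; exact: measurable_ball_cV.
  - exact: measurable_ball_cV.
  - exact: image_mulmx_ball (row_sum_le_ex M) _.
have nu_sf : sigma_finite [set: borel 'cV[R]_n] nu0.
  exists (fun k => ball (0 : 'cV[R]_n) k%:R); last first.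
    by move=> k; split; [exact: measurable_ball_cV|exact: nufin].
  apply/esym; rewrite -subTset => x _; exists (Num.truncn `|x|).+1 => //.
  by rewrite mx_norm_ball /= sub0r normrN truncnS_gt.
pose nu : {sigma_finite_measure set (borel 'cV[R]_n) -> \bar R} :=
  HB.pack (Measure.sort nu0) (Measure.class nu0)
    (Measure_isSigmaFinite.Build _ _ _ nu0 nu_sf).
set Q : set (borel 'cV[R]_n) := ball (0 : 'cV[R]_n) 1.
have nuQ : nu0 Q = (dilation M * 2 ^+ n)%:E.
  rewrite /dilation divfK ?expf_neq0 ?pnatr_eq0// fineK; first exact: nuE.
  rewrite -[X in X \is a _]nuE ge0_fin_numE//; exact: nufin.
have h : (nu0 E * lam Q = nu0 Q * lam E)%E.
  apply: (@shift_invariant_proportional R n nu Q E) => //.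
  - move=> c F mF; apply: etrans (nuE _) _; apply: etrans _ (esym (nuE _)).
    rewrite -[RHS](lebesgue_cV_shift (M *m c)); last exact: measurable_image_mulmx.
    congr (lebesgue_cV _); rewrite !image_mulmx_cV//.
    by apply/seteqP; split=> x /=; rewrite mulmxDr mulKmx.
  - by move=> x; rewrite /Q !cV_ballE !sub0r opprK normrN.
  - exact: measurable_ball_cV.
pose t : R := 2 ^+ n; have t0 : t != 0 by rewrite expf_neq0// pnatr_eq0.
have lamQ : lam Q = t%:E by exact: lebesgue_cV_ball.
rewrite nuQ lamQ in h.
rewrite -nuE -[LHS]mule1 (_ : 1 = t%:E * t^-1%:E)%E; last by rewrite -EFinM divff.
rewrite muleA h EFinM -!muleA; congr (_ * _)%E.
by rewrite muleCA -EFinM divff// mule1.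
Qed.

Lemma dilationM M P : M \in unitmx -> P \in unitmx ->
  dilation (M *m P) = dilation M * dilation P.
Proof.
move=> Mu Pu; rewrite [LHS]/dilation.
rewrite (_ : _ @` _ = (fun x => M *m x) @` ((fun x => P *m x) @` ball (0 : 'cV[R]_n) 1)); last first.
  by rewrite image_comp; apply: eq_imagel => x _ /=; rewrite mulmxA.
have mB := @measurable_ball_cV R n 0 1.
rewrite dilationE//; last exact: measurable_image_mulmx.
rewrite [X in (_ * X)%E]dilationE// [X in (_ * (_ * X))%E]lebesgue_cV_ball// -!EFinM/=.
by rewrite mulr2n mulrA mulfK// expf_neq0// pnatr_eq0.
Qed.

Lemma dilation1 : dilation 1%:M = 1.
Proof.
rewrite /dilation (_ : _ @` _ = ball (0 : 'cV[R]_n) 1).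
  by rewrite lebesgue_cV_ball//= divff// expf_neq0// pnatr_eq0.
apply/seteqP; split=> [_ [x xB <-]|x xB]; first by rewrite mul1mx.
by exists x => //; rewrite mul1mx.
Qed.

(** The image of the unit ball lies in the box with half-sides [s i]. *)
Lemma dilation_le M (s : 'I_n -> R) : M \in unitmx ->
  (forall i, 0 < s i) -> (forall i, \sum_j `|M i j| <= s i) ->
  dilation M <= \prod_i s i.
Proof.
move=> Mu s0 Ms; rewrite ler_pdivrMr ?exprn_gt0//.
pose b := box (- \col_i s i) (\col_i s i).
have bE : lam b = (\prod_i s i * 2 ^+ n)%:E.
  rewrite lebesgue_cV_box mulrC; congr (_%:E).
  rewrite (eq_bigr (fun i => 2 * s i)); last first.
    move=> i _; rewrite !mxE opprK max_r ?addr_ge0 ?(ltW (s0 i))//.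
    by rewrite mulr_natl mulr2n.
  by rewrite big_split/= prodr_const card_ord.
have mB := @measurable_ball_cV R n 0 1.
have : (lam ((fun x => M *m x) @` ball (0%R : 'cV[R]_n) 1) <= lam b)%E.
  apply: le_measure; rewrite ?inE.
  - exact: measurable_image_mulmx.
  - by apply: sub_gen_smallest; exact: open_box.
  move=> _ [x + <-] i; rewrite cV_ballE sub0r normrN => x1.
  rewrite !mxE -ltr_norml.
  apply: (@le_lt_trans _ _ (s i * `|x|)); last by rewrite gtr_pMr.
  apply: (@le_trans _ _ ((\sum_j `|M i j|) * `|x|)); last by rewrite ler_wpM2r.
  rewrite (le_trans (ler_norm_sum _ _ _))// mulr_suml.
  by apply: ler_sum => j _; rewrite normrM ler_wpM2l// cV_coord_le.
rewrite bE => h; rewrite -lee_fin fineK//.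
by rewrite ge0_fin_numE//; apply: le_lt_trans h _; rewrite ltry.
Qed.

(** Conjugation preserves the dilation and makes the off-diagonal entries negligible, which gives
    the bound with an extra [e] in each factor. That bound is a polynomial in [e], so it passes to
    the limit at 0. *)
Lemma dilation_triangular M (r : 'I_n -> nat) : M \in unitmx ->
  (forall i j, i != j -> M i j != 0 -> (r j < r i)%N) ->
  dilation M <= \prod_i `|M i i|.
Proof.
move=> Mu Mr.
have le_e (e : R) : 0 < e -> dilation M <= \prod_i (`|M i i| + e).
  move=> e0; have [D [D' [DD' D'D DMD']]] := conj_triangular_row_sum Mr e0.
  have [Du D'u] := mulmx1_unit DD'.
  have DMu : D *m M \in unitmx by rewrite unitmx_mul Du.
  have -> : dilation M = dilation (D *m M *m D').
    rewrite !dilationM// mulrAC -dilationM// DD' dilation1 mul1r//.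
  apply: dilation_le => //; first by rewrite unitmx_mul DMu.
  by move=> i; rewrite ltr_wpDl.
pose p : {poly R} := \prod_i ('X + `|M i i|%:P).
have pE e : p.[e] = \prod_i (`|M i i| + e).
  by rewrite horner_prod; apply: eq_bigr => i _; rewrite hornerD hornerX hornerC addrC.
have -> : \prod_i `|M i i| = p.[0] by rewrite pE; apply: eq_bigr => i _; rewrite addr0.
have p0 : p.[x] @[x --> 0^'+] --> p.[0].
  by apply: cvg_at_right_filter; exact: continuous_horner.
apply: (cvgr_to_ge p0); near=> e; rewrite pE; apply: le_e; near: e.
exact: nbhs_right_gt.
Unshelve. all: by end_near. Qed.

End linear_change.

Section determinant.
Context (R : realType).

Lemma dilation_perm n (s : {perm 'I_n}) : dilation (perm_mx s : 'M[R]_n) <= 1.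
Proof.
rewrite (_ : 1 = \prod_(i < n) 1 :> R); last by rewrite big1.
apply: dilation_le => //; first exact: unitmx_perm.
move=> i; rewrite (bigD1 (s i))//= big1 ?addr0 => [|j ji].
  by rewrite !mxE eqxx normr1.
by rewrite !mxE eq_sym (negbTE ji) normr0.
Qed.

(** Both sides are multiplicative, so the factors of an LUP decomposition can be treated separately.
    The rank function is the index for the lower factor and the reversed index for the upper one. *)
Lemma dilation_le_det n (M : 'M[R]_n) : M \in unitmx -> dilation M <= `|\det M|.
Proof.
case: n M => [|n] M Mu.
  by rewrite (flatmx0 M) -(flatmx0 1%:M) dilation1 det1 normr1.
have := cormen_lup_correct M; have := cormen_lup_perm M.
have := @cormen_lup_lower _ n M; have := @cormen_lup_upper _ n M.
have := cormen_lup_detL M.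
case: (cormen_lup M) => [[P L] U]/= detL Uu Ll /is_perm_mxP[s ->] sM.
have Lu : L \in unitmx by rewrite unitmxE detL unitr1.
have sMu : perm_mx s *m M \in unitmx by rewrite unitmx_mul unitmx_perm.
have Uu' : U \in unitmx by move: sMu; rewrite [_ *m _]sM unitmx_mul => /andP[].
have detU : \det U = \prod_i U i i.
  rewrite -det_tr det_trig; last by apply/is_trig_mxP => i j ij; rewrite mxE Uu.
  by apply: eq_bigr => i _; rewrite mxE.
have detL' : \det L = \prod_i L i i.
  rewrite det_trig//; apply/is_trig_mxP => i j ij.
  by rewrite Ll ?(ltnW ij)// -val_eqE ltn_eqF.
have ME : M = perm_mx s^-1 *m (L *m U).
  by rewrite -[L *m U]sM mulmxA -perm_mxM mulVg perm_mx1 mul1mx.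
rewrite ME !dilationM ?unitmx_perm ?unitmx_mul ?Lu//.
rewrite !det_mulmx det_perm !normrM normrX normrN1 expr1n mul1r.
rewrite -[leRHS]mul1r; apply: ler_pM.
- exact: dilation_ge0.
- exact: mulr_ge0 (dilation_ge0 _) (dilation_ge0 _).
- exact: dilation_perm.
apply: ler_pM; [exact: dilation_ge0|exact: dilation_ge0| |].
  rewrite detL' normr_prod; apply: (@dilation_triangular _ _ _ (fun i => i)) => //.
  move=> i j ij; apply: contraNltn => ij'; rewrite Ll// (negbTE ij)//.
rewrite detU normr_prod; apply: (@dilation_triangular _ _ _ (fun i => n - i)%N) => //.
move=> i j ij Uij; have : (i < j)%N.
  rewrite ltn_neqAle ij/= leqNgt; apply: contra Uij => ji; apply/eqP; exact: Uu.
by have := ltn_ord j; lia.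
Qed.

(** A strict inequality for [M] would contradict the upper bound for its inverse, since the
    dilations of the two multiply to 1. *)
Lemma dilation_det n (M : 'M[R]_n) : M \in unitmx -> dilation M = `|\det M|.
Proof.
move=> Mu; apply/eqP; rewrite eq_le dilation_le_det//=.
have Vu : invmx M \in unitmx by rewrite unitmx_inv.
have d0 : 0 < `|\det M| by rewrite normr_gt0 -unitfE -unitmxE.
have := dilation_le_det Vu; rewrite det_inv normfV.
have : dilation M * dilation (invmx M) = 1.
  by rewrite -dilationM// mulmxV// dilation1.
rewrite -[_ <= _^-1](ler_pM2r d0) mulVf ?gt_eqF// => h1 h2.
have p0 : 0 <= dilation M by exact: dilation_ge0.
have q0 : 0 < dilation (invmx M).
  rewrite lt_neqAle dilation_ge0 andbT eq_sym; apply: contra_eq_neq h1 => ->.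
  by rewrite mulr0 eq_sym oner_eq0.
by rewrite -(ler_pM2l q0) [leRHS]mulrC h1.
Qed.

Lemma lebesgue_cV_mulmx n (M : 'M[R]_n) (E : set (borel 'cV[R]_n)) :
  M \in unitmx -> measurable E ->
  lebesgue_cV ((fun x => M *m x) @` E) = (`|\det M|%:E * lebesgue_cV E)%E.
Proof. by move=> Mu mE; rewrite dilationE// dilation_det. Qed.

End determinant.

Section finite_unions.
Context d (T : measurableType d) (R : realType) (mu : {measure set T -> \bar R}).

Lemma bigcup_finType (I : finType) (F : I -> set T) :
  \bigcup_i F i = \big[setU/set0]_i F i.
Proof.
rewrite -(bigcup_pred xpredT F); congr bigcup.
by apply/seteqP; split.
Qed.

Lemma measurable_bigcup_fin (I : finType) (F : I -> set T) :
  (forall i, measurable (F i)) -> measurable (\bigcup_i F i).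
Proof. by move=> mF; rewrite bigcup_finType; exact: bigsetU_measurable. Qed.

Lemma measure_bigcup_fin_le (I : finType) (F : I -> set T) :
  (forall i, measurable (F i)) -> (mu (\bigcup_i F i) <= \sum_i mu (F i))%E.
Proof.
move=> mF; rewrite bigcup_finType.
elim: (index_enum I) => [|i s IH]; first by rewrite !big_nil measure0.
rewrite !big_cons (le_trans (measureU2 _ _ _))//; first exact: bigsetU_measurable.
by rewrite leeD2l.
Qed.

Lemma measure_bigcup_fin (I : finType) (F : I -> set T) :
  (forall i, measurable (F i)) ->
  (forall i j, i != j -> F i `&` F j = set0) ->
  mu (\bigcup_i F i) = (\sum_i mu (F i))%E.
Proof.
move=> mF dF; rewrite bigcup_finType.
elim: (index_enum I) (index_enum_uniq I) => [|i s IH]; first by rewrite !big_nil measure0.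
rewrite cons_uniq => /andP[si us]; rewrite !big_cons measureU//.
- by congr (_ + _)%E; exact: IH.
- exact: bigsetU_measurable.
rewrite big_distrr/= big1_seq// => j /andP[_ sj]; apply: dF.
by apply: contraNneq si => ->.
Qed.

End finite_unions.

Section thickening.
Context (R : realType) (n : nat).
Implicit Types (S : set 'cV[R]_n) (e : R).

Definition thick S e : set 'cV[R]_n := [set y | exists2 x, S x & `|x - y| < e].

Lemma thick_bigcup S e : thick S e = \bigcup_(x in S) ball x e.
Proof.
apply/seteqP; split=> [y [x Sx xy]|y [x Sx]]; first by exists x => //; rewrite cV_ballE.
by rewrite cV_ballE => xy; exists x.
Qed.

Lemma open_thick S e : open (thick S e).
Proof. by rewrite thick_bigcup; apply: bigcup_open => x _; exact: ball_open. Qed.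

Lemma measurable_thick S e : measurable (thick S e : set (borel 'cV[R]_n)).
Proof. by apply: sub_gen_smallest; exact: open_thick. Qed.

Lemma sub_thick S e : 0 < e -> S `<=` thick S e.
Proof. by move=> e0 x Sx; exists x => //; rewrite subrr normr0. Qed.

Lemma le_thick S e e' : e <= e' -> thick S e `<=` thick S e'.
Proof. by move=> ee' y [x Sx xy]; exists x => //; exact: lt_le_trans ee'. Qed.

Lemma thick_thick S e e' : thick (thick S e) e' `<=` thick S (e + e').
Proof.
move=> z [y [x Sx xy] yz]; exists x => //.
by rewrite -[x - z](subrKA y) (le_lt_trans (ler_normD _ _))// ltrD.
Qed.

Lemma bigcap_thick S : closed S -> \bigcap_k thick S k.+1%:R^-1 = S.
Proof.
move=> cS; apply/seteqP; split=> [y yS|y Sy k _]; last first.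
  by apply: sub_thick => //; rewrite invr_gt0.
apply: cS => B /nbhs_ballP[e /= e0 eB].
have [k ke] : exists k, k.+1%:R^-1 < e.
  exists (Num.truncn e^-1); rewrite invf_plt ?posrE//.
  exact: truncnS_gt.
have [x Sx xy] := yS k I.
exists x; split => //; apply: eB; rewrite cV_ballE distrC.
exact: lt_trans ke.
Qed.

(** The neighbourhoods of radius 1/(k+1) decrease to the closed set [S]; finiteness of the first one
    allows continuity from above. *)
Lemma measure_thick_lt (mu : {measure set (borel 'cV[R]_n) -> \bar R}) S (c : R) :
  closed S -> (mu (thick S 1) < +oo)%E -> (mu S < c%:E)%E ->
  exists2 e, 0 < e & (mu (thick S e) < c%:E)%E.
Proof.
move=> cS fin Sc.
pose F k : set (borel 'cV[R]_n) := thick S k.+1%:R^-1.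
have FS : \bigcap_k F k = S by exact: bigcap_thick.
have /(_ _ _ _ _) h := @nonincreasing_cvg_mu _ (borel 'cV[R]_n) R mu F.
have {h} : (mu \o F) x @[x --> \oo] --> mu S.
  rewrite -{1}FS; apply: h.
  - by rewrite /F invr1.
  - by move=> i; exact: measurable_thick.
  - by rewrite FS; exact: measurable_borel_closed.
  - move=> a b ab; rewrite subsetEset; apply: le_thick.
    by rewrite lef_pV2 ?posrE ?ler_nat.
move=> /(_ _ (open_ereal_lt' Sc))[k _ /(_ k (leqnn k))] /= h.
by exists k.+1%:R^-1 => //; rewrite invr_gt0.
Qed.

End thickening.

(** * Attractor and self-similar measure *)

Section affine_words.
Context (R : realType) (d N : nat) (A : 'M[int]_d).
Implicit Types (u : 'I_N -> 'cV[R]_d) (w v : seq 'I_N) (x y : 'cV[R]_d)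
  (X : set 'cV[R]_d).
Local Notation AR := (map_mx intr A : 'M[R]_d).
Local Notation B := (invmx AR).

Definition translation u w : 'cV[R]_d := word_map (ifs_map A u) w 0.

Lemma translation_cons u j w :
  translation u (j :: w) = B *m translation u w + u j.
Proof. by []. Qed.

Lemma word_mapE u w x :
  word_map (ifs_map A u) w x = B ^+ size w *m x + translation u w.
Proof.
elim: w => [|j w IH] /=.
  by rewrite /translation/= expr0 mul1mx addr0.
by rewrite IH translation_cons /ifs_map mulmxDr addrA exprmxS -mulmxA.
Qed.

Lemma word_map_cat u v w :
  word_map (ifs_map A u) (v ++ w) =
  word_map (ifs_map A u) v \o word_map (ifs_map A u) w.
Proof. by elim: v => //= j v ->. Qed.

Definition geometric (M : 'M[R]_d) (C q : R) :=
  [/\ 0 < C, 0 < q, q < 1 & forall k x, `|M ^+ k *m x| <= C * q ^+ k * `|x|].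

Lemma geometric_small C q r e : geometric B C q -> 0 <= r -> 0 < e ->
  exists k0 : nat, forall k x, (k0 <= k)%N -> `|x| <= r -> `|B ^+ k *m x| < e.
Proof.
move=> [C0 q0 q1 BC] r0 e0.
have : (C * (r + 1)) * q ^+ k @[k --> \oo] --> C * (r + 1) * 0.
  by apply: cvgMr; apply: cvg_expr; rewrite gtr0_norm.
rewrite mulr0 => /cvgr0Pnorm_lt/(_ e e0)[k0 _ h]; exists k0 => k x k0k xr.
apply: (le_lt_trans (BC k x)); apply: le_lt_trans (h k k0k) => /=.
rewrite ger0_norm; last by rewrite !mulr_ge0 ?exprn_ge0 ?addr_ge0 ?(ltW q0)// ltW.
rewrite mulrAC ler_wpM2r ?exprn_ge0 ?(ltW q0)// ler_wpM2l ?(ltW C0)//.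
by rewrite (le_trans xr)// lerDl.
Qed.

(** The translation of [w] is the sum of the B^i u_(w_i), dominated by a geometric series. *)
Lemma translation_bound u C q U w : geometric B C q -> 0 <= U ->
  (forall j, `|u j| <= U) -> `|translation u w| <= C * U / (1 - q).
Proof.
move=> [C0 q0 q1 BC] U0 uU.
have q10 : 0 < 1 - q by rewrite subr_gt0.
(* Removing the first letter of [w] brings out one factor B, so the induction needs the bound for
   all powers [k]. *)
suff h k : `|B ^+ k *m translation u w| <= C * U / (1 - q) * q ^+ k.
  by have := h 0%N; rewrite expr0 mul1mx mulr1.
elim: w k => [|j w IH] k.
  rewrite /translation/= mulmx0 normr0.
  by rewrite !mulr_ge0 ?exprn_ge0 ?invr_ge0 ?(ltW q0) ?(ltW C0) ?(ltW q10).
rewrite translation_cons mulmxDr mulmxA -exprmxSr.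
apply: (le_trans (ler_normD _ _)).
apply: (le_trans (lerD (IH k.+1) (BC k (u j)))).
rewrite [leRHS](_ : _ = C * U / (1 - q) * q ^+ k.+1 + C * q ^+ k * U); last first.
  rewrite exprS mulrA -mulrA [in RHS]mulrAC -[X in _ = _ + X](mulrK (_ : 1 - q \is a GRing.unit)).
    by field; rewrite gt_eqF.
  by rewrite unitfE gt_eqF.
by rewrite lerD2l ler_wpM2l// mulr_ge0 ?exprn_ge0 ?(ltW q0) ?(ltW C0).
Qed.

Lemma ifs_map_continuous u j : continuous (ifs_map A u j).
Proof.
pose a := \sum_i \sum_j `|B i j|.
apply: (@lipschitz_cV_continuous _ _ _ a) => x y.
rewrite /ifs_map opprD addrACA subrr addr0 -mulmxBr.
exact: mulmx_norm_le (row_sum_le_ex B).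
Qed.

Lemma word_map_continuous u w : continuous (word_map (ifs_map A u) w).
Proof.
elim: w => [|j w IH]; first by move=> x; exact: cvg_id.
move=> x; apply: (@continuous_comp _ _ _ (word_map (ifs_map A u) w) (ifs_map A u j)).
  exact: IH.
exact: ifs_map_continuous.
Qed.

(** The matrix 1 - B is invertible: a non-zero vector fixed by B would be fixed by all its powers,
    which tend to 0. *)
Lemma ifs_map_fixpoint u j C q : geometric B C q -> exists p, ifs_map A u j p = p.
Proof.
move=> Bg; have [C0 q0 q1 BC] := Bg.
have IBu : 1%:M - B \in unitmx.
  rewrite unitmxE unitfE -det_tr; apply/negP => /det0P[v v0 vB].
  have Bv : B *m v^T = v^T.
    apply/eqP; rewrite eq_sym -subr_eq0 -{1}[v^T]mul1mx -mulmxBl.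
    by rewrite -[_ *m _]trmxK trmx_mul trmxK vB trmx0.
  have Bkv k : B ^+ k *m v^T = v^T.
    elim: k => [|k IH]; first by rewrite expr0 mul1mx.
    by rewrite exprmxS -mulmxA IH.
  have vn0 : 0 < `|v^T| by rewrite normr_gt0 -[0]trmx0 (inj_eq trmx_inj).
  have [k /(_ k v^T (leqnn k) (lexx _))] := geometric_small Bg (ltW vn0) vn0.
  by rewrite Bkv ltxx.
exists (invmx (1%:M - B) *m u j).
set v := _ *m u j; have : (1%:M - B) *m v = u j by rewrite mulKVmx.
by rewrite mulmxBl mul1mx /ifs_map => <-; rewrite addrC subrK.
Qed.

(** The orbit [P] of a fixed point [p] of one of the maps is itself invariant, the empty word being
    covered by [p = T p]. It is bounded, and invariance passes to its closure because images of
    compact sets are closed. *)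
Lemma attractor_exists u C q : (0 < N)%N -> geometric B C q ->
  is_attractor (ifs_map A u) (attractor (ifs_map A u)).
Proof.
move=> N0 Bg; apply: getPex.
have [C0 q0 q1 BC] := Bg.
have [p Tp] := ifs_map_fixpoint u (Ordinal N0) Bg.
pose P := [set word_map (ifs_map A u) w p | w in [set: seq 'I_N]].
have TP : P = \bigcup_j (ifs_map A u j @` P).
  apply/seteqP; split=> [_ [[|j w] _ <-]|_ [j _ [_ [w _ <-] <-]]].
  - by exists (Ordinal N0) => //; exists p => //; exists [::].
  - by exists j => //; exists (word_map (ifs_map A u) w p) => //; exists w.
  - by exists (j :: w).
pose U := \sum_j `|u j|.
have U0 : 0 <= U by exact: sumr_ge0.
have uU j : `|u j| <= U by rewrite /U (bigD1 j)//= lerDl sumr_ge0.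
pose K := C * `|p| + C * U / (1 - q).
have PK x : P x -> `|x| <= K.
  move=> [w _ <-]; rewrite word_mapE (le_trans (ler_normD _ _))//.
  rewrite lerD ?translation_bound// (le_trans (BC _ _))//.
  rewrite ler_wpM2r// ler_piMr ?(ltW C0)//.
  by rewrite exprn_ile1 ?ltW.
have cK : compact (closure P).
  apply: (@bounded_closed_compact_cV _ _ _ K); last exact: closed_closure.
  have cl : closed [set x : 'cV[R]_d | `|x| <= K].
    rewrite (_ : [set _ | _] = (@Num.norm _ 'cV[R]_d) @^-1` [set r : R | r <= K])//.
    by apply: preimage_closed; [move=> x _; exact: norm_continuous|exact: closed_le].
  move=> x /(_ _) Px; apply: cl => O /Px[y [Py Oy]]; exists y; split => //.
  exact: PK.
exists (closure P); split => //.
  by exists p; apply: subset_closure; exists [::].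
apply/seteqP; split.
  have cT : closed (\bigcup_j (ifs_map A u j @` closure P)).
    apply: closed_bigcup; first exact: finite_finset.
    move=> j _; apply: closed_compact_cV; apply: continuous_compact => //.
    by apply: continuous_subspaceT; exact: ifs_map_continuous.
  rewrite [X in _ `<=` X](closure_id _).1//; apply: closure_subset.
  rewrite {1}TP => x [j _ [y Py <-]]; exists j => //; exists y => //.
  exact: subset_closure.
move=> _ [j _ [x Px <-]] O /(@ifs_map_continuous u j) /Px[y [Py Oy]].
by exists (ifs_map A u j y); split => //; rewrite TP; exists j => //; exists y.
Qed.

Lemma attractor_words u X n : is_attractor (ifs_map A u) X ->
  X = \bigcup_(w : n.-tuple 'I_N) (word_map (ifs_map A u) w @` X).
Proof.
move=> [_ _ XT]; elim: n => [|n IH].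
  apply/seteqP; split=> [x Xx|_ [w _ [x Xx <-]]].
    by exists [tuple] => //; exists x.
  by rewrite tuple0.
apply/seteqP; split=> [x|_ [w _ [x Xx <-]]].
  rewrite {1}XT => -[j _ [y]]; rewrite {1}IH => -[w _ [z Xz <-] <-].
  by exists (cons_tuple j w) => //; exists z.
rewrite (tuple_eta w) XT; exists (thead w) => //=.
exists (word_map (ifs_map A u) (behead_tuple w) x) => //.
by rewrite IH; exists (behead_tuple w) => //; exists x.
Qed.

Lemma attractor_word u X w : is_attractor (ifs_map A u) X ->
  forall x, X x -> X (word_map (ifs_map A u) w x).
Proof.
move=> Xa x Xx; rewrite (attractor_words (size w) Xa).
by exists (in_tuple w) => //; exists x.
Qed.

(** By invariance every point of [X] is a translation of a long word up to a negligible error. The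
    bound depends on [u] only through [U], which makes it usable before [u] is fixed. *)
Lemma attractor_bound u X C q U : is_attractor (ifs_map A u) X ->
  geometric B C q -> 0 <= U -> (forall j, `|u j| <= U) ->
  forall x, X x -> `|x| <= C * U / (1 - q).
Proof.
move=> Xa Bg U0 uU x Xx.
have [cX _ _] := Xa; have [r r0 Xr] := compact_bounded_cV cX.
apply/ler_addgt0Pl => e e0; have [k0 h] := geometric_small Bg (ltW r0) e0.
move: Xx; rewrite (attractor_words k0 Xa) => -[w _ [y Xy <-]].
rewrite word_mapE (le_trans (ler_normD _ _))// lerD//.
  by rewrite size_tuple ltW// h//; exact: Xr.
exact: translation_bound.
Qed.

End affine_words.

Lemma big_tuple_cons (T : Type) (idx : T) (op : Monoid.com_law idx) (I : finType) n
    (F : n.+1.-tuple I -> T) :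
  \big[op/idx]_(w : n.+1.-tuple I) F w =
  \big[op/idx]_i \big[op/idx]_(w : n.-tuple I) F (cons_tuple i w).
Proof.
rewrite pair_big/=.
rewrite (reindex (fun p : I * n.-tuple I => cons_tuple p.1 p.2))//=.
exists (fun w : n.+1.-tuple I => (thead w, behead_tuple w)) => [[i w] _|w _].
  by congr pair; apply/val_inj.
by rewrite [RHS](tuple_eta w); apply/val_inj.
Qed.

Section self_similar.
Context (R : realType) (d N : nat) (A : 'M[int]_d) (u : 'I_N -> 'cV[R]_d).
Local Notation V := (borel 'cV[R]_d).
Local Notation AR := (map_mx intr A : 'M[R]_d).
Local Notation B := (invmx AR).
Local Notation T := (ifs_map A u).
Context (C q : R) (Bg : geometric B C q) (N_gt0 : (0 < N)%N).
Implicit Types (nu : probability V R) (S : set 'cV[R]_d).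

Lemma measurable_word_preimage w (S : set V) : measurable S ->
  measurable (word_map T w @^-1` S : set V).
Proof.
move=> mS; rewrite -[X in measurable X]setTI.
exact: (continuous_borel (@word_map_continuous _ _ _ A u w)).
Qed.

Lemma fine_measure_le nu (S S' : set V) : measurable S -> measurable S' ->
  S `<=` S' -> fine (nu S) <= fine (nu S').
Proof.
move=> mS mS' SS'; rewrite fine_le ?fin_num_measure//.
by rewrite le_measure ?inE.
Qed.

Lemma fine_measure_le1 nu (S : set V) : measurable S -> fine (nu S) <= 1.
Proof.
move=> mS; rewrite -lee_fin fineK ?fin_num_measure//; exact: probability_le1.
Qed.

Lemma self_similar_fine nu (S : set V) : is_self_similar T nu -> measurable S ->
  fine (nu S) = N%:R^-1 * \sum_j fine (nu (T j @^-1` S)).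
Proof.
move=> nuT mS; apply: EFin_inj; rewrite fineK ?fin_num_measure// nuT//.
rewrite EFinM -sumEFin; congr (_ * _)%E; apply: eq_bigr => j _.
by rewrite fineK// fin_num_measure//; exact: (measurable_word_preimage [:: j]).
Qed.

Lemma self_similar_words nu n (S : set V) : is_self_similar T nu -> measurable S ->
  fine (nu S) = (N%:R ^+ n)^-1 * \sum_(w : n.-tuple 'I_N) fine (nu (word_map T w @^-1` S)).
Proof.
move=> nuT; elim: n S => [|n IH] S mS.
  rewrite expr0 invr1 mul1r (big_pred1 [tuple])//= => w.
  by rewrite [w]tuple0 /= eqxx.
rewrite self_similar_fine// big_tuple_cons exprS invfM -mulrA; congr (_ * _).
rewrite mulr_sumr; apply: eq_bigr => j _; rewrite IH//.
exact: (measurable_word_preimage [:: j]).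
Qed.

Definition word_frequency n x0 S : R :=
  (N%:R ^+ n)^-1 * \sum_(w : n.-tuple 'I_N) (`[< S (word_map T w x0) >])%:R.

Lemma sum_tuples_cst n (c : R) :
  (N%:R ^+ n)^-1 * \sum_(w : n.-tuple 'I_N) c = c.
Proof.
rewrite sumr_const card_tuple card_ord -[c *+ _]mulr_natl natrX mulrA mulVf ?mul1r//.
by rewrite expf_neq0// pnatr_eq0 -lt0n.
Qed.

Lemma probability_ball nu e : 0 < e ->
  exists2 r : R, 0 < r & 1 - e < fine (nu (ball (0 : 'cV[R]_d) r)).
Proof.
move=> e0; pose F k : set V := ball (0 : 'cV[R]_d) k%:R.
have FT : \bigcup_k F k = setT.
  rewrite -subTset => x _; exists (Num.truncn `|x|).+1 => //.
  by rewrite /F mx_norm_ball /= sub0r normrN truncnS_gt.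
have e1 : ((1 - e)%:E < 1)%E by rewrite lte_fin ltrBlDr ltrDl.
have h : (nu \o F) x @[x --> \oo] --> 1%E.
  rewrite -(probability_setT nu) -FT; apply: nondecreasing_cvg_mu.
  - by move=> i; exact: measurable_ball_cV.
  - by rewrite FT; exact: measurableT.
  - by move=> a b ab; rewrite subsetEset; apply: le_ball; rewrite ler_nat.
move: h => /(_ _ (open_ereal_gt' e1))[k _ /(_ k.+1 (leqnSn k))] /= h.
exists k.+1%:R => //; rewrite -lte_fin fineK// fin_num_measure//.
exact: measurable_ball_cV.
Qed.

(* For long words, the images T_w of a ball of nu-measure almost 1 have small
   diameter, so nu is close to the distribution of T_w x0 for uniform w. *)
Lemma self_similar_frequency nu x0 e h : is_self_similar T nu -> 0 < e -> 0 < h ->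
  exists n0 : nat, forall n (S : set V), (n0 <= n)%N -> measurable S ->
    fine (nu S) <= word_frequency n x0 (thick S e) + h /\
    word_frequency n x0 S <= fine (nu (thick S e)) + h.
Proof.
move=> nuT e0 h0; have [r r0 rh] := probability_ball nu h0.
have rx0 : 0 <= r + `|x0| by rewrite addr_ge0// ltW.
have [n0 small] := geometric_small Bg rx0 e0.
exists n0 => n S n0n mS.
have near0 (w : n.-tuple 'I_N) x : ball (0 : 'cV[R]_d) r x ->
    `|word_map T w x - word_map T w x0| < e.
  rewrite cV_ballE sub0r normrN => xr.
  rewrite !word_mapE opprD addrACA subrr addr0 -mulmxBr size_tuple.
  by apply: small => //; rewrite (le_trans (ler_normB _ _))// lerD2r ltW.
have mB := @measurable_ball_cV R d 0 r.
split.
  rewrite (self_similar_words n nuT mS) /word_frequency.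
  rewrite -[X in _ + X](sum_tuples_cst n) -mulrDr -big_split/=.
  rewrite ler_wpM2l ?invr_ge0 ?exprn_ge0//; apply: ler_sum => w _.
  have mw := measurable_word_preimage w mS.
  case: asboolP => [_|nS] /=.
    by rewrite (le_trans (fine_measure_le1 _ mw))// lerDl ltW.
  rewrite add0r.
  apply: (@le_trans _ _ (fine (nu (~` ball (0 : 'cV[R]_d) r)))).
    apply: fine_measure_le => //; first exact: measurableC.
    move=> x Sx xr; apply: nS; exists (word_map T w x) => //.
    exact: near0.
  rewrite probability_setC// fineB ?fin_num_measure//=.
  by rewrite lerBlDl -lerBlDr ltW.
have mt := @measurable_thick R d S e.
rewrite (self_similar_words n nuT mt) /word_frequency.
rewrite -[X in _ + X](sum_tuples_cst n) -mulrDr -big_split/=.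
rewrite ler_wpM2l ?invr_ge0 ?exprn_ge0//; apply: ler_sum => w _.
case: asboolP => [Sw|_] /=; last by rewrite addr_ge0 ?fine_ge0// ltW.
rewrite -lerBlDr (le_trans (ltW rh))//.
apply: fine_measure_le => //; first exact: measurable_word_preimage.
by move=> x /near0 xw; exists (word_map T w x0) => //; rewrite distrC.
Qed.

(** Closed sets generate the Borel sets and are stable under intersection, so they suffice. For such
    a set one measure is at most the word frequency of a neighbourhood, which is at most the other
    measure of a larger neighbourhood, up to small errors. *)
Lemma self_similar_unique nu nu' : is_self_similar T nu -> is_self_similar T nu' ->
  forall E, measurable E -> nu E = nu' E.
Proof.
move=> nuT nuT'.
have le12 (m1 m2 : probability V R) : is_self_similar T m1 ->
    is_self_similar T m2 -> forall S, closed S -> (m1 S <= m2 S)%E.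
  move=> m1T m2T S cS; have mS := measurable_borel_closed cS.
  rewrite leNgt; apply/negP => m21.
  have m2fin : m2 S \is a fin_num by rewrite fin_num_measure.
  have m1fin : m1 S \is a fin_num by rewrite fin_num_measure.
  (* One third for each comparison with word frequencies and one for the thickening of [S]. *)
  pose h := (fine (m1 S) - fine (m2 S)) / 3.
  have h0 : 0 < h.
    by rewrite divr_gt0// subr_gt0 -lte_fin !fineK.
  have Sc : (m2 S < (fine (m2 S) + h)%:E)%E.
    by rewrite -[ltLHS]fineK// lte_fin ltrDl.
  have tfin : (m2 (thick S 1) < +oo)%E.
    rewrite (le_lt_trans (probability_le1 _ _)) ?ltry//; exact: measurable_thick.
  have [e e0 Se] := measure_thick_lt cS tfin Sc.
  have e20 : 0 < e / 2 by rewrite divr_gt0.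
  have [n1 h1] := self_similar_frequency 0 m1T e20 h0.
  have [n2 h2] := self_similar_frequency 0 m2T e20 h0.
  pose n := maxn n1 n2.
  have [a1 _] := h1 n S (leq_maxl _ _) mS.
  have [_ a2] := h2 n _ (leq_maxr _ _) (@measurable_thick R d S (e / 2)).
  have a3 : fine (m2 (thick (thick S (e / 2)) (e / 2))) <= fine (m2 (thick S e)).
    apply: fine_measure_le; [exact: measurable_thick|exact: measurable_thick|].
    by have := @thick_thick R d S (e / 2) (e / 2); rewrite -splitr.
  have a4 : fine (m2 (thick S e)) < fine (m2 S) + h.
    by rewrite -lte_fin fineK// fin_num_measure//; exact: measurable_thick.
  have a5 : fine (m1 S) = fine (m2 S) + h *+ 3.
    by rewrite /h -mulr_natr divfK// addrC subrK.
  by clear -h0 a1 a2 a3 a4 a5; lra.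
move=> E mE.
apply: (@measure_unique _ R V closed (fun=> setT)) => //.
- rewrite eqEsubset; split; apply: smallest_sub.
  + exact: smallest_sigma_algebra.
  + move=> U oU; rewrite -[U]setCK.
    pose W := g_sigma_algebraType (closed : set (set V)).
    apply: (@measurableC _ W); apply: sub_sigma_algebra; exact: open_closedC.
  + exact: smallest_sigma_algebra.
  + by move=> S cS; exact: measurable_borel_closed.
- by move=> S S' cS cS'; exact: closedI.
- by rewrite bigcup_const//; exists 0%N.
- by move=> S cS; apply/eqP; rewrite eq_le !le12.
- by move=> _; apply: le_lt_trans (probability_le1 nu _) (ltry _).
Qed.

(** With base point in [X] all points T_w x0 stay in [X], so its word frequency is 1 and every
    neighbourhood of [X] has almost full measure. *)
Lemma self_similar_support nu X : is_self_similar T nu -> is_attractor T X ->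
  nu X = 1%E.
Proof.
move=> nuT Xa; have [cX [x0 Xx0] _] := Xa.
have clX := closed_compact_cV cX.
have mX := measurable_borel_closed clX.
apply/eqP; rewrite eq_le probability_le1//= leNgt; apply/negP => nuX.
have fX : nu X \is a fin_num by rewrite fin_num_measure.
pose h := (1 - fine (nu X)) / 2.
have h0 : 0 < h by rewrite divr_gt0// subr_gt0 -lte_fin fineK.
have Xc : (nu X < (fine (nu X) + h)%:E)%E.
  by rewrite -[ltLHS]fineK// lte_fin ltrDl.
have tfin : (nu (thick X 1) < +oo)%E.
  rewrite (le_lt_trans (probability_le1 _ _)) ?ltry//; exact: measurable_thick.
have [e e0 Xe] := measure_thick_lt clX tfin Xc.
have [n /(_ n X (leqnn n) mX)[_]] := self_similar_frequency x0 nuT e0 h0.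
have -> : word_frequency n x0 X = 1.
  rewrite -[RHS](sum_tuples_cst n); congr (_ * _); apply: eq_bigr => w _.
  by rewrite asboolT//; apply: attractor_word.
have : fine (nu (thick X e)) < fine (nu X) + h.
  by rewrite -lte_fin fineK// fin_num_measure//; exact: measurable_thick.
have : h *+ 2 = 1 - fine (nu X) by rewrite /h -mulr_natr divfK.
by clear nuX Xc tfin Xe; lra.
Qed.

End self_similar.

(** * Existence of the self-similar measure by digit coding *)

Section coding.
Context (R : realType) (d N : nat) (A : 'M[int]_d) (u : 'I_N -> 'cV[R]_d).
Local Notation V := (borel 'cV[R]_d).
Local Notation AR := (map_mx intr A : 'M[R]_d).
Local Notation B := (invmx AR).
Local Notation T := (ifs_map A u).
Context (C q : R) (Bg : geometric B C q) (N_gt0 : (0 < N)%N).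
Local Notation X := (measurableTypeR R).

Let NR_gt0 : 0 < N%:R :> R. Proof. by rewrite ltr0n. Qed.

Definition digit_cell (j : 'I_N) : set X := [set` `[j%:R / N%:R, j.+1%:R / N%:R[ ].

Definition unit_cell : set X := [set` `[0, 1[ ].

Lemma digit_cellE j x : digit_cell j x = unit_cell (N%:R * x - j%:R) :> Prop.
Proof.
rewrite /digit_cell /unit_cell /= !in_itv/= ler_pdivrMr// ltr_pdivlMr//.
by rewrite subr_ge0 ltrBlDr -natr1 [1 + _]addrC !(mulrC x).
Qed.

Lemma digit_cell_disjoint j k x : digit_cell j x -> digit_cell k x -> j = k.
Proof.
rewrite !digit_cellE /unit_cell /= !in_itv/= !subr_ge0 !ltrBlDr.
move=> /andP[j1 j2] /andP[k1 k2]; apply/val_inj/eqP; rewrite eqn_leq.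
have := le_lt_trans j1 k2; have := le_lt_trans k1 j2.
by rewrite ![1 + _]addrC !natr1 !ltr_nat !ltnS => -> ->.
Qed.

Lemma unit_cell_bigcup : unit_cell = \bigcup_j digit_cell j.
Proof.
apply/seteqP; split=> [x|x [j _]]; rewrite /unit_cell /digit_cell /= !in_itv/=.
  move=> /andP[x0 x1].
  have Nx0 : 0 <= N%:R * x by rewrite mulr_ge0.
  have /andP[k1 k2] := truncn_itv Nx0.
  have kN : (Num.truncn (N%:R * x)%R < N)%N.
    by rewrite -(ltr_nat R) (le_lt_trans k1)// gtr_pMr.
  exists (Ordinal kN) => //=; rewrite in_itv/= ler_pdivrMr// ltr_pdivlMr//.
  by rewrite !(mulrC x) k1.
move=> /andP[x0 x1]; rewrite (le_trans _ x0)/= ?divr_ge0//.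
by rewrite (lt_le_trans x1)// ler_pdivrMr// mul1r ler_nat.
Qed.

(** The point T_w 0, where [w] consists of the first [n] base-N digits of [x]; the map N x - j
    removes the first digit. Outside [0, 1) the value is 0. *)
Fixpoint coding_approx n (x : X) : 'cV[R]_d :=
  if n is m.+1 then
    if [pick j | `[< digit_cell j x >]] is Some j
    then T j (coding_approx m (N%:R * x - j%:R)) else 0
  else 0.

Lemma coding_approx_cell n j x : digit_cell j x ->
  coding_approx n.+1 x = T j (coding_approx n (N%:R * x - j%:R)).
Proof.
move=> jx /=; case: pickP => [k /asboolP kx|/(_ j)]; last by rewrite asboolT.
by rewrite (digit_cell_disjoint kx jx).
Qed.

Lemma coding_approx_notin n x : ~ unit_cell x -> coding_approx n x = 0.
Proof.
case: n => //= n nx; case: pickP => // j /asboolP jx.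
by exfalso; apply: nx; rewrite unit_cell_bigcup; exists j.
Qed.

Lemma coding_approx_translation n x : exists w, coding_approx n x = translation A u w.
Proof.
elim: n x => [|n IH] x; first by exists [::].
rewrite /=; case: pickP => [j _|_]; last by exists [::].
by have [w ->] := IH (N%:R * x - j%:R); exists (j :: w).
Qed.

Lemma coding_approx_bound : exists2 K : R, 0 < K & forall n x, `|coding_approx n x| <= K.
Proof.
have [C0 q0 q1 _] := Bg.
have U0 : 0 <= \sum_j `|u j| by exact: sumr_ge0.
have uU j : `|u j| <= \sum_j `|u j| by rewrite [leRHS](bigD1 j)//= lerDl sumr_ge0.
exists (C * (\sum_j `|u j|) / (1 - q) + 1).
  by rewrite ltr_wpDl// divr_ge0 ?mulr_ge0 ?subr_ge0// ltW.
move=> n x; have [w ->] := coding_approx_translation n x.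
by rewrite (le_trans (translation_bound w Bg U0 uU))// lerDl.
Qed.

(** The two points share their first [n] digits, so that their difference is B^n times a vector
    bounded by [K]. As for [translation_bound], the induction carries an additional power of B. *)
Lemma coding_approx_cauchy K : (forall n x, `|coding_approx n x| <= K) ->
  forall n k x, `|coding_approx (n + k) x - coding_approx n x| <= C * K * q ^+ n.
Proof.
move=> cK n k x; have [C0 q0 q1 BC] := Bg.
suff h m : `|B ^+ m *m (coding_approx (n + k) x - coding_approx n x)| <= C * K * q ^+ (n + m).
  by have := h 0%N; rewrite expr0 mul1mx addn0.
elim: n m x => [|n IH] m x.
  rewrite subr0 add0n (le_trans (BC m _))// mulrAC ler_wpM2r ?exprn_ge0 ?(ltW q0)//.
  by rewrite ler_wpM2l// ltW.
rewrite addSn /=; case: pickP => [j _|_].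
  rewrite /ifs_map opprD addrACA subrr addr0 -mulmxBr mulmxA -exprmxSr.
  by rewrite addSnnS; exact: IH.
rewrite subrr mulmx0 normr0 !mulr_ge0 ?exprn_ge0 ?(ltW q0) ?(ltW C0)//.
exact: le_trans (normr_ge0 _) (cK 0%N x).
Qed.

Lemma measurable_coding_approx n : measurable_fun [set: X] (coding_approx n : X -> V).
Proof.
elim: n => [|n IH]; first exact: measurable_cst.
move=> _ E mE; rewrite setTI.
have mT j : measurable_fun [set: X] (fun x : X => coding_approx n (N%:R * x - j%:R) : V).
  apply: (measurableT_comp IH).
  by apply: measurable_funB => //; apply: measurable_funM.
rewrite (_ : _ @^-1` E = (\bigcup_j (digit_cell j `&`
    (fun x : X => coding_approx n (N%:R * x - j%:R)) @^-1` (T j @^-1` E)))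
    `|` (~` unit_cell `&` [set x | E 0])).
  apply: measurableU.
    apply: measurable_bigcup_fin => j; apply: measurableI; first exact: measurable_itv.
    rewrite -[X in measurable X]setTI; apply: (mT j) => //.
    exact: (@measurable_word_preimage R d N A u [:: j]).
  apply: measurableI; first by apply: measurableC; exact: measurable_itv.
  have [E0|E0] := pselect (E 0).
    by rewrite (_ : [set _ | _] = setT)//; apply/seteqP; split.
  by rewrite (_ : [set _ | _] = set0)//; apply/seteqP; split.
apply/seteqP; split=> [x Ex|x [[j _ [jx Ex]]|[nx E0]]].
- have [|nx] := pselect (unit_cell x); last first.
    by right; split => //=; rewrite -(coding_approx_notin n.+1 nx).
  rewrite unit_cell_bigcup => -[j _ jx]; left; exists j => //; split => //.
  by rewrite /= -coding_approx_cell.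
- by rewrite /preimage/= -/(coding_approx n.+1 x) (coding_approx_cell _ jx).
- by rewrite /preimage/= -/(coding_approx n.+1 x) coding_approx_notin.
Qed.

Lemma coding_approx_cvg x : cvg (coding_approx n x @[n --> \oo]).
Proof.
have [C0 q0 q1 BC] := Bg; have [K K0 cK] := coding_approx_bound.
apply: (@cauchy_cvgP 'cV[R]_d (coding_approx n x @[n --> \oo]) _).1.
apply: (@cauchy_exP R 'cV[R]_d (coding_approx n x @[n --> \oo])) => e e0.
have : C * K * q ^+ n @[n --> \oo] --> C * K * 0.
  by apply: cvgMr; apply: cvg_expr; rewrite gtr0_norm.
rewrite mulr0 => /cvgr0Pnorm_lt/(_ e e0)[n0 _ h].
exists (coding_approx n0 x), n0 => // n /= n0n.
rewrite cV_ballE distrC -(subnKC n0n).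
apply: (le_lt_trans (coding_approx_cauchy cK _ _ _)).
by apply: le_lt_trans (h n0 (leqnn n0)); exact: ler_norm.
Qed.

(* For x uniform in [0, 1), the law of sum_k B^k u_(j_k), where j_k is the k-th
   digit of x in base N, is self-similar. *)
Definition coding (x : X) : 'cV[R]_d := lim (coding_approx n x @[n --> \oo]).

Lemma coding_cell j x : digit_cell j x ->
  coding x = T j (coding (N%:R * x - j%:R)).
Proof.
move=> jx.
have c1 : coding_approx n.+1 x @[n --> \oo] --> coding x.
  rewrite (cvg_shiftS (fun n => coding_approx n x)); exact: coding_approx_cvg.
have E : (fun n => coding_approx n.+1 x) =
    T j \o (fun n => coding_approx n (N%:R * x - j%:R)).
  by apply/funext => n; exact: coding_approx_cell.
have c2 : (T j \o (fun n => coding_approx n (N%:R * x - j%:R))) n @[n --> \oo] -->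
    T j (coding (N%:R * x - j%:R)).
  have h : coding_approx n (N%:R * x - j%:R) @[n --> \oo] -->
      coding (N%:R * x - j%:R) by exact: coding_approx_cvg.
  exact: cvg_comp h (@ifs_map_continuous _ _ _ A u j _).
move: c1; rewrite E => c1; exact: (cvg_unique _ c1 c2).
Qed.

Lemma measurable_coding : measurable_fun [set: X] (coding : X -> V).
Proof.
apply: measurable_fun_cV => i.
apply: (measurable_fun_cvg (h := fun n x => coding_approx n x i ord0)).
  move=> n; apply: (measurableT_comp (@measurable_coord_cV R d i)).
  exact: measurable_coding_approx.
move=> x _.
have h : coding_approx n x @[n --> \oo] --> coding x by exact: coding_approx_cvg.
exact: cvg_comp h (@coord_continuous _ _ _ i ord0 _).
Qed.

Lemma lebesgue_measure_affine_preimage j (E : set X) : measurable E ->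
  lebesgue_measure ((fun x : X => N%:R * x - j%:R : X) @^-1` E) =
  ((N%:R^-1)%:E * lebesgue_measure E)%E.
Proof.
move=> mE.
have ms : measurable_fun [set: X] (fun x : X => N%:R * x - j%:R : X).
  by apply: measurable_funB => //; apply: measurable_funM.
pose nu := measure_function_pushforward__canonical__measure_function_Measure
  (@lebesgue_measure R) ms.
have N0 : 0 <= N%:R :> R by rewrite ltW.
pose mu := mscale (NngNum N0) nu.
have muE : (lebesgue_measure E = mu E)%E.
  apply: lebesgue_measure_unique => // _ [[a b]] /= _ <-.
  rewrite /mu /mscale/= /pushforward.
  rewrite (_ : _ @^-1` _ = [set` `](a + j%:R) / N%:R, (b + j%:R) / N%:R] ]).
    rewrite !lebesgue_measure_itv/= !lte_fin ltr_pM2r ?invr_gt0// ltrD2r.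
    case: ifP => _; last by rewrite mule0.
    rewrite -!EFinB -EFinM; congr (_%:E); field.
    by rewrite gt_eqF.
  apply/seteqP; split=> x /=; rewrite !in_itv/=.
    by rewrite ltr_pdivrMr// ler_pdivlMr// ltrBrDr lerBlDr mulrC.
  by rewrite ltr_pdivrMr// ler_pdivlMr// ltrBrDr lerBlDr mulrC.
by rewrite muE /mu /mscale/= muleA -EFinM mulVf ?mul1e// gt_eqF.
Qed.

(** The unit interval splits into its [N] digit cells. On the cell of [j] the coding is T_j composed
    with the coding of N x - j, and this affine map stretches the cell onto [0, 1) by the factor
    N. *)
Lemma self_similar_exists : exists nu, is_self_similar T nu.
Proof.
have mu1 : measurable unit_cell by exact: measurable_itv.
pose nu0 := measure_function_pushforward__canonical__measure_function_Measure
  (mrestr (@lebesgue_measure R) mu1) measurable_coding.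
have nu0E E : nu0 E = lebesgue_measure (coding @^-1` E `&` unit_cell) by [].
have nu01 : nu0 setT = 1%E.
  rewrite nu0E preimage_setT setTI /unit_cell lebesgue_measure_itv/=.
  by rewrite lte_fin ltr01 sube0.
pose nu : probability V R := HB.pack (Measure.sort nu0) (Measure.class nu0)
    (Measure_isProbability.Build _ _ _ nu0 nu01).
exists nu => E mE.
have nuE S : nu S = lebesgue_measure (coding @^-1` S `&` unit_cell) by [].
have mc S : measurable (S : set V) -> measurable (coding @^-1` S).
  by move=> mS; rewrite -[X in measurable X]setTI; exact: measurable_coding.
have mTE j : measurable (T j @^-1` E : set V).
  exact: (@measurable_word_preimage R d N A u [:: j]).
have -> : nu E = (\sum_j lebesgue_measure (coding @^-1` E `&` digit_cell j))%E.
  rewrite nuE unit_cell_bigcup setI_bigcupr measure_bigcup_fin//.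
  - by move=> j; apply: measurableI; [exact: mc|exact: measurable_itv].
  - move=> j k jk; apply/seteqP; split=> // x [[_ jx] [_ kx]].
    by move/eqP: jk; apply; exact: digit_cell_disjoint kx.
transitivity (\sum_j (N%:R^-1%:E * nu (T j @^-1` E)))%E; last first.
  by apply/esym/ge0_sume_distrr => j _; exact: (measure_ge0 nu).
apply: eq_bigr => j _; rewrite nuE -(lebesgue_measure_affine_preimage j); last first.
  by apply: measurableI => //; exact: mc.
congr (lebesgue_measure _); apply/seteqP; split=> x /=.
  by move=> [Ex jx]; rewrite -digit_cellE -coding_cell.
by rewrite -digit_cellE => -[Ex jx]; rewrite (coding_cell jx).
Qed.

End coding.

(** * Box dimension and exact overlaps *)

Lemma det_expmx (K : comPzRingType) n (M : 'M[K]_n) k : \det (M ^+ k) = \det M ^+ k.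
Proof.
elim: k => [|k IH]; first by rewrite !expr0 det1.
by rewrite exprmxS det_mulmx IH exprS.
Qed.

Lemma unitmx_exp (K : comUnitRingType) n (M : 'M[K]_n) k :
  M \in unitmx -> M ^+ k \in unitmx.
Proof. by rewrite !unitmxE det_expmx => Mu; exact: unitrX. Qed.

Lemma exp_invmxK (K : comUnitRingType) n (M : 'M[K]_n) k : M \in unitmx ->
  invmx M ^+ k *m M ^+ k = 1%:M.
Proof.
move=> Mu; elim: k => [|k IH]; first by rewrite !expr0 mulmx1.
by rewrite exprmxSr exprmxS -mulmxA (mulmxA (invmx M)) mulVmx// mul1mx IH.
Qed.

Lemma exp_mulmxK (K : comUnitRingType) n (M : 'M[K]_n) k : M \in unitmx ->
  M ^+ k *m invmx M ^+ k = 1%:M.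
Proof. by move=> Mu; apply/mulmx1C/exp_invmxK. Qed.

Section packing.
Context (R : realType) (d : nat).
Implicit Types (X : set 'cV[R]_d) (e v : R).

Definition separated n (c : 'I_n -> 'cV[R]_d) e :=
  forall i j, i != j -> e <= `|c i - c j|.

(** The balls of radius [e / 2] around the points are disjoint, have volume e^d each and lie in the
    neighbourhood of [X]. *)
Lemma separated_card X n (c : 'I_n -> 'cV[R]_d) e v : 0 < e ->
  (forall i, X (c i)) -> separated c e ->
  (lebesgue_cV (thick X (e / 2)) <= v%:E)%E -> n%:R * e ^+ d <= v.
Proof.
move=> e0 Xc sc Xv; have e20 : 0 < e / 2 by rewrite divr_gt0.
pose F i : set (borel 'cV[R]_d) := ball (c i) (e / 2).
have mF i : measurable (F i) by exact: measurable_ball_cV.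
have FE : lebesgue_cV (\bigcup_i F i) = (n%:R * e ^+ d)%:E.
  rewrite measure_bigcup_fin//.
    rewrite (eq_bigr (fun=> (e ^+ d)%:E)) => [|i _].
      by rewrite sumEFin sumr_const card_ord mulr_natl.
    apply: etrans (lebesgue_cV_ball _ e20) _.
    by rewrite -[_ *+ 2]mulr_natr divfK.
  move=> i j ij; apply/seteqP; split=> // x [].
  rewrite /F !cV_ballE => ix jx; have := sc i j ij.
  rewrite leNgt => /negP; apply.
  rewrite -[_ - _](subrKA x) (le_lt_trans (ler_normD _ _))//.
  by rewrite [ltRHS](splitr e) ltrD// distrC.
rewrite -lee_fin -FE (le_trans _ Xv)//; apply: le_measure; rewrite ?inE.
- exact: measurable_bigcup_fin.
- exact: measurable_thick.
- by move=> x [i _]; rewrite /F cV_ballE => ix; exists (c i).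
Qed.

(** The centres of a maximal [e]-separated family in [X] cover [X] by balls of radius [e], and the
    volume bounds their number. *)
Lemma covering_number_le X e v : 0 < e ->
  (lebesgue_cV (thick X (e / 2)) <= v%:E)%E ->
  (covering_number X e <= (v / e ^+ d)%:E)%E.
Proof.
move=> e0 Xv; have ed0 : 0 < e ^+ d by rewrite exprn_gt0.
pose P n := `[< exists c : 'I_n -> 'cV[R]_d, (forall i, X (c i)) /\ separated c e >].
have P0 : exists n, P n.
  by exists 0%N; apply/asboolP; exists (fun=> 0); split=> -[].
have Pv n : P n -> n%:R <= v / e ^+ d.
  by move=> /asboolP[c [Xc sc]]; rewrite ler_pdivlMr//; exact: separated_card Xv.
have Pb n : P n -> (n <= Num.truncn (v / e ^+ d))%N.
  move=> /Pv nv; rewrite -ltnS -(ltr_nat R) (le_lt_trans nv)//.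
  exact: truncnS_gt.
case: (ex_maxnP P0 Pb) => n Pn nmax.
apply: (@le_trans _ _ n%:R%:E); last by rewrite lee_fin; exact: Pv.
apply: ereal_inf_lbound; exists n => //.
move/asboolP: Pn => [c [Xc sc]]; exists c => x Xx.
have [//|nx] := pselect ((\bigcup_i ball (c i) e) x).
have far i : e <= `|c i - x|.
  by rewrite leNgt; apply/negP => ix; apply: nx; exists i => //; rewrite cV_ballE.
suff /nmax : P n.+1 by rewrite ltnn.
apply/asboolP; exists (fun i => if unlift ord0 i is Some j then c j else x); split.
  by move=> i; case: unliftP.
move=> i j; case: (unliftP ord0 i) => [i' ->|->]; case: (unliftP ord0 j) => [j' ->|->] ij.
- by apply: sc; apply: contraNneq ij => ->.
- exact: far.
- by rewrite distrC; exact: far.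
- by rewrite eqxx in ij.
Qed.

Lemma covering_number_mono X e e' : e <= e' ->
  (covering_number X e' <= covering_number X e)%E.
Proof.
move=> ee'; apply: ereal_inf_le_tmp => _ [n [c Xc] <-]; exists n => //.
exists c => x /Xc[i _ ix]; exists i => //.
by apply: le_ball ix.
Qed.

(* The rates eps_k = a^-k are met up to the factor a, so a bound
   N(X, a^-k) <= K (a^d theta)^k gives dimension at most d + ln theta / ln a. *)
Lemma upper_box_dimension_lt X (a theta K : R) : 1 < a -> 0 < theta -> theta < 1 ->
  0 < K -> (forall k : nat, (covering_number X (a ^- k) <= (theta ^+ k * K * a ^+ (k * d))%:E)%E) ->
  (upper_box_dimension X < d%:R%:E)%E.
Proof.
have lin (x1 x2 x3 x4 x5 k l D : R) : x1 <= - k * l -> x2 <= D * l + x3 ->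
    x4 <= x5 -> x5 + x3 + 1 <= k / 2 * l -> x1 + x4 + x2 <= (D - k / 2) * l.
  lra.
move=> a1 t0 t1 K0 cov.
have a0 : 0 < a by rewrite (lt_trans _ a1).
have la : 0 < ln a by rewrite ln_gt0.
have lt : ln theta < 0 by rewrite ln_lt0// t0.
(* The full gain in dimension. Half of it is given up to absorb the constants collected in [K'],
   which is possible as soon as [- ln e] exceeds [L0]. *)
pose kap := - ln theta / ln a.
have kap0 : 0 < kap by rewrite divr_gt0// oppr_gt0.
pose K' := `|ln K| + d%:R * ln a + 1.
have K'0 : 0 < K' by rewrite ltr_wpDl// addr_ge0// mulr_ge0// ltW.
pose L0 := 2 * K' / kap.
have L00 : 0 < L0 by rewrite divr_gt0// mulr_gt0.
apply: (@le_lt_trans _ _ (d%:R - kap / 2)%:E); last first.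
  by rewrite lte_fin ltrBlDr ltrDl divr_gt0.
pose V := [set e : R | 0 < e < expR (- L0)].
apply: (@le_trans _ _ (ereal_sup
    [set (lne (covering_number X e) / (- ln e)%:E)%E | e in V])).
  apply: ereal_inf_lbound; exists V => //.
  rewrite /V; near=> e; apply/andP; split; near: e.
    exact: nbhs_right_gt.
  by apply: nbhs_right_lt; exact: expR_gt0.
apply: ge_ereal_sup => _ [e /= /andP[e0 eL] <-].
pose L := - ln e.
have LL0 : L0 < L.
  by rewrite /L ltrNr -[ltRHS]expRK ltr_ln// posrE expR_gt0.
have L0' : 0 < L := lt_trans L00 LL0.
(* The first [k] with a^-k < e. *)
pose k := (Num.truncn (L / ln a)).+1.
have k1 : L / ln a < k%:R by exact: truncnS_gt.
have k2 : k%:R <= L / ln a + 1.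
  by rewrite /k -natr1 lerD2r truncn_le// divr_ge0// ltW.
have ake : a ^- k <= e.
  rewrite -[leRHS]lnK ?posrE// -[leLHS]lnK ?posrE ?invr_gt0 ?exprn_gt0//.
  rewrite ler_expR lnV ?posrE ?exprn_gt0// lnXn// lerNl -/L -mulr_natr.
  by rewrite -ler_pdivrMl// mulrC ltW.
have := le_trans (covering_number_mono X ake) (cov k) => covk.
have rhs0 : 0 < theta ^+ k * K * a ^+ (k * d).
  by rewrite !mulr_gt0 ?exprn_gt0.
have lcov : (lne (covering_number X e) <= (ln (theta ^+ k * K * a ^+ (k * d)))%:E)%E.
  have c0 : (0 <= covering_number X e)%E.
    by apply: le_ereal_inf_tmp => _ [n _ <-]; rewrite lee_fin.
  rewrite -lne_EFin// lee_lne// in_itv/= ?leey ?andbT//.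
  by rewrite lee_fin ltW.
have lnE : ln (theta ^+ k * K * a ^+ (k * d)) =
    k%:R * ln theta + ln K + d%:R * (k%:R * ln a).
  rewrite !lnM ?posrE ?mulr_gt0 ?exprn_gt0// !lnXn//.
  rewrite -[ln theta *+ k]mulr_natl -[ln a *+ (k * d)]mulr_natl natrM mulrA.
  by rewrite (mulrC d%:R).
have -> : ((- ln e)%:E^-1 = (L^-1)%:E)%E by rewrite inver gt_eqF.
apply: (@le_trans _ _ ((ln (theta ^+ k * K * a ^+ (k * d)))%:E * (L^-1)%:E)%E).
  by apply: lee_wpmul2r => //; rewrite lee_fin invr_ge0 ltW.
rewrite -EFinM lee_fin ler_pdivrMr// lnE.
have b1 : k%:R * ln theta <= - kap * L.
  rewrite (_ : - kap * L = L / ln a * ln theta); last by rewrite /kap; field; rewrite gt_eqF.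
  by rewrite ler_nM2r// ltW.
have b2 : k%:R * ln a <= L + ln a.
  have := ler_wpM2r (ltW la) k2; rewrite mulrDl divfK ?gt_eqF// mul1r; exact.
have b3 : d%:R * (k%:R * ln a) <= d%:R * L + d%:R * ln a.
  by rewrite -mulrDr ler_wpM2l.
have b4 : ln K <= `|ln K| by exact: ler_norm.
have b5 : K' <= kap / 2 * L.
  have -> : K' = kap / 2 * L0.
    by rewrite /L0; field; rewrite gt_eqF.
  by apply: ler_wpM2l; [rewrite divr_ge0// ltW|exact: ltW].
exact: lin b1 b3 b4 b5.
Unshelve. all: by end_near. Qed.

End packing.

Section overlaps.
Context (R : realType) (d N : nat) (A : 'M[int]_d) (u : 'I_N -> 'cV[R]_d).
Local Notation V := (borel 'cV[R]_d).
Local Notation AR := (map_mx intr A : 'M[R]_d).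
Local Notation B := (invmx AR).
Local Notation T := (ifs_map A u).
Context (C q : R) (Bg : geometric B C q) (N_gt1 : (1 < N)%N).
Context (Au : AR \in unitmx) (detA : `|\det AR| = N%:R).

Let Bu : B \in unitmx. Proof. by rewrite unitmx_inv. Qed.

Let N_gt0 : (0 < N)%N. Proof. exact: ltnW. Qed.

Lemma norm_det_expB n : `|\det (B ^+ n)| = (N%:R ^+ n)^-1.
Proof. by rewrite det_expmx normrX det_inv normfV detA exprVn. Qed.

Lemma image_word_map w (E : set 'cV[R]_d) : word_map T w @` E =
  (fun x => x + translation A u w) @` ((fun x => B ^+ size w *m x) @` E).
Proof.
by rewrite image_comp; apply: eq_imagel => x _ /=; rewrite word_mapE.
Qed.

Lemma measurable_image_word w (E : set V) : measurable E ->
  measurable (word_map T w @` E : set V).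
Proof.
move=> mE; rewrite image_word_map; apply: measurable_image_shift.
by apply: measurable_image_mulmx => //; exact: unitmx_exp.
Qed.

Lemma lebesgue_image_word w (E : set V) : measurable E ->
  lebesgue_cV (word_map T w @` E) = (((N%:R ^+ size w)^-1)%:E * lebesgue_cV E)%E.
Proof.
move=> mE; rewrite image_word_map lebesgue_cV_image_shift.
  by rewrite lebesgue_cV_mulmx ?unitmx_exp// norm_det_expB.
by apply: measurable_image_mulmx => //; exact: unitmx_exp.
Qed.

Lemma word_map_eq_size v w : word_map T v = word_map T w -> size v = size w.
Proof.
move=> vw.
have mB := @measurable_ball_cV R d 0 1.
have := lebesgue_image_word v mB; rewrite vw lebesgue_image_word// => /eqP.
have lB : lebesgue_cV (ball (0 : 'cV[R]_d) 1) = ((1 *+ 2) ^+ d)%:E.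
  exact: lebesgue_cV_ball.
rewrite !lB -!EFinM eqe (inj_eq (mulIf _)) ?expf_neq0 ?mulr2n ?pnatr_eq0//.
rewrite (inj_eq invr_inj) -!natrX eqr_nat eqn_exp2l// => /eqP //.
Qed.

Lemma overlap_cover X : exact_overlaps T -> is_attractor T X ->
  exists p (L : seq 'cV[R]_d), (0 < p)%N /\ (size L < N ^ p)%N /\
    forall x, X x -> exists s y, [/\ s \in L, X y & x = B ^+ p *m y + s].
Proof.
move=> [v [w [v0 w0 vw Tvw]]] Xa; have svw := word_map_eq_size Tvw.
exists (size v), (undup [seq translation A u w | w : (size v).-tuple 'I_N]).
split; first by rewrite lt0n size_eq0.
split.
  rewrite -[X in (_ < X)%N](_ : size [seq translation A u w | w : (size v).-tuple 'I_N] = _).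
    rewrite ltn_size_undup; apply/negP => /injectiveP inj.
    have /eqP h : size w == size v by rewrite svw.
    have : in_tuple v = tcast h (in_tuple w).
      by apply: inj => /=; rewrite /translation val_tcast/= Tvw.
    by move=> /(congr1 (@tval _ _)); rewrite val_tcast/=; exact/eqP.
  by rewrite size_map -cardE card_tuple card_ord.
move=> x; rewrite {1}(attractor_words (size v) Xa) => -[t _ [y Xy <-]].
exists (translation A u t), y; split => //; last by rewrite word_mapE size_tuple.
by rewrite mem_undup; apply/mapP; exists t => //; rewrite mem_enum.
Qed.

Lemma cover_iter (M : 'M[R]_d) (X : set 'cV[R]_d) (L : seq 'cV[R]_d) k :
  (forall x, X x -> exists s y, [/\ s \in L, X y & x = M *m y + s]) ->
  exists2 Lk : seq 'cV[R]_d, size Lk = (size L ^ k)%N &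
    forall x, X x -> exists s y, [/\ s \in Lk, X y & x = M ^+ k *m y + s].
Proof.
move=> XL; elim: k => [|k [Lk sLk XLk]].
  exists [:: 0] => // x Xx; exists 0, x; split => //; first by rewrite inE.
  by rewrite expr0 mul1mx addr0.
exists [seq M *m s + t | s <- Lk, t <- L].
  by rewrite size_allpairs sLk expnSr.
move=> x /XL[t [y [tL Xy ->]]]; have [s [z [sL Xz ->]]] := XLk _ Xy.
exists (M *m s + t), z; split => //; first by apply/allpairsP; exists (s, t).
by rewrite mulmxDr mulmxA -exprmxS addrA.
Qed.

Lemma overlap_volume X : exact_overlaps T -> is_attractor T X ->
  exists a theta K : R, [/\ 1 < a, 0 < theta, theta < 1, 0 < K &
    forall k : nat, (lebesgue_cV (thick X (a ^- k)) <= (theta ^+ k * K)%:E)%E].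
Proof.
move=> ov Xa; have [p [L [p0 [sL XL]]]] := overlap_cover ov Xa.
have [cX [x0 Xx0] _] := Xa; have [r r0 Xr] := compact_bounded_cV cX.
(* A bound for the norm of A^p: applying A^(pk) turns a distance below a^-k into one below 1, whence
   the radius [r + 1] of the balls used below. The summand 2 ensures [1 < a]. *)
pose a : R := \sum_i \sum_j `|(AR ^+ p) i j| + 2.
have S0 : 0 <= \sum_i \sum_j `|(AR ^+ p) i j| :> R.
  by apply: sumr_ge0 => i _; exact: sumr_ge0.
have a1 : 1 < a by rewrite /a ltr_wpDl// ltr1n.
have a0 : 0 < a by rewrite (lt_trans _ a1).
have aA : row_sum_le (AR ^+ p) a.
  by move=> i; rewrite (le_trans (row_sum_le_ex (AR ^+ p) i))// lerDl.
have Np0 : 0 < N%:R ^+ p :> R by rewrite exprn_gt0// ltr0n.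
have sL0 : (0 < size L)%N.
  by have [s [y [sLs _ _]]] := XL x0 Xx0; case: (L) sLs.
pose theta : R := (size L)%:R / N%:R ^+ p.
exists a, theta, (((r + 1) *+ 2) ^+ d); split => //.
- by rewrite divr_gt0// ltr0n.
- by rewrite ltr_pdivrMr// mul1r -natrX ltr_nat.
- by rewrite exprn_gt0// pmulrn_lgt0// ltr_wpDl// ltW.
move=> k; have [Lk sLk XLk] := cover_iter k XL.
have r10 : 0 < r + 1 by rewrite ltr_wpDl// ltW.
pose M := (B ^+ p) ^+ k.
pose F (i : 'I_(size Lk)) : set V :=
  (fun x => x + Lk`_i) @` ((fun x => M *m x) @` ball (0 : 'cV[R]_d) (r + 1)).
have Mu : M \in unitmx by rewrite !unitmx_exp.
have mB := @measurable_ball_cV R d 0 (r + 1).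
have mMB := measurable_image_mulmx Mu mB.
have mF i : measurable (F i) by exact: measurable_image_shift.
have FE i : lebesgue_cV (F i) = ((N%:R ^+ p) ^- k * ((r + 1) *+ 2) ^+ d)%:E.
  rewrite /F lebesgue_cV_image_shift// lebesgue_cV_mulmx//.
  by rewrite [X in (_ * X)%E]lebesgue_cV_ball// det_expmx normrX norm_det_expB exprVn.
have sub : thick X (a ^- k) `<=` \bigcup_i F i.
  move=> z [x /XLk[s [y [sLs Xy ->]]] xz].
  have ss : (index s Lk < size Lk)%N by rewrite index_mem.
  exists (Ordinal ss) => //; rewrite /F/= nth_index//.
  exists (z - s); last by rewrite subrK.
  have M'M : M *m (AR ^+ p) ^+ k = 1%:M.
    by rewrite /M -!exprM exp_invmxK.
  exists ((AR ^+ p) ^+ k *m (z - s)); last by rewrite mulmxA M'M mul1mx.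
  rewrite cV_ballE sub0r normrN.
  have -> : (AR ^+ p) ^+ k *m (z - s) = y - (AR ^+ p) ^+ k *m (M *m y + s - z).
    rewrite -[in RHS](addrA (M *m y)) [in RHS]mulmxDr mulmxA (mulmx1C M'M).
    rewrite mul1mx opprD addrA subrr add0r.
    by rewrite -mulmxN opprB.
  rewrite (le_lt_trans (ler_normB _ _))// ler_ltD ?Xr//.
  apply: (le_lt_trans (mulmx_norm_le _ (row_sum_le_exp k (ltW a0) aA))).
  by rewrite -ltr_pdivlMl ?exprn_gt0// mulr1.
apply: (@le_trans _ _ (lebesgue_cV (\bigcup_i F i))).
  apply: le_measure; rewrite ?inE//; first exact: measurable_thick.
  exact: measurable_bigcup_fin.
apply: (le_trans (measure_bigcup_fin_le _ mF)).
rewrite (eq_bigr _ (fun i _ => FE i)) sumEFin lee_fin sumr_const card_ord sLk.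
by rewrite -[leLHS]mulr_natl natrX mulrA /theta expr_div_n.
Qed.

Lemma overlap_caseP : exact_overlaps T -> overlap_case A u.
Proof.
move=> ov; have Xa := attractor_exists u N_gt0 Bg.
have [a [theta [K [a1 t0 t1 K0 vol]]]] := overlap_volume ov Xa.
have a0 : 0 < a by rewrite (lt_trans _ a1).
set X := attractor T in Xa vol.
have clX : closed X by case: Xa => cX _ _; exact: closed_compact_cV.
have mX := measurable_borel_closed clX.
split => //.
  apply: (upper_box_dimension_lt a1 t0 t1 K0) => k.
  have ak0 : 0 < a ^- k by rewrite invr_gt0 exprn_gt0.
  have := @covering_number_le R d X (a ^- k) (theta ^+ k * K) ak0.
  rewrite exprVn -exprM invrK; apply.
  apply: le_trans (vol k); apply: le_measure; rewrite ?inE.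
  - exact: measurable_thick.
  - exact: measurable_thick.
  - by apply: le_thick; rewrite ler_pdivrMr// ler_pMr// ler1n.
exists X; split => //.
  apply/eqP; rewrite eq_le measure_ge0 andbT.
  apply/lee_addgt0Pr => e e0; rewrite add0e.
  have : theta ^+ k * K @[k --> \oo] --> 0 * K.
    by apply: cvgMl; apply: cvg_expr; rewrite gtr0_norm.
  rewrite mul0r => /cvgr0Pnorm_lt/(_ e e0)[k _ /(_ k (leqnn k))] h.
  apply: (@le_trans _ _ (theta ^+ k * K)%:E); last first.
    by rewrite lee_fin (le_trans (ler_norm _))// ltW.
  apply: le_trans (vol k); apply: le_measure; rewrite ?inE//.
    exact: measurable_thick.
  by apply: sub_thick; rewrite invr_gt0 exprn_gt0.
have nuT : is_self_similar T (self_similar_measure T).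
  by apply: getPex; exact: (self_similar_exists u Bg N_gt0).
rewrite probability_setC// (self_similar_support Bg N_gt0 nuT Xa).
by rewrite subee.
Qed.

End overlaps.

(** * Systems without exact overlaps *)

Section no_overlaps.
Context (R : realType) (d N : nat) (A : 'M[int]_d) (u : 'I_N -> 'cV[R]_d).
Local Notation V := (borel 'cV[R]_d).
Local Notation AR := (map_mx intr A : 'M[R]_d).
Local Notation B := (invmx AR).
Local Notation T := (ifs_map A u).
Context (C q : R) (Bg : geometric B C q) (N_gt1 : (1 < N)%N).
Context (Au : AR \in unitmx) (detA : `|\det AR| = N%:R).

Let Bu : B \in unitmx. Proof. by rewrite unitmx_inv. Qed.

Let N_gt0 : (0 < N)%N. Proof. exact: ltnW. Qed.

Definition lattice_vec m (z : 'cV[int]_d) : 'cV[R]_d := B ^+ m *m map_mx intr z.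

Lemma lattice_vecD m z z' : lattice_vec m (z + z') = lattice_vec m z + lattice_vec m z'.
Proof. by rewrite /lattice_vec map_mxD mulmxDr. Qed.

Lemma lattice_vecN m z : lattice_vec m (- z) = - lattice_vec m z.
Proof. by rewrite /lattice_vec map_mxN mulmxN. Qed.

(** As A is integral, the lattices B^m Z^d increase with [m]. *)
Lemma lattice_vec_lift m k z : lattice_vec m z = lattice_vec (m + k) (A ^+ k *m z).
Proof.
rewrite /lattice_vec exprmxD map_mxM map_mx_exp -mulmxA (mulmxA (B ^+ k)).
by rewrite exp_invmxK// mul1mx.
Qed.

Lemma lattice_common_level : (forall j, lattice_union A (u j)) ->
  exists m, forall j, exists z, u j = lattice_vec m z.
Proof.
move=> /choice[m um]; exists (\max_j m j)%N => j; have [z uz] := um j.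
exists (A ^+ (\max_j m j - m j) *m z).
by rewrite uz -/(lattice_vec (m j) z) (lattice_vec_lift _ (\max_j m j - m j)) subnKC ?leq_bigmax.
Qed.

(** For [w] of length n the vector A^n t_w is the sum of the A^(n-i) u_(w_i), and A preserves the
    lattice B^m Z^d. *)
Lemma lattice_translation m : (forall j, exists z, u j = lattice_vec m z) ->
  forall w, exists z, AR ^+ size w *m translation A u w = lattice_vec m z.
Proof.
move=> /choice[z uz]; elim=> [|j w [y IH]].
  by exists 0; rewrite /translation/= /lattice_vec map_mx0 !mulmx0.
exists (y + A ^+ (size w).+1 *m z j).
rewrite translation_cons mulmxDr lattice_vecD -IH; congr (_ + _).
  by rewrite /= exprmxSr -mulmxA mulKVmx.
rewrite uz /lattice_vec map_mxM map_mx_exp !mulmxA; congr (_ *m _).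
have AB : GRing.comm AR B by rewrite /GRing.comm; apply: (etrans (mulmxV Au)); rewrite -(mulVmx Au).
exact: (commrX _ (commr_sym (commrX _ (commr_sym AB)))).
Qed.

(** A^m sends non-zero lattice vectors to non-zero integer vectors, whose norm is at least 1. *)
Lemma lattice_separated m : exists2 rho : R, 0 < rho &
  forall z, z != 0 -> rho <= `|lattice_vec m z|.
Proof.
pose a : R := \sum_i \sum_j `|(AR ^+ m) i j| + 1.
have a0 : 0 < a.
  by rewrite ltr_wpDl//; apply: sumr_ge0 => i _; exact: sumr_ge0.
have aA : row_sum_le (AR ^+ m) a.
  by move=> i; rewrite (le_trans (row_sum_le_ex (AR ^+ m) i))// lerDl.
exists a^-1; first by rewrite invr_gt0.
move=> z z0; rewrite -[leLHS]mulr1 ler_pdivrMl//.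
have := mulmx_norm_le (lattice_vec m z) aA.
rewrite /lattice_vec mulmxA exp_mulmxK// mul1mx; apply: le_trans.
have [i zi] : exists i, z i ord0 != 0.
  apply/existsP; apply: contraNT z0 => /existsPn h.
  by apply/eqP/colP => i; rewrite mxE; apply/eqP; have := h i; rewrite negbK.
apply: le_trans (cV_coord_le (map_mx intr z : 'cV[R]_d) i).
by rewrite mxE -intr_norm (ler_int R 1) -gtz0_ge1 normr_gt0.
Qed.

Lemma finite_lattice_ball m (r : R) : exists s : seq 'cV[R]_d,
  forall z, `|lattice_vec m z| <= r -> lattice_vec m z \in s.
Proof.
pose a : R := \sum_i \sum_j `|(AR ^+ m) i j|.
pose K := Num.truncn (a * r).
pose f (g : {ffun 'I_d -> 'I_(K + K).+1}) : 'cV[int]_d := \col_i ((g i)%:Z - K%:Z).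
exists [seq lattice_vec m (f g) | g : {ffun 'I_d -> 'I_(K + K).+1}] => z zr.
have zK i : `|z i ord0| <= K%:Z.
  have h : `|(z i ord0)%:~R : R| <= a * r.
    have := cV_coord_le (map_mx intr z : 'cV[R]_d) i; rewrite mxE => /le_trans; apply.
    have -> : map_mx intr z = AR ^+ m *m lattice_vec m z.
      by rewrite /lattice_vec mulmxA exp_mulmxK// mul1mx.
    apply: (le_trans (mulmx_norm_le _ (row_sum_le_ex _))).
    by rewrite ler_wpM2l//; apply: sumr_ge0 => ? _; exact: sumr_ge0.
  move: h; rewrite -intr_norm -abszE -pmulrn lez_nat => h.
  by rewrite /K truncn_ge_nat// (le_trans _ h).
have z0 i : 0 <= z i ord0 + K%:Z by have := zK i; rewrite ler_norml => /andP[]; lia.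
have zK2 i : (absz (z i ord0 + K%:Z)%R < (K + K).+1)%N.
  by have := zK i; have := z0 i; rewrite ler_norml; lia.
apply/mapP; exists [ffun i => Ordinal (zK2 i)]; first by rewrite mem_enum.
suff {1}-> : z = f [ffun i => Ordinal (zK2 i)] by [].
apply/colP => i; rewrite mxE ffunE/= gez0_abs//.
by rewrite addrK.
Qed.

(** A closed set with empty interior contains no non-empty open set, so its translates can be
    removed from [U] one after the other. *)
Lemma open_avoid_translates (X U : set 'cV[R]_d) (s : seq 'cV[R]_d) :
  closed X -> interior X = set0 -> open U -> U !=set0 ->
  exists U', [/\ open U', U' !=set0, U' `<=` U &
    forall v x, v \in s -> U' x -> ~ X (x - v)].
Proof.
move=> cX iX; elim: s U => [|v s IH] U oU U0; first by exists U; split.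
have [U' [oU' U'0 U'U U's]] := IH U oU U0.
have cont : continuous (fun x : 'cV[R]_d => x - v) by exact: shift_cV_continuous.
pose W := U' `&` (fun x : 'cV[R]_d => x - v) @^-1` (~` X).
exists W; split.
- apply: openI => //; apply: open_comp; last exact: closed_openC.
  by move=> x _; exact: cont.
- apply/set0P/negP => /eqP W0.
  have [x U'x] := U'0; have : interior X (x - v).
    have sub : (fun y : 'cV[R]_d => y + v) @^-1` U' `<=` X.
      move=> y /= U'y; have [//|nXy] := pselect (X y).
      suff : W (y + v) by rewrite W0.
      by split => //=; rewrite addrK.
    apply: (filterS sub); apply: open_nbhs_nbhs; split; last by rewrite /= subrK.
    by apply: open_comp => // y _; exact: shift_cV_continuous.
  by rewrite iX.
- by move=> x [/U'U].
- move=> v' x; rewrite inE => /orP[/eqP -> [] //|v's [U'x _]].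
  exact: U's.
Qed.

Lemma lebesgue_open_gt0 (U : set 'cV[R]_d) : open U -> U !=set0 ->
  (0 < lebesgue_cV U)%E.
Proof.
move=> oU [x Ux].
have /nbhs_ballP[e /= e0 eU] : nbhs x U by exact: open_nbhs_nbhs.
apply: (@lt_le_trans _ _ (lebesgue_cV (ball x e))).
  by rewrite lebesgue_cV_ball// lte_fin exprn_gt0// pmulrn_lgt0.
apply: le_measure; rewrite ?inE//; first exact: measurable_ball_cV.
exact: measurable_borel_open.
Qed.

Lemma lebesgue_bounded_fin (S : set V) (r : R) : measurable S ->
  (forall x : 'cV[R]_d, S x -> `|x| <= r) -> (lebesgue_cV S < +oo)%E.
Proof.
move=> mS Sr; apply: le_lt_trans (lebesgue_cV_ball_fin (0 : 'cV[R]_d) (r + 1)).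
apply: le_measure; rewrite ?inE//; first exact: measurable_ball_cV.
by move=> x /Sr xr; rewrite cV_ballE sub0r normrN (le_lt_trans xr)// ltrDl.
Qed.

Context (ulat : forall j, lattice_union A (u j)) (nov : ~ exact_overlaps T).

Lemma translation_neq n (w w' : n.-tuple 'I_N) : w != w' ->
  translation A u w != translation A u w'.
Proof.
move=> ww'; apply/eqP => tt'; apply: nov; exists w, w'; split => //.
- case: n w w' ww' {tt'} => [w w'|n w w' _]; first by rewrite (tuple0 w) (tuple0 w') eqxx.
  by rewrite -size_eq0 size_tuple.
- case: n w w' ww' {tt'} => [w w'|n w w' _]; first by rewrite (tuple0 w) (tuple0 w') eqxx.
  by rewrite -size_eq0 size_tuple.
- by apply/funext => x; rewrite !word_mapE !size_tuple tt'.
Qed.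

(** Multiplying by A^n gives x - y = A^n (t_w' - t_w), a lattice vector, which vanishes only if the
    two words define the same map. *)
Lemma word_map_coincide n (w w' : n.-tuple 'I_N) x y m :
  (forall j, exists z, u j = lattice_vec m z) ->
  word_map T w x = word_map T w' y ->
  exists2 z, x = y + lattice_vec m z & w != w' -> z != 0.
Proof.
move=> um; rewrite !word_mapE !size_tuple => xy.
have [z1 h1] := lattice_translation um w; have [z2 h2] := lattice_translation um w'.
rewrite size_tuple in h1; rewrite size_tuple in h2.
have E : x = y + lattice_vec m (z2 - z1).
  rewrite lattice_vecD lattice_vecN -h1 -h2 -mulmxBr.
  have -> : translation A u w' - translation A u w = B ^+ n *m (x - y).
    rewrite mulmxBr -[translation A u w'](addKr (B ^+ n *m y)) -xy.
    by rewrite addrA addrK addrC.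
  by rewrite mulmxA exp_mulmxK// mul1mx addrC subrK.
exists (z2 - z1) => // ww'; apply: contra (translation_neq ww').
rewrite subr_eq0 => /eqP z12.
have : AR ^+ n *m translation A u w = AR ^+ n *m translation A u w' by rewrite h1 h2 z12.
move=> /(congr1 (mulmx (B ^+ n))); rewrite !mulmxA exp_invmxK// !mul1mx.
by move=> ->.
Qed.

(* If X had empty interior, a small open set U would avoid X + L, where L is
   the lattice containing all the A^n t_w. Then X and the sets T_w U, |w| = n,
   are disjoint and lie in any given neighbourhood of X for large n; since
   they have total measure lambda(X) + lambda(U), this is impossible. *)
Lemma attractor_interior X : is_attractor T X -> interior X !=set0.
Proof.
move=> Xa; have [cX [x0 Xx0] _] := Xa.
have clX := closed_compact_cV cX.
have [m um] := lattice_common_level ulat.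
have [rho rho0 sep] := lattice_separated m.
have [r r0 Xr] := compact_bounded_cV cX.
apply/set0P/negP => /eqP iX.
have [s sP] := finite_lattice_ball m (rho + r).
have rho20 : 0 < rho / 2 by rewrite divr_gt0.
(* The list [s] contains every lattice vector that could join a point of X to a point of U. The
   radius [rho / 2] excludes non-zero lattice vectors from U - U, which makes the sets T_w U
   disjoint. *)
have [|U [oU U0 UB Us]] := @open_avoid_translates X (ball (0 : 'cV[R]_d) (rho / 2)) s clX iX (ball_open _ _).
  by exists 0; exact: ballxx.
have Urho x : U x -> `|x| < rho / 2 by move=> /UB; rewrite cV_ballE sub0r normrN.
have UX x y z : U x -> X y -> x != y + lattice_vec m z.
  move=> Ux Xy; apply/eqP => xyz; apply: (Us (lattice_vec m z) x _ Ux).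
    apply: sP; have -> : lattice_vec m z = x - y by rewrite xyz addrC addKr.
    rewrite (le_trans (ler_normB _ _))// lerD ?Xr//.
    by rewrite (le_trans (ltW (Urho _ Ux)))// ler_pdivrMr// ler_pMr// ler1n.
  by rewrite xyz addrK.
have mX := measurable_borel_closed clX.
have mU := measurable_borel_open oU.
have lU0 : (0 < lebesgue_cV U)%E by exact: lebesgue_open_gt0.
have lUfin : lebesgue_cV U \is a fin_num.
  rewrite ge0_fin_numE//; apply: (lebesgue_bounded_fin (r := rho / 2)) => //.
  by move=> x /Urho/ltW.
have lXfin : lebesgue_cV X \is a fin_num.
  by rewrite ge0_fin_numE//; exact: (lebesgue_bounded_fin (r := r)).
have tfin : (lebesgue_cV (thick X 1) < +oo)%E.
  apply: (lebesgue_bounded_fin (r := r + 1)); first exact: measurable_thick.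
  move=> y [x Xx xy]; rewrite -[y](subKr x) (le_trans (ler_normB _ _))//.
  by rewrite lerD ?Xr// ltW.
have [|e e0] := measure_thick_lt (c := fine (lebesgue_cV X) + fine (lebesgue_cV U)) clX tfin.
  by rewrite EFinD !fineK// -[ltLHS]adde0 lteD2lE.
apply/negP; rewrite -leNgt EFinD !fineK//.
have rr0 : 0 <= rho / 2 + r by rewrite addr_ge0// ltW.
have [n /(_ n _ (leqnn n)) small] := geometric_small Bg rr0 e0.
pose F (w : n.-tuple 'I_N) : set V := word_map T w @` U.
have mF w : measurable (F w) by apply: measurable_image_word.
have FE : lebesgue_cV (\bigcup_w F w) = lebesgue_cV U.
  rewrite measure_bigcup_fin//.
    rewrite (eq_bigr (fun=> ((N%:R ^+ n)^-1)%:E * lebesgue_cV U)%E) => [|w _]; last first.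
      by apply: etrans (lebesgue_image_word u Au detA w mU) _; rewrite size_tuple.
    rewrite -ge0_sume_distrl; last by move=> w _; rewrite lee_fin invr_ge0 exprn_ge0.
    rewrite sumEFin sumr_const card_tuple card_ord -[_ *+ (N ^ n)]mulr_natr natrX.
    by rewrite mulVf ?mul1e// expf_neq0// pnatr_eq0 -lt0n.
  move=> w w' ww'; apply/seteqP; split=> // _ [[x Ux <-] [y Uy yx]].
  have [z xyz /(_ ww') z0] := word_map_coincide um (esym yx).
  have := sep z z0; rewrite leNgt => /negP; apply.
  have -> : lattice_vec m z = x - y by rewrite xyz addrC addKr.
  by rewrite (le_lt_trans (ler_normB _ _))// [ltRHS](splitr rho) ltrD// Urho.
rewrite -FE -measureU//; last 2 first.
- exact: measurable_bigcup_fin.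
- apply/seteqP; split=> // y [Xy [w _ [x Ux xy]]].
  move: Xy; rewrite (attractor_words n Xa) => -[w' _ [y' Xy' y'y]].
  have [z xyz _] : exists2 z, x = y' + lattice_vec m z & w != w' -> z != 0.
    by apply: word_map_coincide => //; rewrite xy y'y.
  by have := UX x y' z Ux Xy'; rewrite xyz eqxx.
apply: le_measure; rewrite ?inE.
- by apply: measurableU => //; exact: measurable_bigcup_fin.
- exact: measurable_thick.
- move=> y [Xy|[w _ [x Ux <-]]]; first exact: sub_thick.
  exists (word_map T w x0); first exact: attractor_word.
  rewrite distrC !word_mapE opprD addrACA subrr addr0 -mulmxBr size_tuple.
  apply: small; rewrite (le_trans (ler_normB _ _))// lerD ?Xr//.
  exact/ltW/Urho.
Qed.

End no_overlaps.

(** * The tiling alternative *)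

Section tiling.
Context (R : realType) (d N : nat) (A : 'M[int]_d) (u : 'I_N -> 'cV[R]_d).
Local Notation V := (borel 'cV[R]_d).
Local Notation AR := (map_mx intr A : 'M[R]_d).
Local Notation B := (invmx AR).
Local Notation T := (ifs_map A u).
Context (C q : R) (Bg : geometric B C q) (N_gt1 : (1 < N)%N).
Context (Au : AR \in unitmx) (detA : `|\det AR| = N%:R).
Context (ulat : forall j, lattice_union A (u j)) (nov : ~ exact_overlaps T).

Let Bu : B \in unitmx. Proof. by rewrite unitmx_inv. Qed.

Let N_gt0 : (0 < N)%N. Proof. exact: ltnW. Qed.

Lemma open_image_word w (U : set 'cV[R]_d) : open U -> open (word_map T w @` U).
Proof.
move=> oU; rewrite image_word_map.
set M := B ^+ size w; set t := translation A u w.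
have Mu : M \in unitmx by exact: unitmx_exp.
rewrite (_ : _ @` _ = (fun x => invmx M *m x) @^-1` U \o (fun x => x - t)); last first.
  rewrite image_mulmx_cV//; apply/seteqP; split=> [_ [x Ux <-]|x Ux] /=.
    by rewrite addrK.
  by exists (x - t) => //; rewrite subrK.
apply: (@open_comp _ _ (fun x : 'cV[R]_d => x - t) ((fun x => invmx M *m x) @^-1` U)).
  by move=> x _; exact: shift_cV_continuous.
by apply: open_comp => // x _; exact: mulmx_cV_continuous.
Qed.

Let X := attractor T.

Let Xa : is_attractor T X. Proof. exact: (attractor_exists u N_gt0 Bg). Qed.

Let cX : compact X. Proof. by case: Xa. Qed.

Let clX : closed X. Proof. exact: closed_compact_cV. Qed.

Let mX : measurable (X : set V). Proof. exact: measurable_borel_closed. Qed.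

Lemma interior_word w x : interior X x -> interior X (word_map T w x).
Proof.
move=> Xx; have oU := @open_image_word w _ (open_interior X).
apply: (@filterS _ _ _ (word_map T w @` interior X)).
  by move=> _ [y /interior_subset Xy <-]; exact: attractor_word.
by apply: open_nbhs_nbhs; split => //; exists x.
Qed.

(** A single interior point [g] suffices: all T_w g are interior, and for long words T_w g is close
    to every point of T_w X. *)
Lemma attractor_closure_interior : X = closure (interior X).
Proof.
apply/seteqP; split; last first.
  by rewrite {2}((closure_id X).1 clX); apply: closure_subset; exact: interior_subset.
have [g Xg] := attractor_interior Bg N_gt1 Au detA ulat nov Xa.
have [r r0 Xr] := compact_bounded_cV cX.
have rr0 : 0 <= r + r by rewrite addr_ge0// ltW.
move=> x Xx O /nbhs_ballP[e /= e0 eO].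
have [n /(_ n _ (leqnn n)) small] := geometric_small Bg rr0 e0.
move: Xx; rewrite {1}(attractor_words n Xa) => -[w _ [y Xy yx]].
exists (word_map T w g); split; first exact: interior_word.
apply: eO; rewrite cV_ballE -yx !word_mapE opprD addrACA subrr addr0 -mulmxBr size_tuple.
apply: small; rewrite (le_trans (ler_normB _ _))// lerD ?Xr//.
exact: interior_subset.
Qed.

Let lX0 : (0 < lebesgue_cV X)%E.
Proof.
apply: (@lt_le_trans _ _ (lebesgue_cV (interior X))).
  apply: lebesgue_open_gt0; first exact: open_interior.
  exact: (attractor_interior Bg N_gt1 Au detA ulat nov Xa).
apply: le_measure; rewrite ?inE//; last exact: interior_subset.
by apply: measurable_borel_open; exact: open_interior.
Qed.

Let lXfin : lebesgue_cV X \is a fin_num.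
Proof.
have [r r0 Xr] := compact_bounded_cV cX.
by rewrite ge0_fin_numE//; exact: (lebesgue_bounded_fin (r := r)).
Qed.

Let lTX E j : measurable (E : set V) ->
  lebesgue_cV (E `&` (T j @` X)) = ((N%:R^-1)%:E * lebesgue_cV (T j @^-1` E `&` X))%E.
Proof.
move=> mE; have mT : measurable (T j @^-1` E : set V).
  exact: (@measurable_word_preimage R d N A u [:: j]).
rewrite (_ : E `&` _ = word_map T [:: j] @` (T j @^-1` E `&` X)).
  by rewrite (lebesgue_image_word u Au detA)//; exact: measurableI.
apply/seteqP; split=> [x [Ex [y Xy yx]]|_ [y [Ey Xy] <-]].
  by exists y => //; split => //; rewrite /preimage/= yx.
by split => //; exists y.
Qed.

(* Subadditivity for E and for its complement; both inequalities are equalities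
   since the T_j X have total measure lambda(X). *)
Lemma lebesgue_attractor_split E : measurable (E : set V) ->
  lebesgue_cV (E `&` X) = (\sum_j lebesgue_cV (E `&` (T j @` X)))%E.
Proof.
have mTX j : measurable (T j @` X : set V).
  exact: (@measurable_image_word R d N A u Au [:: j]).
have sub F : measurable (F : set V) ->
    (lebesgue_cV (F `&` X) <= \sum_j lebesgue_cV (F `&` (T j @` X)))%E.
  move=> mF; have [_ _ XT] := Xa.
  rewrite {1}XT setI_bigcupr; apply: measure_bigcup_fin_le => j.
  exact: measurableI.
move=> mE; have mEC := measurableC mE.
have tot j : lebesgue_cV (T j @` X) =
    (lebesgue_cV (E `&` (T j @` X)) + lebesgue_cV (~` E `&` (T j @` X)))%E.
  rewrite -measureU.
  - by rewrite -setIUl setUv setTI.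
  - exact: measurableI.
  - exact: measurableI.
  - by rewrite setIACA setICr set0I.
have totX : lebesgue_cV X = (lebesgue_cV (E `&` X) + lebesgue_cV (~` E `&` X))%E.
  rewrite -measureU.
  - by rewrite -setIUl setUv setTI.
  - exact: measurableI.
  - exact: measurableI.
  - by rewrite setIACA setICr set0I.
have sumX : (\sum_j lebesgue_cV (T j @` X) = lebesgue_cV X)%E.
  rewrite (eq_bigr (fun=> (N%:R^-1)%:E * lebesgue_cV X)%E) => [|j _]; last first.
    by have := lTX j measurableT; rewrite setTI preimage_setT setTI.
  rewrite -ge0_sume_distrl; last by move=> w _; rewrite lee_fin invr_ge0.
  rewrite sumEFin sumr_const card_ord -[_ *+ N]mulr_natr.
  by rewrite mulVf ?mul1e// pnatr_eq0 -lt0n.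
apply/eqP; rewrite eq_le sub//= leNgt; apply/negP => lt.
have lt2 : (lebesgue_cV X < \sum_j lebesgue_cV (T j @` X))%E.
  rewrite (eq_bigr _ (fun j _ => tot j)) big_split/= totX.
  apply: lte_leD => //; last exact: sub.
  have : (lebesgue_cV (~` E `&` X) <= lebesgue_cV X)%E.
    by apply: le_measure; rewrite ?inE//; exact: measurableI.
  move=> /le_lt_trans h; rewrite ge0_fin_numE//; apply: h.
  by rewrite -ge0_fin_numE.
by rewrite sumX ltxx in lt2.
Qed.

Lemma tiling_caseP : tiling_case A u.
Proof.
have mTX j : measurable (T j @` X : set V).
  exact: (@measurable_image_word R d N A u Au [:: j]).
pose l := fine (lebesgue_cV X).
have lE : lebesgue_cV X = l%:E by rewrite fineK.
have l0 : 0 < l by rewrite -lte_fin -lE.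
split => //; last 2 first.
- exact: attractor_closure_interior.
- have l10 : 0 <= l^-1 by rewrite invr_ge0 ltW.
  pose nu0 := mscale (NngNum l10) (mrestr (@lebesgue_cV R d) mX).
  have nu0E E : nu0 E = (l^-1%:E * lebesgue_cV (E `&` X))%E by [].
  have nu01 : nu0 setT = 1%E.
    by rewrite nu0E setTI lE -EFinM mulVf// gt_eqF.
  pose nu : probability V R := HB.pack (nu0 : _ -> _)
    (Measure.class [the measure V R of nu0])
    (Measure_isProbability.Build _ _ _ [the measure V R of nu0] nu01).
  have nuE E : nu E = (l^-1%:E * lebesgue_cV (E `&` X))%E by [].
  have nuT : is_self_similar T nu.
    move=> E mE; rewrite nuE lebesgue_attractor_split//.
    rewrite ge0_sume_distrr// ge0_sume_distrr => [|j _]; last exact: (measure_ge0 nu).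
    by apply: eq_bigr => j _; rewrite /pushforward nuE lTX// muleCA.
  have nuT' : is_self_similar T (self_similar_measure T) by exact: getI nuT.
  move=> E mE; rewrite (self_similar_unique Bg N_gt0 nuT' nuT mE) nuE lE muleC.
  by rewrite inver gt_eqF.
have oiX := open_interior X.
exists (interior X); split => //.
- exact: (attractor_interior Bg N_gt1 Au detA ulat nov Xa).
- by move=> j _ [x Xx <-]; exact: (@interior_word [:: j]).
- move=> j k jk; apply/eqP; apply: contraT => /set0P W0.
  (* The open set [W] lies in two of the pieces T_i X, so the splitting formula counts its volume at
     least twice; a non-empty [W] would have positive finite volume. *)
  pose W := T j @` interior X `&` T k @` interior X.
  have oW : open W by apply: openI; exact: (@open_image_word [:: _]).
  have mW : measurable (W : set V) by exact: measurable_borel_open.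
  have WT i : (i == j) || (i == k) -> W `&` (T i @` X) = W.
    move=> ijk; apply/setIidPl => y [[a /interior_subset Xa' ay] [b /interior_subset Xb yb]].
    by case/orP: ijk => /eqP ->; [exists a|exists b].
  have WX : W `&` X = W.
    apply/setIidPl => y [[a /interior_subset Xa' <-] _].
    by apply: (@attractor_word _ _ _ _ _ _ [:: j] Xa).
  have := lebesgue_attractor_split mW; rewrite WX (bigD1 j)//= (bigD1 k) 1?eq_sym//=.
  rewrite !WT ?eqxx ?orbT// => eqW.
  have lW0 := lebesgue_open_gt0 oW W0.
  have lWfin : lebesgue_cV W \is a fin_num.
    rewrite ge0_fin_numE//; apply: (@le_lt_trans _ _ (lebesgue_cV X)); last first.
      by rewrite -ge0_fin_numE.
    apply: le_measure; rewrite ?inE//; by rewrite -WX; exact: subIsetr.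
  have : (lebesgue_cV W + lebesgue_cV W <= lebesgue_cV W)%E.
    rewrite {3}eqW; apply: leeD2l; apply: leeDl.
    by apply: sume_ge0.
  by rewrite -[leRHS]adde0 leeD2lE// leNgt lW0.
Qed.

End tiling.

Section exclusive.
Context (R : realType) (d N : nat) (A : 'M[int]_d) (u : 'I_N -> 'cV[R]_d).

(** The two descriptions of nu clash: a Lebesgue-null set carrying nu would be nu-null by the
    density formula. *)
Lemma tiling_overlap_exclusive : tiling_case A u -> overlap_case A u -> False.
Proof.
move=> [_ _ XE nuE] [_ _ [E [mE E0 nuC]]].
set X := attractor _ in XE nuE; set nu := self_similar_measure _ in nuE nuC.
have mX : measurable (X : set (borel 'cV[R]_d)).
  by apply: measurable_borel_closed; rewrite XE; exact: closed_closure.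
have nu0 : nu E = 0%E.
  rewrite nuE// (_ : lebesgue_cV (E `&` _) = 0%E) ?mul0e//.
  apply/eqP; rewrite eq_le measure_ge0 andbT.
  apply: (@le_trans _ _ (lebesgue_cV E)); last by rewrite E0.
  apply: le_measure; rewrite ?inE.
  - exact: measurableI.
  - exact: mE.
  - by move=> x [].
move: nuC; rewrite probability_setC// nu0 sube0 => /eqP.
by rewrite onee_eq0.
Qed.

End exclusive.

(** * Density of systems without exact overlaps *)

Section residues.
Context (d : nat) (A : 'M[int]_d).

Lemma unitmx_int_absdet (M : 'M[int]_d) : M \in unitmx -> absz (\det M) = 1%N.
Proof. by rewrite unitmxE => /orP[] /eqP ->. Qed.

(* In Smith normal form A = L D P the vectors L k with 0 <= k_i < |D_i| are
   pairwise incongruent modulo A. *)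
Lemma incongruent_residues : (0 < absz (\det A))%N ->
  exists r : 'I_(absz (\det A)) -> 'cV[int]_d,
    forall i j y, r i - r j = A *m y -> i = j.
Proof.
move=> detA0; have [L Lu [P Pu [s _ AE]]] := int_Smith_normal_form A.
set D := (X in L *m X *m P) in AE.
have detD : \det D = \prod_(i < d) s`_i.
  rewrite (_ : D = diag_mx (\row_(i < d) s`_i)) ?det_diag.
    by apply: eq_bigr => i _; rewrite mxE.
  apply/matrixP => i j; rewrite !mxE.
  by rewrite -(inj_eq val_inj).
have detE : absz (\det A) = (\prod_(i < d) absz (s`_i)%R)%N.
  rewrite AE !det_mulmx !abszM (unitmx_int_absdet Lu) (unitmx_int_absdet Pu) mul1n muln1 detD.
  exact: (big_morph absz abszM).
pose I := {dffun forall i : 'I_d, 'I_(absz s`_i)}.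
have cardI : #|{: I}| = absz (\det A).
  rewrite card_dep_ffun detE foldrE big_map big_enum/=.
  by apply: eq_bigr => i _; rewrite card_ord.
pose f (k : I) : 'cV[int]_d := L *m \col_i (nat_of_ord (k i))%:Z.
exists (fun i => f (enum_val (cast_ord (esym cardI) i))) => i j y.
set k := enum_val _; set k' := enum_val _ => fkk'.
have /colP Dy : \col_i (nat_of_ord (k i))%:Z - \col_i (nat_of_ord (k' i))%:Z =
    D *m (P *m y).
  by rewrite -[LHS](mulKmx Lu) mulmxBr -/(f k) -/(f k') fkk' AE -!mulmxA mulKmx.
suff kk' : k = k'.
  by apply: (@cast_ord_inj _ _ (esym cardI)); apply: enum_val_inj.
apply/ffunP => t; apply/val_inj/eqP.
have := Dy t; rewrite !mxE (bigD1 t)//= big1 => [|t' tt']; last first.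
  by rewrite mxE (inj_eq val_inj) eq_sym (negbTE tt') mul0r.
rewrite mxE eqxx mulr1n addr0 => h.
have := ltn_ord (k t); have := ltn_ord (k' t).
rewrite -eqz_nat -subr_eq0 h => k1 k2.
set p := _ *m _ in h *; have [->|p0] := eqVneq (p t 0) 0; first by rewrite mulr0.
(* Both coordinates lie in [0, |D_t|), so their difference is too small to be a non-zero multiple of
   D_t. *)
have : (absz (s`_t * p t 0)%R < absz (s`_t)%R)%N.
  have aux (a b M : nat) : (a < M)%N -> (b < M)%N -> (absz (a%:Z - b%:Z)%R < M)%N by lia.
  by rewrite -h; exact: aux.
by rewrite abszM -[X in (_ < X)%N]muln1 ltn_mul2l ltnS leqn0 absz_eq0 (negbTE p0) andbF.
Qed.

End residues.

Section approximation.
Context (R : realType) (d N : nat) (A : 'M[int]_d).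
Local Notation AR := (map_mx intr A : 'M[R]_d).
Local Notation B := (invmx AR).
Context (C q : R) (Bg : geometric B C q).
Context (Au : AR \in unitmx).

Lemma int_round (x : 'cV[R]_d) : exists z : 'cV[int]_d, `|x - map_mx intr z| <= 1.
Proof.
exists (\col_i Num.floor (x i ord0)); apply: cV_norm_le => // i; rewrite !mxE.
have /andP[h1 h2] := floor_itv (x i ord0).
rewrite ger0_norm ?subr_ge0// lerBlDr ltW//.
by rewrite addrC (lt_le_trans h2)// intrD.
Qed.

(** Each residue class modulo A becomes arbitrarily fine when scaled by B^m: rounding B (A^m v - r)
    to an integer vector costs at most 1, and this error is then multiplied by B^m A. *)
Lemma lattice_approx e : 0 < e -> exists m0, forall m, (m0 <= m)%N ->
  forall (v : 'cV[R]_d) r, exists y, `|v - lattice_vec R A m (r + A *m y)| < e.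
Proof.
move=> e0; pose a := \sum_i \sum_j `|AR i j|.
have a0 : 0 <= a by apply: sumr_ge0 => i _; exact: sumr_ge0.
have [m0 small] := geometric_small Bg a0 e0.
exists m0 => m m0m v r.
have [y xy] := int_round (B *m (AR ^+ m *m v - map_mx intr r)).
exists y.
rewrite (_ : v - _ = B ^+ m *m (AR *m (B *m (AR ^+ m *m v - map_mx intr r) - map_mx intr y))).
  apply: small => //; apply: (le_trans (mulmx_norm_le _ (row_sum_le_ex AR))).
  by rewrite ler_piMr.
rewrite mulmxBr mulKVmx// -map_mxM -addrA -opprD -map_mxD mulmxBr mulmxA exp_invmxK//.
by rewrite mul1mx.
Qed.

(* The lowest A-adic digit of digit_value z w is the residue of z at the head of w. *)
Fixpoint digit_value (z : 'I_N -> 'cV[int]_d) (w : seq 'I_N) : 'cV[int]_d :=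
  if w is j :: w' then z j + A *m digit_value z w' else 0.

Lemma translation_rcons (u : 'I_N -> 'cV[R]_d) w j :
  translation A u (rcons w j) = translation A u w + B ^+ size w *m u j.
Proof.
rewrite -cats1 /translation word_map_cat/= word_mapE /ifs_map mulmx0 add0r.
by rewrite addrC.
Qed.

(** In A^n t_w the last letter carries the lowest power of A, namely A itself; hence the reversed
    word and the additional factor A. *)
Lemma translation_digit_value m z w :
  AR ^+ size w *m translation A (fun j => lattice_vec R A m (z j)) w =
  AR *m lattice_vec R A m (digit_value z (rev w)).
Proof.
have AB : GRing.comm AR B.
  by rewrite /GRing.comm; apply: (etrans (mulmxV Au)); rewrite -(mulVmx Au).
have ABm : AR *m B ^+ m = B ^+ m *m AR := commrX m AB.
elim/last_ind: w => [|w j IH].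
  by rewrite /translation/= mulmx0 /lattice_vec map_mx0 !mulmx0.
rewrite translation_rcons rev_rcons size_rcons /=.
rewrite mulmxDr {1}exprmxS -mulmxA IH [in X in _ + X]exprmxS -[X in _ + X]mulmxA.
rewrite (mulmxA (AR ^+ _) (B ^+ _)) exp_mulmxK// mul1mx lattice_vecD mulmxDr addrC.
congr (_ + AR *m _).
by rewrite /lattice_vec map_mxM [RHS]mulmxA -ABm mulmxA.
Qed.

(** Modulo A only the first digit is left, and incongruence determines it; injectivity of A then
    gives access to the next digit. *)
Lemma digit_value_inj z : (forall i j y, z i - z j = A *m y -> i = j) ->
  forall w w', size w = size w' -> digit_value z w = digit_value z w' -> w = w'.
Proof.
move=> zinc; elim=> [|j w IH] [|k w']//= [sww'] h.
have jk : j = k.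
  apply: (zinc j k (digit_value z w' - digit_value z w)).
  rewrite mulmxBr -[z j](addrK (A *m digit_value z w)) h addrAC.
  by rewrite [z k + _]addrC addrK.
move: h; rewrite jk => /addrI h; congr (_ :: _); apply: IH => //.
have := congr1 (fun M => map_mx intr M : 'cV[R]_d) h; rewrite !map_mxM => /(congr1 (mulmx B)).
rewrite !mulKmx// => /matrixP zz; apply/matrixP => i l.
by have := zz i l; rewrite !mxE => /eqP; rewrite eqr_int => /eqP.
Qed.

End approximation.

Section no_overlap_dense.
Context (R : realType) (d N : nat) (A : 'M[int]_d).
Local Notation AR := (map_mx intr A : 'M[R]_d).
Local Notation B := (invmx AR).
Context (C q : R) (Bg : geometric B C q) (N_gt1 : (1 < N)%N).
Context (Au : AR \in unitmx) (detA : `|\det AR| = N%:R) (NA : N = absz (\det A)).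

Lemma no_overlap_dense (u : 'I_N -> 'cV[R]_d) e : 0 < e ->
  exists u' : 'I_N -> 'cV[R]_d, [/\ forall j, lattice_union A (u' j),
    forall j, `|u j - u' j| < e & ~ exact_overlaps (ifs_map A u')].
Proof.
move=> e0; have [m0 approx] := lattice_approx Bg Au e0.
have [z zinc] : exists z : 'I_N -> 'cV[int]_d, forall i j y, z i - z j = A *m y -> i = j.
  by rewrite NA; apply: incongruent_residues; rewrite -NA ltnW.
have /choice[y uy] : forall j, exists y, `|u j - lattice_vec R A m0 (z j + A *m y)| < e.
  by move=> j; exact: approx.
pose z' j := z j + A *m y j.
(* The corrections by multiples of A, which bring the points close to [u], do not affect
   residues. *)
have z'inc i j t : z' i - z' j = A *m t -> i = j.
  move=> ij; apply: (zinc i j (t - y i + y j)).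
  have zE k : z k = z' k - A *m y k by rewrite addrK.
  by rewrite mulmxDr mulmxBr -ij !zE opprD opprK addrACA addrA.
exists (fun j => lattice_vec R A m0 (z' j)); split => //.
  by move=> j; exists m0, (z' j).
move=> [v [w [_ _ vw Tvw]]]; move/eqP: vw; apply.
have svw := word_map_eq_size N_gt1 Au detA Tvw.
apply: (can_inj revK); apply: (digit_value_inj Au z'inc); first by rewrite !size_rev.
have := translation_digit_value Au m0 z' v.
rewrite /translation Tvw svw -/(translation _ _ _) translation_digit_value//.
move=> /(congr1 (mulmx B)); rewrite !mulKmx// => /(congr1 (mulmx (AR ^+ m0))).
rewrite /lattice_vec !mulmxA !exp_mulmxK// !mul1mx => /matrixP zz.
apply/esym/matrixP => i l.
by have := zz i l; rewrite !mxE => /eqP; rewrite eqr_int => /eqP.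
Qed.

End no_overlap_dense.

(** * Density of systems with exact overlaps *)

Section riemann_lebesgue.
Context (R : realType) (d : nat).
Local Notation V := (borel 'cV[R]_d).
Local Notation lam := (@lebesgue_cV R d).
Implicit Types (X D : set V) (g : V -> R).

Lemma bounded_integrable (mu : {measure set V -> \bar R}) D g M :
  measurable D -> (mu D < +oo)%E -> measurable_fun [set: V] g ->
  (forall x, `|g x| <= M) -> mu.-integrable D (EFin \o g).
Proof.
move=> mD Dfin mg gM; apply: measurable_bounded_integrable => //.
  exact: measurable_funS mg.
exists M; split; first exact: num_real.
by move=> y My x _; apply: le_trans (gM x) (ltW My).
Qed.

Lemma Rintegral_image_shift X g (h : 'cV[R]_d) M : measurable X -> (lam X < +oo)%E ->
  measurable_fun [set: V] g -> (forall x, `|g x| <= M) ->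
  Rintegral lam ((fun x : 'cV[R]_d => x + h) @` X) g =
  Rintegral lam X (fun x : 'cV[R]_d => g (x + h)).
Proof.
move=> mX Xfin mg gM; rewrite /Rintegral; congr fine.
have mh := @measurable_shift_cV R d h.
have pre : (fun x : 'cV[R]_d => x + h) @^-1` ((fun x : 'cV[R]_d => x + h) @` X) = X.
  apply/seteqP; split=> [x [y Xy /addIr <-]//|x Xx]; by exists x.
pose nu := measure_function_pushforward__canonical__measure_function_Measure lam mh.
have mXh := measurable_image_shift h mX.
set Y := (X in (\int[_]_(x in X) _)%E) in mXh pre *.
transitivity (\int[nu]_(x in Y) (g x)%:E)%E.
  by apply: eq_measure_integral => E mE _; apply/esym/lebesgue_cV_shift.
rewrite integral_pushforward//; first by rewrite pre.
  exact/measurable_EFinP.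
rewrite pre; apply: (@bounded_integrable lam X (fun x : 'cV[R]_d => g (x + h)) M) => //.
exact: (measurableT_comp mg mh).
Qed.

Lemma Rintegral_setID (mu : {measure set V -> \bar R}) X Y g M :
  measurable X -> measurable Y -> (mu X < +oo)%E ->
  measurable_fun [set: V] g -> (forall x, `|g x| <= M) ->
  Rintegral mu X g = Rintegral mu (X `&` Y) g + Rintegral mu (X `\` Y) g.
Proof.
move=> mX mY Xfin mg gM; rewrite -Rintegral_setU ?setUIDK//.
- exact: measurableI.
- exact: measurableD.
- exact: (bounded_integrable _ _ mg gM).
- by apply/disj_set2P; apply/seteqP; split=> // x [[_ ?] []].
Qed.

(* If g changes sign under translation by a small vector h, then its integrals
   over X and over X + h, which almost coincide, are opposite. *)
Lemma antiperiodic_Rintegral X g (h : 'cV[R]_d) e c : closed X ->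
  (lam X < +oo)%E -> `|h| < e -> (lam (thick X e) <= lam X + c%:E)%E ->
  measurable_fun [set: V] g -> (forall x, `|g x| <= 1) ->
  (forall x : 'cV[R]_d, g (x + h) = - g x) ->
  `|Rintegral lam X g| <= c.
Proof.
move=> cX Xfin he tc mg g1 gh.
have mX := measurable_borel_closed cX.
suff key (f : V -> R) : measurable_fun [set: V] f -> (forall x, `|f x| <= 1) ->
    (forall x : 'cV[R]_d, f (x + h) = - f x) -> Rintegral lam X f <= c.
  rewrite ler_norml key// andbT lerNl.
  rewrite (_ : - _ = Rintegral lam X (fun x => -1 * g x)); last first.
    by rewrite RintegralZl ?mulN1r//; exact: (bounded_integrable _ _ mg g1).
  apply: key.
  - exact: measurable_funM.
  - by move=> x; rewrite mulN1r normrN.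
  - by move=> x; rewrite gh !mulN1r.
move=> mf f1 fh.
pose Y : set V := (fun x : 'cV[R]_d => x + h) @` X.
have mY : measurable Y by exact: measurable_image_shift.
have lY : lam Y = lam X by exact: lebesgue_cV_image_shift.
(* With a non-negative integrand, dropping [Y \ X] can only decrease the integral over [Y]; the
   upper bound 2 controls the integral over [X \ Y]. *)
pose f' x := 1 + f x.
have mf' : measurable_fun [set: V] f' by exact: measurable_funD.
have f'2 x : `|f' x| <= 2.
  by rewrite (le_trans (ler_normD _ _))// normr1 -[leRHS]natr1 addrC lerD.
have f'0 x : 0 <= f' x.
  by have := f1 x; rewrite ler_norml /f' => /andP[+ _]; rewrite -lerBlDl sub0r.
have fin D : measurable D -> D `<=` X -> (lam D < +oo)%E.
  by move=> mD DX; apply: le_lt_trans Xfin; apply: le_measure; rewrite ?inE.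
have finY D : measurable D -> D `<=` Y -> (lam D < +oo)%E.
  by move=> mD DX; apply: le_lt_trans Xfin; rewrite -lY; apply: le_measure; rewrite ?inE.
have mXY : measurable (X `&` Y) by exact: measurableI.
have mXD : measurable (X `\` Y) by exact: measurableD.
have mYD : measurable (Y `\` X) by exact: measurableD.
have XE := Rintegral_setID mX mY Xfin mf' f'2.
have YE : Rintegral lam Y f' = Rintegral lam (X `&` Y) f' + Rintegral lam (Y `\` X) f'.
  by rewrite setIC; apply: Rintegral_setID mf' f'2 => //; exact: finY.
have YD0 : 0 <= Rintegral lam (Y `\` X) f' by apply: Rintegral_ge0 => x _; exact: f'0.
(* Both [X] and [Y] lie in the neighbourhood of [X] and they have equal volume. *)
have XYc : (lam (X `\` Y) <= c%:E)%E.
  have mt := @measurable_thick R d X e.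
  have e0 : 0 < e := le_lt_trans (normr_ge0 h) he.
  have lYfin : lam Y \is a fin_num by rewrite lY ge0_fin_numE.
  rewrite -(@leeD2rE _ (lam Y))// -measureU//; last first.
    by apply/seteqP; split=> // x [[_ ?] ?].
  rewrite addeC lY; apply: le_trans tc; apply: le_measure; rewrite ?inE//.
    exact: measurableU.
  move=> x [[Xx _]|[y Xy <-]]; first exact: sub_thick.
  by exists y => //; rewrite opprD addrA subrr add0r normrN.
have XD : Rintegral lam (X `\` Y) f' <= 2 * c.
  apply: (@le_trans _ _ (Rintegral lam (X `\` Y) (fun=> 2))).
    apply: le_Rintegral => //.
    - by apply: (bounded_integrable _ _ mf' f'2) => //; apply: fin => // x [].
    - by apply: (@bounded_integrable lam _ _ 2) => //; [apply: fin => // x []|move=> x; rewrite normr_nat].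
    - by move=> x _; apply: le_trans (ler_norm _) (f'2 x).
  rewrite Rintegral_cst// ler_pM2l// -lee_fin fineK// ge0_fin_numE//.
  exact: le_lt_trans XYc (ltry _).
have YX : Rintegral lam Y f' = Rintegral lam X (fun x => 1 - f x).
  rewrite (Rintegral_image_shift h mX Xfin mf' f'2); apply: eq_Rintegral => x _.
  by rewrite /f' fh.
have if1 : lam.-integrable X (EFin \o f) by exact: (bounded_integrable _ _ mf f1).
have ic1 : lam.-integrable X (EFin \o (fun=> 1 : R)).
  by apply: (@bounded_integrable lam _ _ 1) => // x; rewrite normr1.
rewrite RintegralB// in YX; rewrite /f' RintegralD// in XE.
have : Rintegral lam (X `&` Y) (fun x => 1 + f x) <= Rintegral lam Y f'.
  by rewrite YE lerDl.
rewrite YX; move: XE XD; rewrite /f' => XE XD.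
move: (Rintegral lam X f) (Rintegral lam X (fun=> 1)) (Rintegral lam (X `&` Y) _)
  (Rintegral lam (X `\` Y) _) XE XD => a b p t; clear; lra.
Qed.

End riemann_lebesgue.

(** * Fourier transform of the self-similar measure *)

Section self_similar_integral.
Context (R : realType) (d N : nat) (A : 'M[int]_d) (u : 'I_N -> 'cV[R]_d).
Local Notation V := (borel 'cV[R]_d).
Local Notation T := (ifs_map A u).
Context (N_gt0 : (0 < N)%N) (nu : probability V R).
Context (nuT : is_self_similar T nu).

Lemma measurable_ifs_map j : measurable_fun [set: V] (T j : V -> V).
Proof. by apply: continuous_borel; exact: ifs_map_continuous. Qed.

Lemma self_similar_integral (f : V -> \bar R) : measurable_fun [set: V] f ->
  (forall x, 0 <= f x)%E ->
  (\int[nu]_x f x = N%:R^-1%:E * \sum_j \int[nu]_x f (T j x))%E.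
Proof.
move=> mf f0.
have N10 : 0 <= N%:R^-1 :> R by rewrite invr_ge0.
pose j0 := Ordinal N_gt0.
pose push j := measure_function_pushforward__canonical__measure_function_Measure
  nu (measurable_ifs_map j).
(* [msum] runs over naturals; [insubd j0] recovers the ordinal for [k < N]. *)
pose m_ (k : nat) : {measure set V -> \bar R} := push (insubd j0 k).
pose mu := mscale (NngNum N10) (msum m_ N).
have insubE (j : 'I_N) : insubd j0 j = j by rewrite valKd.
transitivity (\int[mu]_x f x)%E.
  apply: eq_measure_integral => E mE _.
  apply: etrans (nuT mE) _; rewrite /= /mscale/= /msum; congr (_ * _)%E.
  by apply: eq_bigr => j _; rewrite /m_ insubE.
rewrite ge0_integral_mscale//; congr (_ * _)%E.
rewrite ge0_integral_measure_sum//; apply: eq_bigr => j _.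
rewrite /m_ insubE ge0_integral_pushforward//.
exact: measurable_ifs_map.
Qed.

(** Adding the constant [M] reduces to a non-negative integrand. *)
Lemma self_similar_Rintegral (g : V -> R) (M : R) : measurable_fun [set: V] g ->
  (forall x, `|g x| <= M) ->
  Rintegral nu setT g = N%:R^-1 * \sum_j Rintegral nu setT (fun x => g (T j x)).
Proof.
move=> mg gM.
have fin : (nu setT < +oo)%E by rewrite probability_setT ltry.
have mgT j : measurable_fun [set: V] (fun x => g (T j x)).
  exact: measurableT_comp mg (measurable_ifs_map j).
have cst : Rintegral nu setT (fun=> M) = M.
  rewrite Rintegral_cst//; rewrite [X in fine X](@probability_setT _ _ _ nu).
  by rewrite mulr1.
have gD (h : V -> R) : measurable_fun [set: V] h -> (forall x, `|h x| <= M) ->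
    Rintegral nu setT (fun x => h x + M) = Rintegral nu setT h + M.
  move=> mh hM; rewrite RintegralD ?cst//; first exact: bounded_integrable hM.
  by apply: (@bounded_integrable _ _ _ _ _ `|M|).
have gM0 x : 0 <= g x + M.
  by have := gM x; rewrite ler_norml => /andP[+ _]; rewrite -subr_ge0 opprK.
have ig j : nu.-integrable setT (EFin \o (fun x => g (T j x) + M)).
  apply: (@bounded_integrable _ _ _ _ _ (M + `|M|)) => //.
    exact: measurable_funD.
  by move=> x; rewrite (le_trans (ler_normD _ _))// lerD.
apply: (@addIr _ M); rewrite -gD//.
transitivity (N%:R^-1 * \sum_j Rintegral nu setT (fun x => g (T j x) + M)).
  rewrite /Rintegral self_similar_integral.
  - rewrite (eq_bigr (fun j => (Rintegral nu setT (fun x => g (T j x) + M))%:E)).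
      by rewrite sumEFin.
    by move=> j _; rewrite /Rintegral fineK//; exact: (integrable_fin_num _ (ig j)).
  - by apply/measurable_EFinP; exact: measurable_funD.
  - by move=> x; rewrite lee_fin.
rewrite (eq_bigr (fun j => Rintegral nu setT (fun x => g (T j x)) + M)); last first.
  by move=> j _; rewrite gD.
rewrite big_split/= mulrDr; congr (_ + _).
by rewrite sumr_const card_ord -[M *+ N]mulr_natr mulrC mulfK// pnatr_eq0 -lt0n.
Qed.

End self_similar_integral.

Section characters.
Context (R : realType) (d : nat).
Local Notation V := (borel 'cV[R]_d).
Implicit Types (r : 'rV[R]_d) (x : 'cV[R]_d).

Definition pairing r x : R := (r *m x) ord0 ord0.

Lemma pairingD r x y : pairing r (x + y) = pairing r x + pairing r y.
Proof. by rewrite /pairing mulmxDr mxE. Qed.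

Lemma pairingZ r a x : pairing r (a *: x) = a * pairing r x.
Proof. by rewrite /pairing -scalemxAr mxE. Qed.

Lemma pairing_mulmx r (M : 'M[R]_d) x : pairing r (M *m x) = pairing (r *m M) x.
Proof. by rewrite /pairing mulmxA. Qed.

Lemma measurable_pairing r : measurable_fun [set: V] (pairing r : V -> R).
Proof.
rewrite (_ : pairing r = fun x => \sum_i r ord0 i * x i ord0).
  apply: measurable_sum => i; apply: measurable_funM => //.
  exact: measurable_coord_cV.
by apply/funext => x; rewrite /pairing mxE.
Qed.

Lemma pairing_bound r : exists2 K : R, 0 < K & forall x, `|pairing r x| <= K * `|x|.
Proof.
exists (1 + \sum_i `|r ord0 i|); first by rewrite ltr_pwDl// sumr_ge0.
move=> x; rewrite /pairing mxE mulrDl mul1r mulr_suml.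
rewrite (le_trans (ler_norm_sum _ _ _))// -[leLHS]add0r lerD//.
by apply: ler_sum => i _; rewrite normrM ler_wpM2l// cV_coord_le.
Qed.

Lemma measurable_cos_pairing r : measurable_fun [set: V] (fun x : V => cos (pairing r x)).
Proof.
apply: measurableT_comp (measurable_pairing r).
exact: continuous_measurable_fun (@continuous_cos R).
Qed.

Lemma measurable_sin_pairing r : measurable_fun [set: V] (fun x : V => sin (pairing r x)).
Proof.
apply: measurableT_comp (measurable_pairing r).
exact: continuous_measurable_fun (@continuous_sin R).
Qed.

(* Real part, imaginary part and squared modulus of the Fourier transform of nu
   at r. *)
Definition fcos (nu : probability V R) r := Rintegral nu setT (fun x => cos (pairing r x)).
Definition fsin (nu : probability V R) r := Rintegral nu setT (fun x => sin (pairing r x)).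
Definition fnorm nu r := fcos nu r ^+ 2 + fsin nu r ^+ 2.

End characters.

Section concentrated.
Context (R : realType) (d : nat) (nu : probability (borel 'cV[R]_d) R).
Local Notation V := (borel 'cV[R]_d).

Lemma Rintegral_concentrated X (g : V -> R) (M : R) : measurable (X : set V) ->
  nu X = 1%E -> measurable_fun [set: V] g -> (forall x, `|g x| <= M) ->
  Rintegral nu setT g = Rintegral nu X g.
Proof.
move=> mX nuX mg gM; have fin : (nu setT < +oo)%E by rewrite probability_setT ltry.
rewrite (Rintegral_setID measurableT mX fin mg gM) setTI setTD.
rewrite [X in _ + X = _](_ : _ = 0) ?addr0// /Rintegral null_set_integral//.
- exact: measurableC.
- by apply/measurable_EFinP; exact: measurable_funS mg.
- by rewrite [LHS]probability_setC// nuX subee.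
Qed.

(** On [X] the angle has absolute value below 1, so the cosine is at least cos 1 > 0 and the real
    part is positive. *)
Lemma fnorm_gt0 X r : measurable (X : set V) -> nu X = 1%E ->
  (forall x, X x -> `|pairing r x| < 1) -> 0 < fnorm nu r.
Proof.
move=> mX nuX rX; rewrite /fnorm ltr_pwDl ?sqr_ge0// exprn_gt0//.
rewrite /fcos (Rintegral_concentrated mX nuX (measurable_cos_pairing r) (M := 1)); last first.
  by move=> x; exact: cos_max.
have fin : (nu X < +oo)%E by rewrite nuX ltry.
apply: (@lt_le_trans _ _ (Rintegral nu X (fun=> cos 1))).
  by rewrite Rintegral_cst// [X in fine X](_ : _ = 1%E)// mulr1 cos1_gt0.
apply: le_Rintegral => //.
- by apply: (@bounded_integrable _ _ _ _ _ 1) => // x; exact: cos_max.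
- apply: (bounded_integrable mX fin (measurable_cos_pairing r) (M := 1)) => x.
  exact: cos_max.
move=> x Xx; have := rX x Xx; set t := pairing r x => t1.
have -> : cos t = cos `|t| by case: (ger0P t); rewrite ?cosN.
rewrite le_eqVlt; apply/orP; right; rewrite ltr_cos// in_itv/= ?normr_ge0 ?ler01/=.
  apply: le_trans (ltW t1) _; apply: le_trans (pi_ge2 _); lra.
apply: le_trans (pi_ge2 _); lra.
Qed.

Lemma Rintegral_normalized X (g : V -> R) (M : R) : measurable (X : set V) ->
  (0 < lebesgue_cV X < +oo)%E -> (forall E : set V, measurable E ->
    nu E = (lebesgue_cV (E `&` X) / lebesgue_cV X)%E) ->
  measurable_fun [set: V] g -> (forall x, `|g x| <= M) ->
  Rintegral nu setT g =
  (fine (lebesgue_cV X))^-1 * Rintegral (@lebesgue_cV R d) X g.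
Proof.
move=> mX /andP[lX0 lXfin] nuE mg gM.
have lE : lebesgue_cV X = (fine (lebesgue_cV X))%:E by rewrite fineK// ge0_fin_numE.
have l0 : 0 < fine (lebesgue_cV X) by rewrite -lte_fin -lE.
have l10 : 0 <= (fine (lebesgue_cV X))^-1 by rewrite invr_ge0 ltW.
have nuX : nu X = 1%E.
  by apply: etrans (nuE _ mX) _; rewrite setIid lE inver gt_eqF//= -EFinM divff// gt_eqF.
rewrite (Rintegral_concentrated mX nuX mg gM).
have mgX := measurable_funS measurableT (@subsetT _ X) mg.
have fin : (nu X < +oo)%E by rewrite nuX ltry.
pose f x := g x + M.
have f0 x : 0 <= f x.
  by have := gM x; rewrite ler_norml => /andP[+ _]; rewrite -subr_ge0 opprK.
have mf : measurable_fun [set: V] f by exact: measurable_funD.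
have iM (m : {measure set V -> \bar R}) : (m X < +oo)%E ->
    m.-integrable X (EFin \o (fun=> M)).
  by move=> mfin; apply: (@bounded_integrable _ _ _ _ _ `|M|).
have ig (m : {measure set V -> \bar R}) : (m X < +oo)%E ->
    m.-integrable X (EFin \o g).
  by move=> mfin; exact: bounded_integrable gM.
have : Rintegral nu X f = (fine (lebesgue_cV X))^-1 * Rintegral (@lebesgue_cV R d) X f.
  rewrite /Rintegral; set J := (\int[lebesgue_cV (n := d)]_(x in X) _)%E.
  transitivity (fine ((fine (lebesgue_cV X))^-1%:E * J)); last first.
    rewrite fineM//; apply: (integrable_fin_num mX).
    apply: (bounded_integrable mX lXfin mf (M := M + `|M|)) => x.
    by rewrite (le_trans (ler_normD _ _))// lerD.
  have mfX : measurable_fun X (EFin \o f).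
    by apply/measurable_EFinP; exact: measurable_funS mf.
  have scale := ge0_integral_mscale (@lebesgue_cV R d) mX (NngNum l10) mfX.
  rewrite -scale => [|x _]; last by rewrite lee_fin.
  congr fine.
  apply: eq_measure_integral => E mE EX; apply: etrans (nuE _ mE) _.
  by rewrite /= /mscale/= (setIidl EX) lE inver gt_eqF// muleC.
rewrite /f !RintegralD//; try exact: ig; try exact: iM.
rewrite !Rintegral_cst// [X in _ + M * fine X = _](_ : _ = 1%E)// mulr1 mulrDr.
by rewrite [_^-1 * (M * _)]mulrCA mulVf ?(gt_eqF l0)// mulr1 => /addIr.
Qed.

End concentrated.

Section fourier_recursion.
Context (R : realType) (d N : nat) (A : 'M[int]_d) (u : 'I_N -> 'cV[R]_d).
Local Notation V := (borel 'cV[R]_d).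
Local Notation AR := (map_mx intr A : 'M[R]_d).
Local Notation B := (invmx AR).
Local Notation T := (ifs_map A u).
Context (N_gt0 : (0 < N)%N) (nu : probability V R).
Context (nuT : is_self_similar T nu).

(* The squared modulus of N^-1 sum_j exp (i <r, u j>). *)
Definition mask r := (N%:R^-1 * \sum_j cos (pairing r (u j))) ^+ 2 +
  (N%:R^-1 * \sum_j sin (pairing r (u j))) ^+ 2.

(** The addition formulas give the real and imaginary parts of the product of p(r) and the transform
    at r B; squared moduli are multiplicative. *)
Lemma fnorm_mask r : fnorm nu r = mask r * fnorm nu (r *m B).
Proof.
have fin : (nu setT < +oo)%E by rewrite probability_setT ltry.
have ic s : nu.-integrable setT (EFin \o (fun x : V => cos (pairing s x))).
  apply: (bounded_integrable _ fin (measurable_cos_pairing s) (M := 1)) => // x.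
  exact: cos_max.
have is' s : nu.-integrable setT (EFin \o (fun x : V => sin (pairing s x))).
  apply: (bounded_integrable _ fin (measurable_sin_pairing s) (M := 1)) => // x.
  exact: sin_max.
have iZ (f : V -> R) a : nu.-integrable setT (EFin \o f) ->
    nu.-integrable setT (EFin \o (fun x => f x * a)).
  by move=> /(integrableZr measurableT a).
have pT j x : pairing r (T j x) = pairing (r *m B) x + pairing r (u j).
  by rewrite /ifs_map pairingD pairing_mulmx.
have cE : fcos nu r = N%:R^-1 * (\sum_j cos (pairing r (u j))) * fcos nu (r *m B) -
    N%:R^-1 * (\sum_j sin (pairing r (u j))) * fsin nu (r *m B).
  rewrite /fcos (self_similar_Rintegral N_gt0 nuT (measurable_cos_pairing r) (M := 1)).
    rewrite -!mulrA -mulrBr; congr (_ * _); rewrite !mulr_suml -sumrB.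
    apply: eq_bigr => j _; under eq_Rintegral do rewrite pT cosD.
    by rewrite RintegralB ?RintegralZr//; [congr (_ - _); exact: mulrC|exact: iZ|exact: iZ].
  by move=> x; exact: cos_max.
have sE : fsin nu r = N%:R^-1 * (\sum_j sin (pairing r (u j))) * fcos nu (r *m B) +
    N%:R^-1 * (\sum_j cos (pairing r (u j))) * fsin nu (r *m B).
  rewrite /fsin (self_similar_Rintegral N_gt0 nuT (measurable_sin_pairing r) (M := 1)).
    rewrite -!mulrA -mulrDr; congr (_ * _); rewrite !mulr_suml -big_split/=.
    apply: eq_bigr => j _; under eq_Rintegral do rewrite pT sinD.
    rewrite RintegralD ?RintegralZr//; [|exact: iZ|exact: iZ].
    by rewrite addrC; congr (_ + _); exact: mulrC.
  by move=> x; exact: sin_max.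
rewrite /fnorm cE sE /mask; ring.
Qed.

Lemma fnorm_mask_prod r n : fnorm nu r =
  (\prod_(k < n) mask (r *m B ^+ k)) * fnorm nu (r *m B ^+ n).
Proof.
elim: n => [|n IH]; first by rewrite big_ord0 mul1r expr0 mulmx1.
by rewrite big_ord_recr/= -mulrA {1}IH fnorm_mask -mulmxA -exprmxSr.
Qed.

End fourier_recursion.

Section lattice_characters.
Context (R : realType) (d : nat) (A : 'M[int]_d) (i0 : 'I_d).
Local Notation AR := (map_mx intr A : 'M[R]_d).
Local Notation B := (invmx AR).
Context (Au : AR \in unitmx).

Lemma cos_sin_2pi_int (k : int) :
  cos (2 * pi * k%:~R) = 1 :> R /\ sin (2 * pi * k%:~R) = 0 :> R.
Proof.
have nat n : cos (2 * pi * n%:R) = 1 :> R /\ sin (2 * pi * n%:R) = 0 :> R.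
  rewrite mulr_natr (mulrC 2) mulr_natr -[_ *+ n]add0r.
  by rewrite (periodicn (@cosD2pi R)) (periodicn (@sinD2pi R)) cos0 sin0.
case: k => n; first exact: nat.
by rewrite NegzE mulrNz mulrN cosN sinN; have [-> ->] := nat n.+1; rewrite oppr0.
Qed.

Definition dual_vec m : 'rV[R]_d := (2 * pi) *: (delta_mx ord0 i0 *m AR ^+ m).

Lemma dual_vecS m : dual_vec m.+1 *m B = dual_vec m.
Proof. by rewrite -scalemxAl -mulmxA exprmxSr mulmxK. Qed.

Lemma pairing_dual_vec m x : pairing (dual_vec m) (B ^+ m *m x) = 2 * pi * x i0 ord0.
Proof.
rewrite /pairing -scalemxAl mxE -mulmxA (mulmxA (AR ^+ m)) exp_mulmxK// mul1mx.
by rewrite -rowE mxE.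
Qed.

Lemma dual_vec_lattice p m z : (p <= m)%N ->
  cos (pairing (dual_vec m) (lattice_vec R A p z)) = 1 /\
  sin (pairing (dual_vec m) (lattice_vec R A p z)) = 0.
Proof.
move=> pm; rewrite (lattice_vec_lift Au p (m - p)) subnKC//.
by rewrite /lattice_vec pairing_dual_vec !mxE; exact: cos_sin_2pi_int.
Qed.

End lattice_characters.

Section overlap_dense.
Context (R : realType) (d N : nat) (A : 'M[int]_d) (i0 : 'I_d).
Local Notation AR := (map_mx intr A : 'M[R]_d).
Local Notation B := (invmx AR).
Context (C q : R) (Bg : geometric B C q) (N_gt2 : (2 < N)%N).
Context (Au : AR \in unitmx) (detA : `|\det AR| = N%:R).
Local Notation dual_vec := (@dual_vec R d A i0).
Implicit Types u v : 'I_N -> 'cV[R]_d.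

Let N_gt1 : (1 < N)%N. Proof. exact: ltnW. Qed.
Let N_gt0 : (0 < N)%N. Proof. exact: ltnW. Qed.

(** All cosines but one equal 1 and the remaining one is at least -1, so the real part is at least
    (N - 2) / N. *)
Lemma mask_neq0 u j0 m p : (m <= p)%N ->
  (forall j, j != j0 -> exists y, u j = lattice_vec R A m y) ->
  mask u (dual_vec p) != 0.
Proof.
move=> mp ulat; rewrite gt_eqF// /mask ltr_pwDl ?sqr_ge0// exprn_gt0//.
rewrite mulr_gt0 ?invr_gt0 ?ltr0n// (bigD1 j0)//=.
rewrite (eq_bigr (fun=> 1)) => [|j /ulat[y ->]]; last first.
  by have [] := dual_vec_lattice i0 Au y mp.
rewrite sumr_const cardC1 card_ord.
have := cos_geN1 (pairing (dual_vec p) (u j0)).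
have : 1 < N.-1%:R :> R by rewrite ltr1n -ltnS prednK.
move: (_%:R) (cos _) => a b; lra.
Qed.

Lemma mask_eq1 u p m : (forall j, exists y, u j = lattice_vec R A m y) ->
  (m <= p)%N -> mask u (dual_vec p) = 1.
Proof.
move=> ulat mp; rewrite /mask.
rewrite (eq_bigr (fun=> 1)) => [|j _]; last first.
  by have [y ->] := ulat j; have [] := dual_vec_lattice i0 Au y mp.
rewrite [X in _ + (_ * X) ^+ 2]big1 => [|j _]; last first.
  by have [y ->] := ulat j; have [] := dual_vec_lattice i0 Au y mp.
rewrite sumr_const card_ord mulVf ?pnatr_eq0 -?lt0n//.
by rewrite mulr0 expr0n/= addr0 expr1n.
Qed.

(* Riemann-Lebesgue for the normalized Lebesgue measure of X: the character of
   dual_vec p changes sign under translation by a vector which tends to 0. *)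
Lemma fnorm_dual_vec_small u e : (forall j, lattice_union A (u j)) ->
  ~ exact_overlaps (ifs_map A u) -> 0 < e ->
  exists p0, forall p, (p0 <= p)%N ->
    fnorm (self_similar_measure (ifs_map A u)) (dual_vec p) < e.
Proof.
move=> ulat nov e0.
have quarter : 4^-1 + 4^-1 < 1 :> R by lra.
have [_ lX0 _ nuE] := tiling_caseP Bg N_gt1 Au detA ulat nov.
have Xa := attractor_exists u N_gt0 Bg.
set X := attractor _ in lX0 nuE Xa; set nu := self_similar_measure _ in nuE *.
have [cX _ _] := Xa; have clX := closed_compact_cV cX.
have mX := measurable_borel_closed clX.
have [r r0 Xr] := compact_bounded_cV cX.
have lXfin : (lebesgue_cV X < +oo)%E by exact: (lebesgue_bounded_fin (r := r)).
have lE : lebesgue_cV X = (fine (lebesgue_cV X))%:E by rewrite fineK// ge0_fin_numE.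
set l := fine _ in lE; have l0 : 0 < l by rewrite -lte_fin -lE.
(* As [t <= 1] and [t <= e / 4], the squares of the real and imaginary parts are at most [e / 4]
   each. *)
pose t := Num.min 1 (e / 4).
have t0 : 0 < t by rewrite lt_min ltr01 divr_gt0.
have tfin : (lebesgue_cV (thick X 1) < +oo)%E.
  apply: (lebesgue_bounded_fin (r := r + 1)); first exact: measurable_thick.
  move=> y [x Xx xy]; rewrite -[y](subrK x) addrC (le_trans (ler_normD _ _))//.
  by rewrite lerD ?Xr// distrC ltW.
have lt1 : (lebesgue_cV X < (l + l * t)%:E)%E by rewrite lE lte_fin ltrDl mulr_gt0.
have [h h0 hX] := measure_thick_lt clX tfin lt1.
(* Half a unit vector: B^p x0 shifts the angle by pi, which changes the sign of both cosine and
   sine. *)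
pose x0 : 'cV[R]_d := 2^-1 *: delta_mx i0 ord0.
have [p0 small] := geometric_small Bg (normr_ge0 x0) h0.
exists p0 => p pp.
have px : pairing (dual_vec p) (B ^+ p *m x0) = pi.
  by rewrite pairing_dual_vec// !mxE !eqxx mulr1 mulrAC divff ?mul1r.
have bound (g : R -> R) : measurable_fun setT (fun x : borel 'cV[R]_d => g (pairing (dual_vec p) x)) ->
    (forall x, `|g x| <= 1) -> alternating g pi ->
    `|Rintegral nu setT (fun x => g (pairing (dual_vec p) x))| <= t.
  move=> mg g1 gpi.
  rewrite (Rintegral_normalized mX _ nuE mg (M := 1)) ?lX0//.
  rewrite normrM gtr0_norm ?invr_gt0// ler_pdivrMl//.
  apply: (antiperiodic_Rintegral (h := B ^+ p *m x0) (e := h)) => //.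
  - exact: small.
  - by rewrite lE -EFinD ltW.
  - by move=> x; rewrite pairingD px gpi.
have fc := bound cos (measurable_cos_pairing _) (@cos_max R) (@cosDpi R).
have fs := bound sin (measurable_sin_pairing _) (@sin_max R) (@sinDpi R).
have sq a : `|a| <= t -> a ^+ 2 <= e / 4.
  move=> at'; rewrite -(real_normK (num_real a)) expr2 -[e / 4]mul1r ler_pM//.
  - by rewrite (le_trans at')// ge_min lexx.
  - by rewrite (le_trans at')// ge_min lexx orbT.
rewrite /fnorm (le_lt_trans (lerD (sq _ fc) (sq _ fs)))//.
by rewrite -mulrDr gtr_pMr.
Qed.

(* Without exact overlaps the Fourier transform at dual_vec p would be constant
   and non-zero for large p, since mask u (dual_vec p) is then 1. *)
Lemma exact_overlaps_of_mask u m k0 j0 : (forall j, lattice_union A (u j)) ->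
  (forall j, j != j0 -> exists y, u j = lattice_vec R A m y) ->
  (forall x, attractor (ifs_map A u) x -> `|pairing (dual_vec m *m B ^+ k0) x| < 1) ->
  (forall k, (k < k0)%N -> mask u (dual_vec m *m B ^+ k) != 0) ->
  exact_overlaps (ifs_map A u).
Proof.
move=> ulat ulatm Xsmall mask0; apply: contrapT => nov.
have [nu0 nuT0] := self_similar_exists u Bg N_gt0.
have nuT : is_self_similar (ifs_map A u) (self_similar_measure (ifs_map A u)) by exact: getI nuT0.
have Xa := attractor_exists u N_gt0 Bg.
have [cX _ _] := Xa; have mX := measurable_borel_closed (closed_compact_cV cX).
have nuX := self_similar_support Bg N_gt0 nuT Xa.
set nu := self_similar_measure _ in nuT nuX.
pose f p := fnorm nu (dual_vec p).
have f_ge0 p : 0 <= f p by rewrite addr_ge0 ?sqr_ge0.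
have fS p : f p.+1 = mask u (dual_vec p.+1) * f p.
  by rewrite /f (fnorm_mask N_gt0 nuT) dual_vecS.
(* Multiplying by B [k0] times leads from [dual_vec m] to a vector whose pairing with X is small,
   where the transform does not vanish; the masks met on the way are non-zero by assumption. *)
have fm : f m != 0.
  rewrite /f (fnorm_mask_prod N_gt0 nuT _ k0) mulf_neq0//; last first.
    by rewrite gt_eqF// (fnorm_gt0 mX nuX).
  by apply/prodf_neq0 => k _; exact: mask0.
have fp p : f (m + p)%N != 0.
  elim: p => [|p IH]; first by rewrite addn0.
  rewrite addnS fS mulf_neq0//; apply: mask_neq0 ulatm.
  by rewrite -addnS leq_addr.
have [L uL] := lattice_common_level Au ulat.
have fL p : f (m + L + p)%N = f (m + L)%N.
  elim: p => [|p IH]; first by rewrite addn0.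
  rewrite addnS fS IH (mask_eq1 uL) ?mul1r//.
  by rewrite addnAC leqW// leq_addl.
have fL0 : 0 < f (m + L)%N by rewrite lt_neqAle eq_sym fp f_ge0.
have [p0 small] := fnorm_dual_vec_small ulat nov fL0.
have := small (m + L + p0)%N (leq_addl _ _).
by rewrite -/(f _) fL ltxx.
Qed.

(* The excluded set is closed and contains no point x + t h, 0 < t < pi,
   together with x. *)
Lemma avoid_trigonometric (W : set 'cV[R]_d) (s : 'rV[R]_d) (h : 'cV[R]_d) (a b : R) :
  pairing s h = 1 -> open W -> W !=set0 ->
  exists W', [/\ open W', W' !=set0, W' `<=` W &
    forall x, W' x -> ~ (cos (pairing s x) + a = 0 /\ sin (pairing s x) + b = 0)].
Proof.
move=> sh oW [x Wx].
have cs : continuous (pairing s).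
  move=> y; have [K K0 sK] := pairing_bound s.
  apply/(@cvgrPdist_lt _ _ _ _ (nbhs_filter y)) => e e0.
  apply/nbhs_ballP; exists (e / K) => /=; first exact: divr_gt0.
  move=> z; rewrite cV_ballE ltr_pdivlMr// mulrC; apply: le_lt_trans.
  by rewrite (_ : pairing s y - _ = pairing s (y - z)) ?sK// pairingD -(scaleN1r z) pairingZ mulN1r.
have cont (g : R -> R) c : continuous g -> closed [set x | g (pairing s x) + c = 0].
  move=> cg; rewrite (_ : [set x | _] = (g \o pairing s) @^-1` [set - c]).
    apply: closed_comp; last exact: closed_eq.
    by move=> y _; apply: continuous_comp; [exact: cs|exact: cg].
  apply/seteqP; split=> y /= yc; first by apply/eqP; rewrite -addr_eq0 yc.
  by rewrite yc addNr.
pose Z := [set x | cos (pairing s x) + a = 0] `&` [set x | sin (pairing s x) + b = 0].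
have cZ : closed Z.
  by apply: closedI; apply: cont; [exact: continuous_cos|exact: continuous_sin].
exists (W `&` ~` Z); split => //; last by move=> y [_ Zy] [ya yb]; exact: Zy.
  by apply: openI => //; exact: closed_openC.
have [Zx|nZx] := pselect (Z x); last by exists x.
have : nbhs x W by exact: open_nbhs_nbhs.
move=> /nbhs_ballP[e /= e0 eW].
pose t := Num.min 1 (e / (2 * (1 + `|h|))).
have h1 : 0 < 1 + `|h| by rewrite ltr_pwDl.
have t0 : 0 < t by rewrite lt_min ltr01 divr_gt0// mulr_gt0.
exists (x + t *: h); split.
  apply: eW; rewrite cV_ballE opprD addrA subrr add0r normrN normrZ gtr0_norm//.
  apply: (@le_lt_trans _ _ (e / (2 * (1 + `|h|)) * (1 + `|h|))).
    by rewrite ler_pM ?(ltW t0)// ?ge_min ?lexx ?orbT// lerDr.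
  by rewrite invfM mulrA divfK ?gt_eqF// ltr_pdivrMr// mulr_natr mulr2n ltrDl.
move=> -[]; have [/= xa xb] := Zx; rewrite /= pairingD pairingZ sh mulr1 => ya yb.
set y := pairing s x in xa xb ya yb.
(* If the shifted point also lay in [Z], cosine and sine would agree at [y] and [y + t], forcing cos
   t = 1, although 0 < t < pi. *)
have ct : cos t = 1.
  have -> : cos t = cos ((y + t) - y) by congr cos; rewrite addrAC subrr add0r.
  have := cos2Dsin2 y; rewrite cosB.
  rewrite -(addIr _ (etrans ya (esym xa))) -(addIr _ (etrans yb (esym xb))).
  by rewrite !expr2.
have st : 0 < sin t.
  apply: sin_gt0_pi; rewrite t0/=; apply: (@le_lt_trans _ _ 1); first by rewrite ge_min lexx.
  by apply: lt_le_trans (pi_ge2 _); rewrite ltr1n.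
have := cos2Dsin2 t; rewrite ct expr1n => /eqP.
by rewrite -subr_eq0 addrAC subrr add0r sqrf_eq0 gt_eqF.
Qed.

Lemma avoid_trigonometrics (W : set 'cV[R]_d) (s : nat -> 'rV[R]_d)
    (h : nat -> 'cV[R]_d) (a b : nat -> R) n :
  (forall k, pairing (s k) (h k) = 1) -> open W -> W !=set0 ->
  exists W', [/\ open W', W' !=set0, W' `<=` W & forall k x, (k < n)%N -> W' x ->
    ~ (cos (pairing (s k) x) + a k = 0 /\ sin (pairing (s k) x) + b k = 0)].
Proof.
move=> sh oW W0; elim: n => [|n [W' [oW' W'0 W'W avoid]]]; first by exists W; split.
have [W2 [oW2 W20 W2W' avoid2]] := avoid_trigonometric (a n) (b n) (sh n) oW' W'0.
exists W2; split => // [x /W2W'/W'W//|k x]; rewrite ltnS leq_eqVlt => /predU1P[->|kn] W2x.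
  exact: avoid2.
by apply: avoid => //; exact: W2W'.
Qed.

Lemma overlap_dense v e : 0 < e -> exists u, [/\ forall j, lattice_union A (u j),
  forall j, `|v j - u j| < e & exact_overlaps (ifs_map A u)].
Proof.
move=> e0; pose j0 : 'I_N := Ordinal N_gt0.
have [m /(_ m (leqnn m)) approx] := lattice_approx Bg Au e0.
have /choice[w vw] : forall j, exists w, `|v j - lattice_vec R A m w| < e.
  by move=> j; have [y vy] := approx (v j) 0; exists (0 + A *m y).
(* Bounds every admissible choice of translations, so that [k0] can be fixed before the last
   translation is chosen. *)
pose U := \sum_j `|v j| + e.
have U0 : 0 <= U by rewrite addr_ge0 ?sumr_ge0// ltW.
have vU (u : 'I_N -> 'cV[R]_d) j : `|v j - u j| < e -> `|u j| <= U.
  move=> vu; rewrite -[u j](subrK (v j)) addrC (le_trans (ler_normD _ _))//.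
  rewrite lerD//; last by rewrite distrC ltW.
  by rewrite (bigD1 j)//= lerDl sumr_ge0.
have [C0 q0 q1 _] := Bg.
have rho0 : 0 <= C * U / (1 - q).
  by rewrite divr_ge0 ?subr_ge0 ?(ltW q1)// mulr_ge0// ltW.
have [K K0 rK] := pairing_bound (dual_vec m).
have K10 : 0 < K^-1 by rewrite invr_gt0.
have [k0 small] := geometric_small Bg rho0 K10.
pose s k := dual_vec m *m B ^+ k.
(* The direction along which the character of [s k] moves at unit speed. *)
pose h k := (2 * pi)^-1 *: (AR ^+ k *m (B ^+ m *m delta_mx i0 ord0)) : 'cV[R]_d.
have sh k : pairing (s k) (h k) = 1.
  rewrite pairingZ /s -pairing_mulmx mulmxA exp_invmxK// mul1mx pairing_dual_vec//.
  by rewrite mxE !eqxx mulr1 mulVf// mulf_neq0// gt_eqF// pi_gt0.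
(* Only the translation [j0] is still free. In terms of it, the mask at [s k] vanishes exactly when
   the cosine cancels [a k] and the sine cancels [b k]. *)
pose u x j := if j == j0 then x else lattice_vec R A m (w j).
pose a k := \sum_(j | j != j0) cos (pairing (s k) (lattice_vec R A m (w j))).
pose b k := \sum_(j | j != j0) sin (pairing (s k) (lattice_vec R A m (w j))).
have oB : open (ball (v j0) e : set 'cV[R]_d) by exact: ball_open.
have [|W [oW [x Wx] WB avoid]] :=
    avoid_trigonometrics a b k0 sh oB.
  by exists (v j0); exact: ballxx.
have : nbhs x W by exact: open_nbhs_nbhs.
move=> /nbhs_ballP[e' /= e'0 xW].
(* The free translation may need a finer lattice than the level [m] used for the others. *)
have [m1 /(_ m1 (leqnn m1))/(_ x 0)[y xy]] := lattice_approx Bg Au e'0.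
set z := lattice_vec R A m1 _ in xy.
have Wz : W z by apply: xW; rewrite cV_ballE.
have vz : `|v j0 - z| < e by have := WB z Wz; rewrite cV_ballE.
have ulat j : lattice_union A (u z j).
  rewrite /u; case: ifP => _; first by exists m1, (0 + A *m y).
  by exists m, (w j).
have vu j : `|v j - u z j| < e by rewrite /u; case: eqP => [->|].
exists (u z); split => //.
apply: (@exact_overlaps_of_mask (u z) m k0 j0) => //.
- by move=> j /negPf jj0; exists (w j); rewrite /u jj0.
- move=> p Xp; rewrite -pairing_mulmx (le_lt_trans (rK _))//.
  rewrite mulrC -ltr_pdivlMr// mul1r; apply: small => //.
  apply: (attractor_bound (attractor_exists (u z) N_gt0 Bg) Bg U0) Xp => j.
  exact: vU.
- move=> k kk0; apply/negP; rewrite /mask paddr_eq0 ?sqr_ge0//.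
  rewrite !sqrf_eq0 !mulf_eq0 invr_eq0 pnatr_eq0 gtn_eqF//= => /andP[].
  have split g : \sum_j g (pairing (s k) (u z j)) = g (pairing (s k) z) +
      \sum_(j | j != j0) g (pairing (s k) (lattice_vec R A m (w j))) :> R.
    rewrite (bigD1 j0)//= {1}/u eqxx; congr (_ + _).
    by apply: eq_bigr => j /negPf jj0; rewrite /u jj0.
  rewrite -/(s k) !split => /eqP cz /eqP sz; exact: (avoid k z kk0 Wz).
Qed.

End overlap_dense.

(** * Density in the product and subspace topologies *)

Section pointwise_density.
Context (R : realType) (d N : nat).
Implicit Types P : ('I_N -> 'cV[R]_d) -> Prop.

(** Approximations with error below 1/(k+1) converge to [u] in every coordinate, hence in the
    product topology, and eventually enter [O]. *)
Lemma ptws_open_approx P (O : set {ptws 'I_N -> 'cV[R]_d}) u :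
  (forall (u : 'I_N -> 'cV[R]_d) e, 0 < e -> exists u', P u' /\ forall j, `|u j - u' j| < e) ->
  open O -> O u -> exists2 u', P u' & O u'.
Proof.
move=> approx oO Ou.
have /choice[f fP] : forall k : nat, exists u', P u' /\ forall j, `|u j - u' j| < k.+1%:R^-1.
  by move=> k; apply: approx; rewrite invr_gt0.
have fu : {ptws, (f k @[k --> \oo]) --> u}.
  apply/cvg_sup => j W; rewrite /=.
  rewrite (@nbhsE (initial_topology (fun f : 'I_N -> 'cV[R]_d => f j))) => -[W' [[D oD DW'] W'u] W'W].
  have : nbhs (u j) D by apply: open_nbhs_nbhs; split=> //; rewrite -DW' in W'u.
  move=> /nbhs_ballP[e /= e0 eD].
  suff : \forall k \near \oo, W (f k) by [].
  near=> k; apply: W'W; rewrite -DW'; apply: eD; rewrite cV_ballE.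
  have [_ /(_ j)] := fP k; move=> /lt_trans; apply.
  by near: k; exact: near_infty_natSinv_lt (PosNum e0).
have [k _ kO] : \forall k \near \oo, O (f k).
  by apply: fu; exact: open_nbhs_nbhs.
exists (f k); first by have [] := fP k.
exact: (kO k (leqnn k)).
Unshelve. all: by end_near. Qed.

Lemma dense_ptws P :
  (forall (u : 'I_N -> 'cV[R]_d) e, 0 < e -> exists u', P u' /\ forall j, `|u j - u' j| < e) ->
  dense [set u : {ptws 'I_N -> 'cV[R]_d} | P u].
Proof.
move=> approx O [u Ou] oO.
by have [u' Pu' Ou'] := ptws_open_approx approx oO Ou; exists u'.
Qed.

Lemma dense_lattice_tuples (A : 'M[int]_d) P :
  (forall (u : 'I_N -> 'cV[R]_d) e, 0 < e -> exists u',
    ((forall j, lattice_union A (u' j)) /\ P u') /\ forall j, `|u j - u' j| < e) ->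
  dense [set u : lattice_tuples R N A | P (set_val u : 'I_N -> 'cV[R]_d)].
Proof.
move=> approx O [u Ou] [D oD DO].
have Du : D (set_val u) by move: Ou; rewrite -DO.
have [u' [lu' Pu'] Ou'] := ptws_open_approx approx oD Du.
have lu : u' \in lattice_tuples R N A by rewrite inE.
exists (SigSub lu); split => //.
by rewrite -DO.
Qed.

End pointwise_density.

(** * Expanding matrices and the dichotomy *)

Section expanding.
Context (R : realType) (d : nat) (A : 'M[int]_d).
Local Notation AR := (map_mx intr A : 'M[R]_d).
Context (A_expanding : forall z : R[i],
  eigenvalue (map_mx intr A : 'M[R[i]]_d) z -> 1 < `|z|).

Lemma eigenvalue_invmx_lt1 (z : R[i]) : AR \in unitmx ->
  eigenvalue (map_mx (real_complex R) (invmx AR)) z -> `|z| < 1.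
Proof.
move=> Au /eigenvalueP[v vz v0].
have [->|z0] := eqVneq z 0; first by rewrite normr0 ltr01.
have AE : map_mx (real_complex R) AR = map_mx intr A.
  by apply/matrixP => i j; rewrite !mxE rmorph_int.
rewrite -[z]invrK normfV invf_lt1 ?normr_gt0 ?invr_neq0//.
apply: A_expanding; apply/eigenvalueP; exists v => //.
rewrite -AE; apply: (scalerI z0); rewrite scalerA mulfV// scale1r.
by rewrite scalemxAl -vz -mulmxA -map_mxM mulVmx// map_mx1 mulmx1.
Qed.

Lemma geometric_invmx : (0 < d)%N -> AR \in unitmx ->
  exists C q : R, geometric (invmx AR) C q.
Proof.
move=> d0 Au.
have [C [q [C0 q0 q1 Cq]]] :=
  exp_geometric_bound d0 (fun z => @eigenvalue_invmx_lt1 z Au).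
(* The factor [d] passes from a bound on entries to one on row sums. *)
exists (C * d%:R), q; split => // [|k x]; first by rewrite mulr_gt0 ?ltr0n.
apply: mulmx_norm_le => i; apply: (le_trans (ler_sum _ (fun j _ => Cq k i j))).
by rewrite sumr_const card_ord -[_ *+ d]mulr_natr mulrAC.
Qed.

End expanding.

Theorem theorem1 (R : realType) (d : nat) (A : 'M[int]_d) (N : nat)
    (d_gt0 : (0 < d)%N)
    (A_expanding : forall z : R[i],
       eigenvalue (map_mx intr A : 'M[R[i]]_d) z -> 1 < `|z|)
    (N_def : N = `|\det A|%N)
    (N_gt2 : (2 < N)%N) :
  [/\ forall u : 'I_N -> 'cV[R]_d, (forall j, lattice_union A (u j)) ->
        (tiling_case A u /\ ~ overlap_case A u) \/
        (overlap_case A u /\ ~ tiling_case A u),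
      dense [set u : lattice_tuples R N A | tiling_case A (set_val u : 'I_N -> 'cV[R]_d)] /\
      dense [set u : lattice_tuples R N A | overlap_case A (set_val u : 'I_N -> 'cV[R]_d)] &
      dense [set u : {ptws 'I_N -> 'cV[R]_d} | tiling_case A (u : 'I_N -> 'cV[R]_d)] /\
      dense [set u : {ptws 'I_N -> 'cV[R]_d} | overlap_case A (u : 'I_N -> 'cV[R]_d)]].

Proof.
have N_gt1 : (1 < N)%N := ltnW N_gt2.
have detE : `|\det (map_mx intr A : 'M[R]_d)| = N%:R.
  by rewrite det_map_mx N_def natr_absz intr_norm.
have Au : (map_mx intr A : 'M[R]_d) \in unitmx.
  by rewrite unitmxE unitfE -normr_gt0 detE ltr0n ltnW.
have [C [q Bg]] := geometric_invmx A_expanding d_gt0 Au.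
have tiling (u : 'I_N -> 'cV[R]_d) : (forall j, lattice_union A (u j)) -> ~ exact_overlaps (ifs_map A u) ->
    tiling_case A u.
  by move=> lu nov; exact: (tiling_caseP Bg N_gt1 Au detE lu nov).
have overlap (u : 'I_N -> 'cV[R]_d) : exact_overlaps (ifs_map A u) -> overlap_case A u.
  by move=> ov; exact: (overlap_caseP Bg N_gt1 Au detE ov).
have dense_t (u : 'I_N -> 'cV[R]_d) e : 0 < e -> exists u',
    ((forall j, lattice_union A (u' j)) /\ tiling_case A u') /\ forall j, `|u j - u' j| < e.
  move=> /(no_overlap_dense Bg N_gt1 Au detE N_def u)[u' [lu uu' nov]].
  by exists u'; do 2!split => //; exact: tiling.
have dense_o (u : 'I_N -> 'cV[R]_d) e : 0 < e -> exists u',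
    ((forall j, lattice_union A (u' j)) /\ overlap_case A u') /\ forall j, `|u j - u' j| < e.
  move=> /(overlap_dense (Ordinal d_gt0) Bg N_gt2 Au detE u)[u' [lu uu' ov]].
  by exists u'; do 2!split => //; exact: overlap.
have weaken P :
    (forall (u : 'I_N -> 'cV[R]_d) e, 0 < e -> exists u',
      ((forall j, lattice_union A (u' j)) /\ P u') /\ forall j, `|u j - u' j| < e) ->
    forall (u : 'I_N -> 'cV[R]_d) e, 0 < e -> exists u', P u' /\ forall j, `|u j - u' j| < e.
  by move=> h u e /(h u)[u' [[_ Pu'] uu']]; exists u'.
split.
- move=> u lu; have [ov|nov] := pselect (exact_overlaps (ifs_map A u)).
    right; split=> [|tu]; first exact: overlap.
    exact: tiling_overlap_exclusive tu (overlap _ ov).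
  left; split=> [|ou]; first exact: tiling.
  exact: tiling_overlap_exclusive (tiling _ lu nov) ou.
- by split; apply: dense_lattice_tuples.
- by split; apply: dense_ptws; exact: weaken.
Qed.
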